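(* Let $\kappa>0$, $\rho>0$, $\delta>0$ and $0<\alpha<1$, and let $\mathbf v_0,\mathbf v_1\in\mathcal S(\mathbb R^2)$ (Schwartz class, $\mathbb R^2$-valued). Then the linear peridynamic initial value problem $$\begin{cases}\rho\,\partial_{tt}\mathbf u(t,\mathbf x)=(K\mathbf u(t,\cdot))(\mathbf x), & \mathbf x\in\mathbb R^2,\ t>0,\\ \mathbf u(0,\mathbf x)=\mathbf v_0(\mathbf x),\quad \partial_t\mathbf u(0,\mathbf x)=\mathbf v_1(\mathbf x), & \mathbf x\in\mathbb R^2,\end{cases}$$ with $$(K\mathbf u(t,\cdot))(\mathbf x)=-2\kappa\int_{B_\delta(0)}\frac{\mathbf u(t,\mathbf x)-\mathbf u(t,\mathbf x-\mathbf y)}{|\mathbf y|^{2+2\alpha}}\,d\mathbf y,$$ has the unique solution $\mathbf u:\mathbb R^+\times\mathbb R^2\to\mathbb R^2$ given by $$\mathbf u(t,\mathbf x)=\int_{\mathbb R^2}e^{-i\boldsymbol\xi\cdot\mathbf x}\left[\widehat{\mathbf v_0}(\boldsymbol\xi)\cos(\omega(\xi)t)+\frac{\widehat{\mathbf v_1}(\boldsymbol\xi)}{\omega(\xi)}\sin(\omega(\xi)t)\right]d\boldsymbol\xi,$$ where $\xi=|\boldsymbol\xi|$, $\widehat{\mathbf v_0}$ and $\widehat{\mathbf v_1}$ are the Fourier transforms of $\mathbf v_0$ and $\mathbf v_1$, and $\omega:\mathbb R^+\to\mathbb R^+$ is the dispersion relation $$\omega(\xi)=\left(\frac{4\pi\kappa}{\rho\,\delta^{2\alpha}}\int_0^1\frac{1-J_0(\xi\delta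 z)}{z^{1+2\alpha}}\,dz\right)^{1/2},$$ with $J_0$ the $0$-th order Bessel function of the first kind.
   Context: Fourier transform convention on $\mathbb R^N$ (applied componentwise): $\widehat{\mathbf v}(\boldsymbol\xi):=\frac{1}{(2\pi)^N}\int_{\mathbb R^N}\mathbf v(\mathbf x)e^{i\mathbf x\cdot\boldsymbol\xi}\,d\mathbf x$, with inversion $\mathbf v(\mathbf x)=\int_{\mathbb R^N}\widehat{\mathbf v}(\boldsymbol\xi)e^{-i\boldsymbol\xi\cdot\mathbf x}\,d\boldsymbol\xi$; here $N=2$. Bold letters denote vectors; the corresponding non-bold letter denotes the modulus. $B_\delta(0)$ is the ball of radius $\delta$ centered at the origin. The operator $K$ is the case $N=2$, $p=2$, $\Psi=0$ of the peridynamic operator $\int_{B_\delta(\mathbf x)}\mathbf f(\mathbf x'-\mathbf x,\mathbf u(\mathbf x')-\mathbf u(\mathbf x))\,d\mathbf x'$ with $\mathbf f=\nabla_{\mathbf u}\Phi$, $\Phi(\mathbf y,\mathbf u)=\kappa\frac{|\mathbf u|^p}{|\mathbf y|^{N+\alpha p}}+\Psi(\mathbf y,\mathbf u)$.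
   Formalization: The integral defining K is read as a principal value, and ''unique solution'' means unique among classical solutions, C² in x, whose x-derivatives of order at most 2 grow at most polynomially, locally uniformly in t; with no growth condition uniqueness fails. *)

(* Defs.v *)
From HB Require Import structures.
From mathcomp Require Import all_boot all_order all_algebra.
From mathcomp Require Import all_classical all_reals all_analysis.
From mathcomp Require Import complex.

Set Implicit Arguments.
Unset Strict Implicit.
Unset Printing Implicit Defensive.

Import Order.TTheory GRing.Theory Num.Theory.
Import numFieldNormedType.Exports.

Local Open Scope classical_set_scope.
Local Open Scope ring_scope.
Local Open Scope complex_scope.

Section Plane.
Variable R : realType.
Implicit Types (x y xi : R * R).

(* The join of the pointed and the topological structure, which lim needs, is
   not found for a bare product type. *)
Local Notation V := ((R * R)%type : normedModType R).

Definition dot x y : R := x.1 * y.1 + x.2 * y.2.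

(* Euclidean modulus; the library norm `|x| on R * R is the sup norm. *)
Definition modulus x : R := Num.sqrt (dot x x).

Local Notation mu2 := (@lebesgue_measure R \x @lebesgue_measure R)%E.

Definition vintegral (D : set (R * R)) (F : R * R -> R * R) : R * R :=
  (\int[mu2]_(y in D) (F y).1, \int[mu2]_(y in D) (F y).2).

Definition cintegral (F : R * R -> R[i]) : R[i] :=
  (\int[mu2]_(y in setT) complex.Re (F y)) +i*
  (\int[mu2]_(y in setT) complex.Im (F y)).

Definition cvintegral (F : R * R -> R[i] * R[i]) : R[i] * R[i] :=
  (cintegral (fun y => (F y).1), cintegral (fun y => (F y).2)).

(* The inclusion of R^2 in C^2. *)
Definition cvec x : R[i] * R[i] := (x.1%:C, x.2%:C).

(* exp (i theta) for real theta. *)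
Definition expi (theta : R) : R[i] := cos theta +i* sin theta.

Definition fourier (v : R * R -> R * R) (xi : R * R) : R[i] * R[i] :=
  ((2 * pi) ^- 2)%:C *: cvintegral (fun x => expi (dot x xi) *: cvec (v x)).

(* A word s : seq bool stands for an iterated partial derivative, false being
   the first coordinate direction and true the second one; mixed derivatives
   taken in different orders are different words. *)
Definition basis_vector (i : bool) : R * R := if i then (0, 1) else (1, 0).

Fixpoint pderiv (s : seq bool) (f : R * R -> R * R) : R * R -> R * R :=
  if s is i :: s' then fun x => 'D_(basis_vector i) (pderiv s' f) x else f.

Definition Cn (n : nat) (f : R * R -> R * R) : Prop :=
  forall s : seq bool,
    ((size s < n)%N -> forall i x, derivable (pderiv s f) x (basis_vector i)) /\
    ((size s <= n)%N -> continuous (pderiv s f)).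

Definition schwartz (f : R * R -> R * R) : Prop :=
  (forall n, Cn n f) /\
  forall (a b : nat) (s : seq bool), exists C : R, forall x,
    modulus ((x.1 ^+ a * x.2 ^+ b) *: pderiv s f x) <= C.

(* Derivative relative to the half-line [0, +oo[: the ordinary derivative for
   t > 0 and the right derivative for t = 0. Values at negative times are
   irrelevant. *)
Definition time_quotient (g : R -> R * R) (t : R) : R -> V :=
  fun s => (s - t)^-1 *: (g s - g t).

Definition time_derivable (g : R -> R * R) (t : R) : Prop :=
  cvg (time_quotient g t @ within [set s | 0 <= s] t^').

Definition time_deriv (g : R -> R * R) (t : R) : R * R :=
  lim (time_quotient g t @ within [set s | 0 <= s] t^').

(* The integrand of K is not absolutely integrable at y = 0 for 1/2 <= alpha,
   even for smooth f, so the integral over the ball is a principal value. For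
   f of class C^2 and alpha < 1/2 it is the Lebesgue integral. *)
Definition K_truncated (kappa delta alpha : R) (f : R * R -> R * R) (x : R * R)
    (eps : R) : V :=
  (- 2 * kappa) *:
    vintegral [set y | eps <= modulus y < delta]
      (fun y => (modulus y `^ (2 + 2 * alpha))^-1 *: (f x - f (x - y))).

Definition K_defined (kappa delta alpha : R) (f : R * R -> R * R) (x : R * R) :
    Prop :=
  cvg (K_truncated kappa delta alpha f x eps @[eps --> 0^'+]).

Definition K (kappa delta alpha : R) (f : R * R -> R * R) (x : R * R) : R * R :=
  lim (K_truncated kappa delta alpha f x eps @[eps --> 0^'+]).

(* Without a growth condition in space the problem has Tychonoff-type nonzero
   solutions with zero data. *)
Definition slowly_increasing (u : R -> R * R -> R * R) : Prop :=
  forall T : R, exists (C : R) (m : nat), forall t x (s : seq bool),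
    0 <= t <= T -> (size s <= 2)%N ->
    modulus (pderiv s (u t) x) <= C * (1 + modulus x) ^+ m.

Record peridynamic_solution (kappa rho delta alpha : R)
    (v0 v1 : R * R -> R * R) (u : R -> R * R -> R * R) : Prop := {
  sol_C2_space : forall t, 0 <= t -> Cn 2 (u t);
  sol_growth : slowly_increasing u;
  sol_dt : forall t x, 0 <= t -> time_derivable (u ^~ x) t;
  sol_dtt : forall t x, 0 < t -> time_derivable (time_deriv (u ^~ x)) t;
  sol_K : forall t x, 0 < t -> K_defined kappa delta alpha (u t) x;
  sol_eq : forall t x, 0 < t ->
    rho *: time_deriv (time_deriv (u ^~ x)) t = K kappa delta alpha (u t) x;
  sol_init : forall x, u 0 x = v0 x;
  sol_init_dt : forall x, time_deriv (u ^~ x) 0 = v1 x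
}.

Definition bessel_J0 (r : R) : R :=
  limn (series (fun m : nat => (- 1) ^+ m / (m`!%:R ^+ 2) * (r / 2) ^+ (2 * m))).

Definition omega (kappa rho delta alpha : R) (xi : R) : R :=
  Num.sqrt (4 * pi * kappa / (rho * delta `^ (2 * alpha)) *
    \int[@lebesgue_measure R]_(z in `[0, 1])
      ((1 - bessel_J0 (xi * delta * z)) / z `^ (1 + 2 * alpha))).

(* At the single frequency xi = 0, where omega vanishes, the quotient by omega
   is 0 by the library's convention; this does not affect the integral. *)
Definition solution_formula (kappa rho delta alpha : R)
    (v0 v1 : R * R -> R * R) (t : R) (x : R * R) : R[i] * R[i] :=
  cvintegral (fun xi =>
    let w := omega kappa rho delta alpha (modulus xi) in
    expi (- dot xi x) *:
      ((cos (w * t))%:C *: fourier v0 xi +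
       (sin (w * t) / w)%:C *: fourier v1 xi)).

End Plane.

(* Main.v *)
(* In the Fourier variable, K is multiplication by -rho omega ^ 2: the integral of
   (1 - cos (xi . y)) / |y| ^ (2 + 2 alpha) over an annulus is computed by
   expanding the cosine, the moments of (xi . y) ^ (2 m) over discs being
   determined by scaling up to a constant that is read off from the Gaussian.
   Hence the formula, written with real sine and cosine transforms, may be
   differentiated under the integral sign and solves the equation; the initial
   data come from Fourier inversion, which is proved by Gaussian regularisation.

   For uniqueness, let d be a component of the difference of two solutions and
   let W_{2k} stand for the convolutions of d with derivatives of order 2k of a
   Gaussian. The second difference in y bounds K W_{2k} by W_{2k+2}, so
   |W_{2k}''| <= A |W_{2k+2}| in a weighted sup norm; integrating twice in time
   from zero data, N times over, gives |W_0| <= C (A t ^ 2) ^ N N! / (2 N)!, the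
   factor N! being the size of the Gaussian derivatives of order 2N. Let N tend
   to infinity, and then the width of the Gaussian tend to 0. *)
Require Import Defs.
From HB Require Import structures.
From mathcomp Require Import all_boot all_order all_algebra.
From mathcomp Require Import all_classical all_reals all_analysis.
From mathcomp Require Import measurable_realfun complex ring lra.
Set Implicit Arguments.
Unset Strict Implicit.
Unset Printing Implicit Defensive.
Import Order.TTheory GRing.Theory Num.Theory.
Import numFieldNormedType.Exports.
Local Open Scope classical_set_scope.
Local Open Scope ring_scope.

(** * Integration on the plane *)

Section DominatedConvergence.
Context d {T : measurableType d} {R : realType} {mu : {measure set T -> \bar R}}.

(** J_0 is given by its power series, so it is matched with the symbol coefficient by coefficient,
    without angular integration: a radial factor is integrated against a disc moment by
    differentiating in the radius. The kernel |y|^(- 2 - 2 alpha) is tamed by quadratic smallness,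
    of 1 - cos on the frequency side and of the symmetric second difference on the space side. Both
    leave |y|^(- 2 alpha), integrable in the plane because alpha < 1, with bounds uniform in the
    truncation. A competing solution is only known to grow polynomially, so it has no Fourier
    transform as a function, and K is unbounded, so a plain Gronwall argument loses derivatives.
    Convolution moves this loss to the Gaussian, whose derivatives grow slowly enough to leave a
    margin. The finite horizon delta keeps a polynomial weight stable under K up to a constant.
    Fubini applies to the truncated operator only; commutation with convolution is proved there and
    then passed to the limit. *)

Lemma dominated_integrable_real (D : set T) (f g : T -> R) :
  measurable D -> measurable_fun D f -> mu.-integrable D (EFin \o g) ->
  (forall x, D x -> `|f x| <= g x) -> mu.-integrable D (EFin \o f).
Proof.
move=> mD mf ig fg; apply: le_integrable ig => //; first exact/measurable_EFinP.
by move=> x Dx /=; rewrite lee_fin (le_trans (fg _ Dx))// ler_norm.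
Qed.

Lemma dominated_cvg_Rintegral (D : set T) (f_ : nat -> T -> R) (f g : T -> R) :
  measurable D -> (forall n, measurable_fun D (f_ n)) ->
  (forall x, D x -> f_ n x @[n --> \oo] --> f x) ->
  mu.-integrable D (EFin \o g) ->
  (forall n x, D x -> `|f_ n x| <= g x) ->
  (\int[mu]_(x in D) f_ n x) @[n --> \oo] --> \int[mu]_(x in D) f x.
Proof.
move=> mD mf_ ff ig fg.
have mf : measurable_fun D f by exact: (measurable_fun_cvg mf_ ff).
have mEf : measurable_fun D (EFin \o f) by exact/measurable_EFinP.
have mEf_ n : measurable_fun D (EFin \o f_ n) by exact/measurable_EFinP.
have cE x : D x -> (EFin \o f_ n) x @[n --> \oo] --> (EFin \o f) x.
  by move=> Dx; apply/fine_cvgP; split; [exact: nearW|exact: ff].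
have fgE x n : D x -> (`|(EFin \o f_ n) x| <= (EFin \o g) x)%E.
  by move=> Dx; rewrite /= lee_fin; exact: fg.
have [i1 _ i2] := dominated_convergence mD mEf_ mEf (aeW _ cE) ig (aeW _ fgE).
by apply: fine_cvg; rewrite fineK//; exact: integrable_fin_num.
Qed.

End DominatedConvergence.

Local Notation pushforward_measure :=
  measure_function_pushforward__canonical__measure_function_Measure.

(** * Change of variables along a map that scales the measure by a constant *)

Section ChangeOfVariable.
Context d (T : measurableType d) (R : realType) (mu : {measure set T -> \bar R}).
Variables (phi : T -> T) (c : R).
Hypotheses (mphi : measurable_fun setT phi) (c_gt0 : 0 < c).
Hypothesis mu_phi : forall A, measurable A ->
  mu A = (c%:E * mu (phi @^-1` A))%E.

Lemma ge0_integral_change (f : T -> \bar R) :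
  measurable_fun setT f -> (forall x, 0 <= f x)%E ->
  (\int[mu]_x f x = c%:E * \int[mu]_x f (phi x))%E.
Proof.
move=> mf f0.
pose m := pushforward_measure mu mphi.
transitivity (\int[mscale (NngNum (ltW c_gt0)) m]_x f x)%E.
  by apply: eq_measure_integral => A mA _; exact: mu_phi.
rewrite ge0_integral_mscale//; congr (_ * _)%E.
by rewrite (@ge0_integral_pushforward _ _ _ _ _ _ mphi).
Qed.

(** The integral of |f| is c times that of |f o phi|; since c > 0, an infinite second factor would
    make the first one infinite. *)
Lemma integrable_change (f : T -> R) : mu.-integrable setT (EFin \o f) ->
  mu.-integrable setT (EFin \o (f \o phi)).
Proof.
move=> /integrableP[mf fi]; apply/integrableP; split.
  exact: (measurableT_comp mf).
move: fi; rewrite ge0_integral_change//; last exact: measurableT_comp.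
have : (0 <= \int[mu]_x `|(EFin \o (f \o phi)) x|)%E by exact: integral_ge0.
rewrite [X in (_ * X < _)%E](_ : _ = (\int[mu]_x `|(EFin \o (f \o phi)) x|)%E)//.
case: (\int[mu]_x _)%E => //.
  by move=> r _ _; rewrite ltry.
by rewrite mulry gtr0_sg// mul1e.
Qed.

Lemma Rintegral_change (f : T -> R) : mu.-integrable setT (EFin \o f) ->
  \int[mu]_x f x = c * \int[mu]_x f (phi x).
Proof.
move=> intf.
have mf : measurable_fun setT (EFin \o f) by case/integrableP: intf.
have intf' := integrable_change intf.
rewrite /Rintegral integralE.
rewrite (ge0_integral_change (f := (EFin \o f)^\+)%E)//;
  last exact: measurable_funepos.
rewrite (ge0_integral_change (f := (EFin \o f)^\-)%E)//;
  last exact: measurable_funeneg.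
have -> : (fun x => (EFin \o f)^\+ (phi x))%E = (EFin \o (f \o phi))^\+%E.
  by apply/funext => x; rewrite !funeposE.
have -> : (fun x => (EFin \o f)^\- (phi x))%E = (EFin \o (f \o phi))^\-%E.
  by apply/funext => x; rewrite !funenegE.
(* Factoring c out of a difference of extended reals requires that it is not oo - oo; the negative
   part is finite. *)
rewrite -muleBr//; last first.
  apply: fin_num_adde_defl; rewrite fin_numN.
  exact: (integrable_fin_num measurableT (integrable_funeneg measurableT intf')).
rewrite -[in LHS]integralE fineM//.
exact: (integrable_fin_num measurableT intf').
Qed.

End ChangeOfVariable.

(** * Fubini for products and for integrands dominated by a product *)

Section ProductIntegral.
Context d1 d2 (T1 : measurableType d1) (T2 : measurableType d2) (R : realType).
Variables (m1 : {sigma_finite_measure set T1 -> \bar R}).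
Variables (m2 : {sigma_finite_measure set T2 -> \bar R}).

Lemma integrable_prod (f : T1 -> R) (g : T2 -> R) :
  m1.-integrable setT (EFin \o f) -> m2.-integrable setT (EFin \o g) ->
  (m1 \x m2)%E.-integrable setT (EFin \o (fun x => f x.1 * g x.2)).
Proof.
move=> /integrableP[mf fi] /integrableP[mg gi].
have mf' : measurable_fun setT f by exact/measurable_EFinP.
have mg' : measurable_fun setT g by exact/measurable_EFinP.
have mfg : measurable_fun setT (EFin \o (fun x : T1 * T2 => f x.1 * g x.2)).
  apply/measurable_EFinP/measurable_funM.
    exact: (measurableT_comp mf' measurable_fst).
  exact: (measurableT_comp mg' measurable_snd).
apply/integrable12ltyP => //.
rewrite (_ : (fun x => \int[m2]_y _)%E =
    fun x => (`|f x|%:E * \int[m2]_y `|g y|%:E)%E); last first.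
  apply/funext => x.
  rewrite -ge0_integralZl//; last exact/measurable_EFinP/measurableT_comp.
  by apply: eq_integral => y _; rewrite /= normrM EFinM.
rewrite ge0_integralZr//.
- by apply: lte_mul_pinfty => //; [exact: integral_ge0|
    rewrite ge0_fin_numE//; exact: integral_ge0].
- exact/measurable_EFinP/measurableT_comp.
- exact: integral_ge0.
Qed.

Lemma integrable_prod_dominated (f : T1 * T2 -> R) (g : T1 -> R) (h : T2 -> R) :
  measurable_fun setT f ->
  m1.-integrable setT (EFin \o g) -> m2.-integrable setT (EFin \o h) ->
  (forall x y, `|f (x, y)| <= g x * h y) ->
  (m1 \x m2)%E.-integrable setT (EFin \o f).
Proof.
move=> mf ig ih fgh.
apply: (dominated_integrable_real _ mf (integrable_prod ig ih)) => //.
by move=> [x y] _; exact: fgh.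
Qed.

(** Every section is assumed integrable, not almost every one: the inner real integral is [fine] of
    an extended one, and [fine] loses nothing only at finite values. *)
Lemma Rintegral_iter (f : T1 * T2 -> R) :
  (m1 \x m2)%E.-integrable setT (EFin \o f) ->
  (forall x, m2.-integrable setT (EFin \o (fun y => f (x, y)))) ->
  \int[(m1 \x m2)%E]_z f z = \int[m1]_x \int[m2]_y f (x, y).
Proof.
move=> intf int2; rewrite /Rintegral -(integral12_prod_meas1 intf).
congr fine; apply: eq_integral => x _; rewrite /fubini_F /=.
by rewrite fineK//; exact: (integrable_fin_num measurableT (int2 x)).
Qed.

Lemma Rintegral_iter_swap (f : T1 * T2 -> R) :
  (m1 \x m2)%E.-integrable setT (EFin \o f) ->
  (forall y, m1.-integrable setT (EFin \o (fun x => f (x, y)))) ->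
  \int[(m1 \x m2)%E]_z f z = \int[m2]_y \int[m1]_x f (x, y).
Proof.
move=> intf int1; rewrite /Rintegral -(integral21_prod_meas1 intf).
congr fine; apply: eq_integral => y _; rewrite /fubini_G /=.
by rewrite fineK//; exact: (integrable_fin_num measurableT (int1 y)).
Qed.

(** Domination by a product makes both families of sections integrable at every point, so both
    iterated integrals equal the double one. *)
Lemma Rintegral_swap (f : T1 -> T2 -> R) (g : T1 -> R) (h : T2 -> R) :
  measurable_fun setT (fun z : T1 * T2 => f z.1 z.2) ->
  m1.-integrable setT (EFin \o g) -> m2.-integrable setT (EFin \o h) ->
  (forall x y, `|f x y| <= g x * h y) ->
  \int[m1]_x \int[m2]_y f x y = \int[m2]_y \int[m1]_x f x y.
Proof.
move=> mf ig ih fgh.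
have intf : (m1 \x m2)%E.-integrable setT (EFin \o (fun z : T1 * T2 => f z.1 z.2)).
  exact: (integrable_prod_dominated mf ig ih).
rewrite -(Rintegral_iter intf); last first.
  move=> x; apply: (@dominated_integrable_real _ _ _ _ _ _ (fun y => g x * h y)) => //.
    exact: (measurableT_comp mf (measurable_pair1 x)).
  exact: (integrableZl measurableT (g x) ih).
rewrite (Rintegral_iter_swap intf)// => y.
apply: (@dominated_integrable_real _ _ _ _ _ _ (fun x => g x * h y)) => //.
  exact: (measurableT_comp mf (measurable_pair2 y)).
exact: (integrableZr measurableT (h y) ig).
Qed.

Lemma Rintegral_prod (f : T1 -> R) (g : T2 -> R) :
  m1.-integrable setT (EFin \o f) -> m2.-integrable setT (EFin \o g) ->
  \int[(m1 \x m2)%E]_x (f x.1 * g x.2) = (\int[m1]_x f x) * (\int[m2]_x g x).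
Proof.
move=> intf intg; rewrite Rintegral_iter; first last.
- by move=> x; exact: (integrableZl measurableT (f x) intg).
- exact: integrable_prod.
by under eq_Rintegral do rewrite /= RintegralZl//; rewrite RintegralZr.
Qed.

End ProductIntegral.

(** * Lebesgue measure on the plane: open sets, affine maps, an integrable envelope *)

Section PlaneMeasure.
Variable R : realType.
Local Notation leb := (@lebesgue_measure R).
Local Notation mR := (measurableTypeR R).
Local Notation P := (mR * mR)%type.
Local Notation pushforward_measure :=
  measure_function_pushforward__canonical__measure_function_Measure.
Local Notation mu2 := (leb \x leb)%E.
Implicit Types (f g : P -> R) (x y v : R * R).

(** The sigma-algebra on [P] is the product one; an open set is the union of the countably many
    rational boxes that it contains. *)
Lemma open_measurable_plane (U : set (R * R)) : open U -> measurable (U : set P).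
Proof.
move=> oU.
pose B (p : (rat * rat) * (rat * rat)) : set (R * R) :=
  `]ratr p.1.1, ratr p.1.2[%classic `*` `]ratr p.2.1, ratr p.2.2[%classic.
pose P : set ((rat * rat) * (rat * rat)) := [set p | B p `<=` U].
rewrite (_ : U = \bigcup_(p in P) B p); last first.
  apply/seteqP; split => [x Ux|x [p Pp Bp]]; last exact: Pp.
  have /nbhs_ballP[e /= e0 xeU] : nbhs x U by exact: open_nbhs_nbhs.
  have a1 : x.1 - e < x.1 by rewrite ltrBlDr ltrDl.
  have b1 : x.1 < x.1 + e by rewrite ltrDl.
  have a2 : x.2 - e < x.2 by rewrite ltrBlDr ltrDl.
  have b2 : x.2 < x.2 + e by rewrite ltrDl.
  have [q1 /itvP q1i] := rat_in_itvoo a1.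
  have [q2 /itvP q2i] := rat_in_itvoo b1.
  have [q3 /itvP q3i] := rat_in_itvoo a2.
  have [q4 /itvP q4i] := rat_in_itvoo b2.
  exists ((q1, q2), (q3, q4)).
    move=> z [] /=; rewrite !in_itv/= => /andP[z1 z2] /andP[z3 z4].
    apply: xeU; split; rewrite /ball/= ltr_norml; apply/andP; split.
    - by rewrite ltrNl opprB ltrBlDr (lt_trans z2)// addrC q2i.
    - by rewrite ltrBlDr -ltrBlDl (lt_trans _ z1)// q1i.
    - by rewrite ltrNl opprB ltrBlDr (lt_trans z4)// addrC q4i.
    - by rewrite ltrBlDr -ltrBlDl (lt_trans _ z3)// q3i.
  by rewrite /B /=; split => /=; rewrite in_itv/= ?q1i ?q2i ?q3i ?q4i.
rewrite bigcup_mkcond; apply: countable_bigcupT_measurable => [|p].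
  exact: countableP.
by case: ifP => // _; apply: measurableX; exact: measurable_itv.
Qed.

Lemma continuous_measurable_plane f : continuous (f : R * R -> R) -> measurable_fun [set: P] f.
Proof.
move=> /continuousP cf; apply: (measurability _ (RGenOpens.measurableE R)).
move=> _ [_ [a [b ->] <-]]; rewrite setTI; apply: open_measurable_plane.
exact/cf/interval_open.
Qed.

Lemma measurable_affine1 (s b : R) : measurable_fun setT (fun t : mR => (s * t + b : mR)).
Proof. by apply: measurable_funD => //; exact: measurable_funM. Qed.

(** The pushforward of [leb] along t |-> s t + b, scaled by s, has the right value on half-open
    intervals, hence is [leb] itself. *)
Lemma lebesgue_affine (s b : R) (A : set mR) : 0 < s -> measurable A ->
  leb ((fun t : R => s * t + b) @^-1` A) = (s^-1%:E * leb A)%E.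
Proof.
move=> s0 mA.
pose T : mR -> mR := fun t => s * t + b.
have mT : measurable_fun setT T := measurable_affine1 s b.
pose m : {measure set mR -> \bar R} :=
  mscale (NngNum (ltW s0)) (pushforward_measure leb mT).
have H : forall B, measurable B -> leb B = m B.
  apply: lebesgue_measure_unique => X [[l u] _ <-].
  change (leb `]l, u]%classic = s%:E * pushforward leb T `]l, u]%classic)%E.
  have -> : pushforward leb T `]l, u] = leb `](l - b) / s, (u - b) / s]%classic.
    rewrite /pushforward; congr (leb _).
    by apply/seteqP; split => t /=; rewrite !in_itv/= /T;
      rewrite ltr_pdivrMr// ler_pdivlMr// ltrBlDr lerBrDr (mulrC t).
  rewrite !lebesgue_measure_itv/= !lte_fin ltr_pM2r ?invr_gt0// ltrD2r.
  case: ifPn => _; last by rewrite mule0.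
  by rewrite -!EFinB -EFinM; congr EFin; field; rewrite gt_eqF.
rewrite (H A mA) /m /mscale /pushforward/=.
by rewrite muleA -EFinM mulVf ?gt_eqF// mul1e.
Qed.

Lemma lebesgue_opp (A : set mR) : measurable A -> leb (-%R @^-1` A) = leb A.
Proof.
move=> mA.
pose T : mR -> mR := -%R.
have mT : measurable_fun setT T := @oppr_measurable R setT.
pose m : {measure set mR -> \bar R} := pushforward_measure leb mT.
have H : forall B, measurable B -> leb B = m B.
  apply: lebesgue_measure_unique => X [[l u] _ <-].
  change (leb `]l, u]%classic = pushforward leb T `]l, u]%classic)%E.
  have -> : pushforward leb T `]l, u] = leb `[- u, - l[%classic.
    rewrite /pushforward; congr (leb _).
    by apply/seteqP; split => t /=; rewrite !in_itv/= /T ltrNr lerNl andbC.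
  rewrite !lebesgue_measure_itv/= !lte_fin ltrN2.
  case: ifPn => _ //.
  by rewrite -!EFinB; congr EFin; ring.
by rewrite (H A mA).
Qed.

Definition affine (s : R) (b : R * R) : R * R -> R * R := fun x => s *: x + b.

Lemma measurable_affine s b : measurable_fun [set: P] (affine s b : P -> P).
Proof.
apply/measurable_fun_pairP; split.
  by apply: (measurableT_comp (measurable_affine1 s b.1)); exact: measurable_fst.
by apply: (measurableT_comp (measurable_affine1 s b.2)); exact: measurable_snd.
Qed.

Lemma measurable_opp_plane : measurable_fun [set: P] (-%R : P -> P).
Proof.
apply/measurable_fun_pairP; split.
  by apply: (measurableT_comp (@oppr_measurable R setT)); exact: measurable_fst.
by apply: (measurableT_comp (@oppr_measurable R setT)); exact: measurable_snd.
Qed.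

(** As on the line, with rectangles as determining class; each coordinate contributes one factor
    s. *)
Lemma plane_measure_affine s b (A : set P) : 0 < s -> measurable A ->
  mu2 A = (((s ^+ 2)%:E * mu2 (affine s b @^-1` A)))%E.
Proof.
move=> s0 mA.
have s20 : 0 <= s ^+ 2 by rewrite sqr_ge0.
pose T : P -> P := affine s b.
have mT : measurable_fun setT T := measurable_affine s b.
pose m : {measure set (P) -> \bar R} :=
  mscale (NngNum s20) (pushforward_measure mu2 mT).
have H : forall B, measurable B -> mu2 B = m B.
  apply: product_measure_unique => A1 A2 mA1 mA2.
  change ((s ^+ 2)%:E * mu2 (((fun t : mR => s * t + b.1)%R @^-1` A1) `*`
    ((fun t : mR => s * t + b.2)%R @^-1` A2)) = leb A1 * leb A2)%E.
  have m1 : measurable ((fun t : mR => s * t + b.1) @^-1` A1).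
    by rewrite -[X in measurable X]setTI; exact: measurable_affine1.
  have m2 : measurable ((fun t : mR => s * t + b.2) @^-1` A2).
    by rewrite -[X in measurable X]setTI; exact: measurable_affine1.
  rewrite product_measure1E//= !lebesgue_affine//.
  rewrite muleACA -EFinM (muleA (s ^+ 2)%:E) -EFinM.
  by rewrite (_ : s ^+ 2 * (s^-1 * s^-1) = 1) ?mul1e// expr2; field; rewrite gt_eqF.
exact: H.
Qed.

Lemma plane_measure_opp (A : set P) : measurable A ->
  mu2 A = mu2 (-%R @^-1` A).
Proof.
move=> mA.
pose T : P -> P := -%R.
have mT : measurable_fun setT T := measurable_opp_plane.
pose m : {measure set (P) -> \bar R} := pushforward_measure mu2 mT.
have H : forall B, measurable B -> mu2 B = m B.
  apply: product_measure_unique => A1 A2 mA1 mA2.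
  change (mu2 (((-%R : mR -> mR) @^-1` A1) `*`
    ((-%R : mR -> mR) @^-1` A2)) = leb A1 * leb A2)%E.
  have m1 : measurable ((-%R : mR -> mR) @^-1` A1).
    by rewrite -[X in measurable X]setTI; exact: oppr_measurable.
  have m2 : measurable ((-%R : mR -> mR) @^-1` A2).
    by rewrite -[X in measurable X]setTI; exact: oppr_measurable.
  by rewrite product_measure1E//= !lebesgue_opp.
exact: H.
Qed.

Lemma Rintegral_affine s b f : 0 < s -> mu2.-integrable setT (EFin \o f) ->
  \int[mu2]_x f x = s ^+ 2 * \int[mu2]_x f (s *: x + b).
Proof.
move=> s0; apply: (Rintegral_change (measurable_affine s b)).
  by rewrite exprn_gt0.
by move=> A; exact: plane_measure_affine.
Qed.

Lemma integrable_affine s b f : 0 < s -> mu2.-integrable setT (EFin \o f) ->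
  mu2.-integrable setT (EFin \o (fun x => f (s *: x + b))).
Proof.
move=> s0; apply: (@integrable_change _ _ _ _ _ (s ^+ 2) (measurable_affine s b)).
  by rewrite exprn_gt0.
by move=> A; exact: plane_measure_affine.
Qed.

Lemma Rintegral_opp f : mu2.-integrable setT (EFin \o f) ->
  \int[mu2]_x f (- x) = \int[mu2]_x f x.
Proof.
move=> intf; apply/esym; rewrite -[RHS]mul1r.
apply: (Rintegral_change measurable_opp_plane) => // A mA.
by rewrite mul1e; exact: plane_measure_opp.
Qed.

Lemma integrable_opp f : mu2.-integrable setT (EFin \o f) ->
  mu2.-integrable setT (EFin \o (fun x => f (- x))).
Proof.
apply: (@integrable_change _ _ _ _ _ 1 measurable_opp_plane) => // A mA.
by rewrite mul1e; exact: plane_measure_opp.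
Qed.

Lemma oneDsqr_gt0' (t : R) : 0 < oneDsqr t.
Proof. exact: lt_le_trans (oneDsqr_ge1 t). Qed.

(** A product, so that integrability reduces to one variable. Domination by a multiple of [env] is
    the usual integrability test below. *)
Definition env x : R := (oneDsqr x.1)^-1 * (oneDsqr x.2)^-1.

Lemma integralT_oneDsqr : (\int[leb]_x ((oneDsqr x)^-1)%:E = pi%:E)%E.
Proof.
rewrite ge0_symfun_integralT//=.
- rewrite (_ : [set x | _] = `[0, +oo[%classic); last first.
    by apply/seteqP; split => x/=; rewrite in_itv/= andbT.
  by rewrite integral0y_oneDsqr -EFinM mulrCA divff// mulr1.

- exact: continuous_oneDsqrV.
- by move=> x /=; rewrite /oneDsqr sqrrN.
Qed.

Lemma env_gt0 x : 0 < env x.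
Proof. by rewrite mulr_gt0// invr_gt0 oneDsqr_gt0'. Qed.

Lemma env_ge0 x : 0 <= env x. Proof. exact/ltW/env_gt0. Qed.

Lemma integrable_env : mu2.-integrable setT (EFin \o env).
Proof.
have H : leb.-integrable setT (EFin \o (fun x : R => (oneDsqr x)^-1)).
  apply/integrableP; split.
    apply/measurable_EFinP; apply: continuous_measurable_fun.
    exact: continuous_oneDsqrV.
  under eq_integral => x _ do rewrite /= ger0_norm ?invr_ge0 ?(ltW (oneDsqr_gt0' _))//.
  by rewrite integralT_oneDsqr ltry.
exact: (integrable_prod H H).
Qed.

End PlaneMeasure.

(** * Reduction of limits along filters to sequences *)

Section SequentialLimits.
Context {R : realType} {V : pseudoMetricType R}.

(** Carries dominated convergence, a statement on sequences, to filters. If the limit failed, some e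
    would be violated in each ball of radius 1 / (n + 1), and a choice of such points would be a
    sequence contradicting the hypothesis. *)
Lemma cvg_within_seq (D : set V) (f : V -> R) (p : V) (l : R) :
  (forall u : nat -> V, (forall n, D (u n)) -> u n @[n --> \oo] --> p ->
    f (u n) @[n --> \oo] --> l) ->
  f x @[x --> within D (nbhs p)] --> l.
Proof.
move=> H; apply: contrapT => nf.
have [e e0 ne] : exists2 e, 0 < e & ~ \forall x \near within D (nbhs p), `|l - f x| < e.
  apply: contrapT => ne; apply: nf; apply/cvgrPdist_lt => e e0.
  by apply: contrapT => nn; apply: ne; exists e.
have ex n : exists x, [/\ D x, ball p (n.+1%:R^-1) x & e <= `|l - f x|].
  apply: contrapT => nx; apply: ne.
  rewrite /within /=; apply/nbhs_ballP; exists (n.+1%:R^-1) => //= x px Dx.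
  rewrite ltNge; apply/negP => le; apply: nx; by exists x.
have [u uP] := choice ex.
have up : u n @[n --> \oo] --> p.
  apply/cvg_ballP => r r0; near=> n.
  have [_ h _] := uP n; apply: le_ball h.
  apply: ltW; near: n; exact: near_infty_natSinv_lt (PosNum r0).
have /cvgrPdist_lt/(_ e e0) := H u (fun n => let: And3 h _ _ := uP n in h) up.
move=> [N _ /(_ N (leqnn N))] /=.
by rewrite ltNge; case: (uP N) => _ _ ->.
Unshelve. all: by end_near. Qed.

Lemma continuous_seq (f : V -> R) (p : V) :
  (forall u : nat -> V, u n @[n --> \oo] --> p -> f (u n) @[n --> \oo] --> f p) ->
  {for p, continuous f}.
Proof.
move=> H A nA.
have /(_ A nA) h : f x @[x --> within setT (nbhs p)] --> f p.
  by apply: cvg_within_seq => u _; exact: H.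
by move: h; rewrite /nbhs /= /within /=; apply: filterS => x; apply.
Qed.

End SequentialLimits.

(* An alias, because the sigma-finite instance of product_measure1 is shadowed
   by the one for products of subprobabilities. *)
Definition plane_measure (R : realType) :
  set (measurableTypeR R * measurableTypeR R)%type -> \bar R :=
  (@lebesgue_measure R \x @lebesgue_measure R)%E.

HB.instance Definition _ (R : realType) := Measure.on (@plane_measure R).

Lemma plane_measure_sigma_finite (R : realType) :
  sigma_finite setT (@plane_measure R).
Proof.
have /sigma_finiteP[F [TF ndF Foo]] := sigma_finiteT (@lebesgue_measure R).
exists (fun n => F n `*` F n).
  rewrite -setXTT TF predeqE => -[x y]; split.
    move=> [/= [n _ Fnx] [k _ Fky]]; exists (maxn n k) => //; split.
    - by move: x Fnx; apply/subsetPset/ndF; rewrite leq_maxl.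
    - by move: y Fky; apply/subsetPset/ndF; rewrite leq_maxr.
  by move=> [n _ []/= ? ?]; split; exists n.
move=> k; have [? ?] := Foo k.
split; first exact: measurableX.
by rewrite /plane_measure product_measure1E// lte_mul_pinfty// ge0_fin_numE.
Qed.

HB.instance Definition _ (R : realType) :=
  Measure_isSigmaFinite.Build _ _ _ (@plane_measure R)
    (plane_measure_sigma_finite R).

(** * Measurability and integration of real functions on the plane *)

Section Plane.
Variable R : realType.
Local Notation leb := (@lebesgue_measure R).
Local Notation mR := (measurableTypeR R).
Local Notation P := (mR * mR)%type.
Local Notation mu2 := (leb \x leb)%E.
Implicit Types (f g : R * R -> R) (x y v : R * R).

(** Stated for functions on [R * R], so that the passage to the measurable structure [P] is made
    once and stays out of later statements. *)
Definition pmeas f := measurable_fun [set: P] (f : P -> R).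
Definition pmeas2 (f : R * R -> R * R -> R) :=
  measurable_fun [set: P * P] (fun z : P * P => f z.1 z.2).
Definition pintegrable f := mu2.-integrable setT (EFin \o f).
Definition pint f : R := \int[mu2]_x f x.

Lemma pmeas_continuous f : continuous f -> pmeas f.
Proof. exact: continuous_measurable_plane. Qed.

Lemma pmeas_cst (c : R) : pmeas (fun=> c).
Proof. exact: measurable_cst. Qed.

Lemma pmeasD f g : pmeas f -> pmeas g -> pmeas (fun x => f x + g x).
Proof. exact: measurable_funD. Qed.

Lemma pmeasB f g : pmeas f -> pmeas g -> pmeas (fun x => f x - g x).
Proof. exact: measurable_funB. Qed.

Lemma pmeasM f g : pmeas f -> pmeas g -> pmeas (fun x => f x * g x).
Proof. exact: measurable_funM. Qed.

Lemma pmeas_comp (h : R -> R) f : measurable_fun setT h -> pmeas f ->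
  pmeas (fun x => h (f x)).
Proof. by move=> mh mf; exact: (measurableT_comp mh mf). Qed.

Lemma pmeas_fst : pmeas fst. Proof. exact: measurable_fst. Qed.
Lemma pmeas_snd : pmeas snd. Proof. exact: measurable_snd. Qed.

Lemma pmeas_affine (s : R) b f : pmeas f -> pmeas (fun x => f (s *: x + b)).
Proof. by move=> mf; exact: (measurableT_comp mf (measurable_affine s b)). Qed.

Lemma pmeas_cvg (f_ : nat -> R * R -> R) f : (forall n, pmeas (f_ n)) ->
  (forall x, f_ n x @[n --> \oo] --> f x) -> pmeas f.
Proof. by move=> mf ff; apply: (measurable_fun_cvg mf) => x _; exact: ff. Qed.

Lemma pmeas2_fst f : pmeas f -> pmeas2 (fun x _ => f x).
Proof. by move=> mf; exact: (measurableT_comp mf measurable_fst). Qed.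

Lemma pmeas2_snd f : pmeas f -> pmeas2 (fun _ x => f x).
Proof. by move=> mf; exact: (measurableT_comp mf measurable_snd). Qed.

Lemma pmeas2D (f g : R * R -> R * R -> R) : pmeas2 f -> pmeas2 g -> pmeas2 (fun x y => f x y + g x y).
Proof. exact: measurable_funD. Qed.

Lemma pmeas2B (f g : R * R -> R * R -> R) : pmeas2 f -> pmeas2 g -> pmeas2 (fun x y => f x y - g x y).
Proof. exact: measurable_funB. Qed.

Lemma pmeas2M (f g : R * R -> R * R -> R) : pmeas2 f -> pmeas2 g -> pmeas2 (fun x y => f x y * g x y).
Proof. exact: measurable_funM. Qed.

Lemma pmeas2_comp (h : R -> R) (f : R * R -> R * R -> R) :
  measurable_fun setT h -> pmeas2 f -> pmeas2 (fun x y => h (f x y)).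
Proof. by move=> mh mf; exact: (measurableT_comp mh mf). Qed.

Lemma pmeas2_dot : pmeas2 (@dot R).
Proof.
apply: measurable_funD; apply: measurable_funM.
- exact: (measurableT_comp measurable_fst measurable_fst).
- exact: (measurableT_comp measurable_fst measurable_snd).
- exact: (measurableT_comp measurable_snd measurable_fst).
- exact: (measurableT_comp measurable_snd measurable_snd).
Qed.

Lemma eq_pint f g : f =1 g -> pint f = pint g.
Proof. by move=> /funext ->. Qed.

Lemma eq_pintegrable f g : f =1 g -> pintegrable f -> pintegrable g.
Proof. by move=> /funext ->. Qed.

Lemma pintegrable_meas f : pintegrable f -> pmeas f.
Proof. by case/integrableP => /measurable_EFinP. Qed.

Lemma pintegrable_dominated g f : pmeas f -> pintegrable g ->
  (forall x, `|f x| <= g x) -> pintegrable f.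
Proof.
move=> mf ig fg.
exact: (@dominated_integrable_real _ _ _ mu2 setT f g measurableT mf ig (fun x _ => fg x)).
Qed.

Lemma pintegrableD f g : pintegrable f -> pintegrable g ->
  pintegrable (fun x => f x + g x).
Proof. by move=> i1 i2; exact: (integrableD measurableT i1 i2). Qed.

Lemma pintegrableB f g : pintegrable f -> pintegrable g ->
  pintegrable (fun x => f x - g x).
Proof. by move=> i1 i2; exact: (integrableB measurableT i1 i2). Qed.

Lemma pintegrableZ (c : R) f : pintegrable f -> pintegrable (fun x => c * f x).
Proof. by move=> i1; exact: (integrableZl measurableT c i1). Qed.

Lemma pintegrable_env (C : R) f : pmeas f -> (forall x, `|f x| <= C * env x) ->
  pintegrable f.
Proof.
move=> mf; apply: pintegrable_dominated => //.
by apply: pintegrableZ; exact: integrable_env.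
Qed.

Lemma pintD f g : pintegrable f -> pintegrable g ->
  pint (fun x => f x + g x) = pint f + pint g.
Proof. exact: RintegralD. Qed.

Lemma pintB f g : pintegrable f -> pintegrable g ->
  pint (fun x => f x - g x) = pint f - pint g.
Proof. exact: RintegralB. Qed.

Lemma pintZ (c : R) f : pintegrable f -> pint (fun x => c * f x) = c * pint f.
Proof. by move=> i1; exact: (RintegralZl c measurableT i1). Qed.

Lemma pint0 : pint (fun=> 0) = 0.
Proof. by rewrite /pint /Rintegral integral0. Qed.

Lemma pintN f : pintegrable f -> pint (fun x => - f x) = - pint f.
Proof.
move=> i1; rewrite -mulN1r -pintZ//; apply: eq_pint => x; by rewrite mulN1r.
Qed.

Lemma le_pint f g : pintegrable f -> pintegrable g -> (forall x, f x <= g x) ->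
  pint f <= pint g.
Proof. by move=> i1 i2 fg; apply: le_Rintegral => // x _; exact: fg. Qed.

Lemma pint_ge0 f : (forall x, 0 <= f x) -> 0 <= pint f.
Proof. by move=> f0; apply: Rintegral_ge0. Qed.

Lemma le_norm_pint f : pintegrable f -> `|pint f| <= pint (fun x => `|f x|).
Proof. by move=> i1; exact: le_normr_Rintegral. Qed.

Lemma norm_pint_le f g : pintegrable f -> pintegrable g ->
  (forall x, `|f x| <= g x) -> `|pint f| <= pint g.
Proof.
move=> i1 i2 fg; apply: le_trans (le_norm_pint i1) _; apply: le_pint => //.
apply: pintegrable_dominated i2 _; last by move=> x; rewrite normr_id.
by apply: pmeas_comp => //; exact: pintegrable_meas.
Qed.

Lemma pint_shift b f : pintegrable f -> pint (fun x => f (x + b)) = pint f.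
Proof.
move=> i1; rewrite [RHS](Rintegral_affine b ltr01 i1) expr1n mul1r.
by apply: eq_pint => x; rewrite scale1r.
Qed.

Lemma pintegrable_affine (s : R) b f : 0 < s -> pintegrable f ->
  pintegrable (fun x => f (s *: x + b)).
Proof. by move=> s0 i1; exact: (integrable_affine b s0 i1). Qed.

Lemma pintegrable_shift b f : pintegrable f -> pintegrable (fun x => f (x + b)).
Proof.
move=> /(pintegrable_affine b ltr01); apply: eq_pintegrable => x.
by rewrite scale1r.
Qed.

Lemma pint_affine (s : R) b f : 0 < s -> pintegrable f ->
  pint f = s ^+ 2 * pint (fun x => f (s *: x + b)).
Proof. by move=> s0 i1; exact: (Rintegral_affine b s0 i1). Qed.

Lemma pint_opp f : pintegrable f -> pint (fun x => f (- x)) = pint f.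
Proof. exact: Rintegral_opp. Qed.

Lemma pintegrable_opp f : pintegrable f -> pintegrable (fun x => f (- x)).
Proof. exact: integrable_opp. Qed.

(** Reflection changes the sign of the integral. This will kill the sine part against the even
    kernel and the imaginary part of the explicit formula. *)
Lemma pint_odd f : pintegrable f -> (forall x, f (- x) = - f x) -> pint f = 0.
Proof.
move=> i1 odd; have : pint f = - pint f.
  rewrite -pintN// -[LHS]pint_opp//; exact: eq_pint.
by move=> /eqP; rewrite -addr_eq0 -mulr2n mulrn_eq0 /= => /eqP.
Qed.

Lemma pint_swap (F : R * R -> R * R -> R) f g : pmeas2 F ->
  pintegrable f -> pintegrable g -> (forall x y, `|F x y| <= f x * g y) ->
  pint (fun x => pint (fun y => F x y)) = pint (fun y => pint (fun x => F x y)).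
Proof. move=> mF i1 i2 H.
have := @Rintegral_swap _ _ _ _ _ (@plane_measure R) (@plane_measure R) F f g mF i1 i2 H.
exact. Qed.

Lemma pint_cvg (f_ : nat -> R * R -> R) f g : (forall n, pmeas (f_ n)) ->
  (forall x, f_ n x @[n --> \oo] --> f x) -> pintegrable g ->
  (forall n x, `|f_ n x| <= g x) ->
  pint (f_ n) @[n --> \oo] --> pint f.
Proof.
move=> mf ff ig fg.
by apply: (dominated_cvg_Rintegral measurableT mf (fun x _ => ff x) ig) => n x _.
Qed.

Lemma pint_cvg_within (V : pseudoMetricType R) (D : set V) (p : V)
    (F : V -> R * R -> R) f g : (forall s, D s -> pmeas (F s)) ->
  (forall x, F s x @[s --> within D (nbhs p)] --> f x) -> pintegrable g ->
  (forall s x, D s -> `|F s x| <= g x) ->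
  pint (F s) @[s --> within D (nbhs p)] --> pint f.
Proof.
move=> mF Ff ig Fg; apply: cvg_within_seq => u Du up.
apply: (@pint_cvg (fun n => F (u n)) f g) => //.
- by move=> n; exact: mF.
- move=> x A /(Ff x); rewrite /within /= => nA.
  have : \forall n \near \oo, D (u n) -> A (F (u n) x) := up _ nA.
  by apply: filterS => n; apply.
- by move=> n x; exact: Fg.
Qed.

(** Domination is required only for |t - a| < r, because the dominating functions below depend on a
    bound for the parameter. *)
Lemma is_derive_pint (F dF : R -> R * R -> R) (g : R * R -> R) (a r : R) : 0 < r ->
  (forall t, `|t - a| < r -> pintegrable (F t)) ->
  (forall t x, `|t - a| < r -> is_derive t 1 (F ^~ x) (dF t x)) ->
  pintegrable g -> (forall t x, `|t - a| < r -> `|dF t x| <= g x) ->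
  is_derive a 1 (fun t => pint (F t)) (pint (dF a)).
Proof.
move=> r0 iF dFE ig dFg.
have Ia : `]a - r, a + r[%classic a.
  by rewrite /= in_itv/= ltrBlDr !ltrDl r0.
have II t : `]a - r, a + r[%classic t -> `|t - a| < r.
  by rewrite /= in_itv/= ltr_distl.
have g0 x : 0 <= g x by apply: (le_trans (normr_ge0 (dF a x))); apply: dFg; rewrite subrr normr0.
have E t x : `|t - a| < r -> partial1of2 F t x = dF t x.
  by move=> tr; rewrite partial1of2E; case: (dFE t x tr) => _ ->.
have H1 (x : R) : `]a - r, a + r[%classic x -> mu2.-integrable setT (EFin \o F x).
  by move=> /II; exact: iF.
have H2 (x : R) y : `]a - r, a + r[%classic x -> setT y -> derivable (F ^~ y) x 1.
  by move=> /II xr _; case: (dFE x y xr).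
have H3 (x : R) y : `]a - r, a + r[%classic x -> setT y -> `|partial1of2 F x y| <= g y.
  by move=> /II xr _; rewrite E//; exact: dFg.
have D1 := @derivable_under_integral _ _ _ mu2 F setT measurableT a (a - r) (a + r)
  Ia H1 H2 g g0 ig H3.
have D2 := @differentiation_under_integral _ _ _ mu2 F setT measurableT a (a - r) (a + r)
  Ia H1 H2 g g0 ig H3.
apply: DeriveDef; first exact: D1.
rewrite -derive1E [LHS]D2; apply: eq_pint => x; apply: E.
by rewrite subrr normr0.
Qed.

End Plane.

(** * Differentiation and integration by parts *)

Section DerivativeRules.
Variable R : realType.
Implicit Types (f g h df : R -> R) (x a b : R).

(* A synonym that is not a type class, so that the rules below are applied
   syntactically rather than by instance resolution. *)
Definition has_deriv f x a : Prop := is_derive x 1 f a.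

Lemma has_derivP f x a : has_deriv f x a -> is_derive x 1 f a.
Proof. by []. Qed.

Lemma has_deriv_eq f x a b : has_deriv f x a -> a = b -> has_deriv f x b.
Proof. by move=> ? <-. Qed.

Lemma has_deriv_cst (c x : R) : has_deriv (fun=> c) x 0.
Proof. exact: is_derive_cst. Qed.

Lemma has_deriv_id x : has_deriv (fun t : R => t) x 1.
Proof. exact: is_derive_id. Qed.

Lemma has_derivD f g x a b : has_deriv f x a -> has_deriv g x b ->
  has_deriv (fun t => f t + g t) x (a + b).
Proof. by move=> *; exact: is_deriveD. Qed.

Lemma has_derivN f x a : has_deriv f x a ->
  has_deriv (fun t => - f t) x (- a).
Proof. by move=> *; exact: is_deriveN. Qed.

Lemma has_derivB f g x a b : has_deriv f x a -> has_deriv g x b ->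
  has_deriv (fun t => f t - g t) x (a - b).
Proof. by move=> *; exact: is_deriveB. Qed.

Lemma has_derivM f g x a b : has_deriv f x a -> has_deriv g x b ->
  has_deriv (fun t => f t * g t) x (f x * b + g x * a).
Proof. by move=> *; exact: is_deriveM. Qed.

Lemma has_derivX f n x a : has_deriv f x a ->
  has_deriv (fun t => f t ^+ n) x (n%:R * f x ^+ n.-1 * a).
Proof.
move=> fa; elim: n => [|n IH] /=.
  by rewrite !mul0r; exact: has_deriv_cst.
have := has_derivM fa IH; rewrite (_ : (fun t => _) = (fun t => f t ^+ n.+1)); last first.
  by apply/funext => t; rewrite exprS.
move=> H; apply: (has_deriv_eq H); case: n {IH H} => [|n] /=.
  by rewrite !mul0r mulr0 add0r expr0 mulr1 ?mul1r.
by rewrite -[in RHS]natr1 exprS; ring.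
Qed.

Lemma has_deriv_comp f g x a b : has_deriv f (g x) a -> has_deriv g x b ->
  has_deriv (fun t => f (g t)) x (a * b).
Proof. exact: is_derive1_comp. Qed.

Lemma has_deriv_exp f x a : has_deriv f x a ->
  has_deriv (fun t => expR (f t)) x (expR (f x) * a).
Proof. by move=> fa; exact: (has_deriv_comp (is_derive_expR (f x)) fa). Qed.

Lemma has_deriv_cos f x a : has_deriv f x a ->
  has_deriv (fun t => cos (f t)) x (- sin (f x) * a).
Proof. by move=> fa; exact: (has_deriv_comp (is_derive_cos (f x)) fa). Qed.

Lemma has_deriv_sin f x a : has_deriv f x a ->
  has_deriv (fun t => sin (f t)) x (cos (f x) * a).
Proof. by move=> fa; exact: (has_deriv_comp (is_derive_sin (f x)) fa). Qed.

Lemma is_derive_continuous f x a : is_derive x 1 f a -> {for x, continuous f}.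
Proof. by case=> fd _; exact/differentiable_continuous/derivable1_diffP. Qed.

Lemma derivative_bound f df (M x y : R) :
  (forall t : R, is_derive t 1 f (df t)) -> (forall t, `|df t| <= M) ->
  `|f y - f x| <= M * `|y - x|.
Proof.
move=> fd dM; wlog xy : x y / x < y => [H|].
  have [xy|yx|->] := ltgtP x y; first exact: H.
  - by rewrite distrC (distrC y); exact: H.
  - by rewrite !subrr normr0 mulr0.
have [c _ ->] := MVT xy (fun t _ => fd t)
  (continuous_subspaceT (fun t => is_derive_continuous (fd t))).
by rewrite normrM ler_wpM2r.
Qed.

Lemma derivative_bound_within f df (M x y : R) : x <= y ->
  (forall t : R, x < t < y -> is_derive t 1 f (df t)) ->
  {within `[x, y], continuous f} ->
  (forall t, x < t < y -> `|df t| <= M) ->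
  `|f y - f x| <= M * (y - x).
Proof.
rewrite le_eqVlt => /predU1P[->|xy] fd cf dM; first by rewrite !subrr normr0 mulr0.
have fd' t : t \in `]x, y[ -> is_derive t 1 f (df t) by rewrite in_itv/=; exact: fd.
have [c cxy ->] := MVT xy fd' cf.
rewrite normrM (gtr0_norm (x := y - x)) ?subr_gt0// ler_wpM2r ?subr_ge0 ?(ltW xy)//.
by apply: dM; move: cxy; rewrite in_itv.
Qed.

Lemma is_derive_unique f x a b : is_derive x 1 f a -> is_derive x 1 f b -> a = b.
Proof. by move=> [_ <-] [_ <-]. Qed.

End DerivativeRules.

(** Run after [has_deriv_eq], while the derivative is still an existential variable: the rules
    compute it from the shape of the function, and the remaining goal compares it with the wanted
    value. *)
Ltac derive_rules :=
  repeat first [ eassumption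
    | apply: has_deriv_cst | apply: has_deriv_id
    | apply: has_derivB | apply: has_derivD | apply: has_derivN
    | apply: has_derivM | apply: has_derivX | apply: has_deriv_exp
    | apply: has_deriv_cos | apply: has_deriv_sin ].

(** * Directional derivatives, the polynomial weight, integrals of derivatives *)

Section Plane.
Variable R : realType.
Implicit Types (f g : R * R -> R) (x y v : R * R).

(** The two difference quotients are the same function. The one-variable rules thus apply to
    directional derivatives. *)
Lemma is_derive_line f x v (t d : R) :
  is_derive (x + t *: v) v f d <-> is_derive t 1 (fun s : R => f (x + s *: v)) d.
Proof.
have E : (fun h : R => h^-1 *: ((f \o shift (x + t *: v)) (h *: v) - f (x + t *: v))) =
  (fun h : R => h^-1 *: (((fun s : R => f (x + s *: v)) \o shift t) (h *: (1:R)) - f (x + t *: v))).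
  apply/funext => h; congr (_ *: (_ - _)) => /=.
  by rewrite scalerDl [h *: 1]mulr1 addrCA.
have D : derivable f (x + t *: v) v = derivable (fun s : R => f (x + s *: v)) t 1.
  by rewrite /derivable E.
have D' : 'D_v f (x + t *: v) = 'D_1 (fun s : R => f (x + s *: v)) t.
  by rewrite /derive E.
split; case=> d1 d2; apply: DeriveDef.
- by rewrite -D.
- by rewrite -D'.
- by rewrite D.
- by rewrite D'.
Qed.

Lemma is_derive_line0 f x v (d : R) :
  is_derive x v f d <-> is_derive (0 : R) 1 (fun s : R => f (x + s *: v)) d.
Proof. by rewrite -is_derive_line scale0r addr0. Qed.

Lemma continuous_planeD f g : continuous f -> continuous g ->
  continuous (fun x => f x + g x).
Proof. by move=> cf cg x; apply: cvgD; [exact: cf|exact: cg]. Qed.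
Lemma continuous_planeB f g : continuous f -> continuous g ->
  continuous (fun x => f x - g x).
Proof. by move=> cf cg x; apply: cvgB; [exact: cf|exact: cg]. Qed.
Lemma continuous_planeN f : continuous f -> continuous (fun x => - f x).
Proof. by move=> cf x; apply: cvgN; exact: cf. Qed.
Lemma continuous_planeM f g : continuous f -> continuous g ->
  continuous (fun x => f x * g x).
Proof. by move=> cf cg x; apply: cvgM; [exact: cf|exact: cg]. Qed.
Lemma continuous_planeX f n : continuous f -> continuous (fun x => f x ^+ n).
Proof.
move=> cf; elim: n => [|n IH]; first by move=> x; exact: cvg_cst.
rewrite (_ : (fun x => _) = (fun x => f x * f x ^+ n)).
  exact: continuous_planeM.
by apply/funext => x; rewrite exprS.
Qed.
Lemma continuous_plane_cst (c : R) : continuous (fun _ : R * R => c).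
Proof. by move=> x; exact: cvg_cst. Qed.
Lemma continuous_plane_fst : continuous (fun x : R * R => x.1).
Proof. by move=> x; exact: cvg_fst. Qed.
Lemma continuous_plane_snd : continuous (fun x : R * R => x.2).
Proof. by move=> x; exact: cvg_snd. Qed.
Lemma continuous_plane_comp (h : R -> R) f : continuous h -> continuous f ->
  continuous (fun x => h (f x)).
Proof. by move=> ch cf x; apply: (continuous_comp (cf x)); exact: ch. Qed.

Lemma continuous_dot v : continuous (dot v).
Proof.
apply: continuous_planeD; apply: continuous_planeM;
  solve [exact: continuous_plane_cst|exact: continuous_plane_fst|exact: continuous_plane_snd].
Qed.

Lemma continuous_dotxx : continuous (fun x : R * R => dot x x).
Proof.
apply: continuous_planeD; apply: continuous_planeM;
  solve [exact: continuous_plane_fst|exact: continuous_plane_snd].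
Qed.

Lemma dotC x y : dot x y = dot y x.
Proof. by rewrite /dot mulrC (mulrC x.2). Qed.
Lemma dotDr v x y : dot v (x + y) = dot v x + dot v y.
Proof. by rewrite /dot /=; ring. Qed.
Lemma dotZr v (s : R) x : dot v (s *: x) = s * dot v x.
Proof. by rewrite /dot /=; change (v.1 * (s * x.1) + v.2 * (s * x.2) = s * (v.1 * x.1 + v.2 * x.2)); ring. Qed.
Lemma dotNr v x : dot v (- x) = - dot v x.
Proof. by rewrite /dot /=; ring. Qed.
Lemma dotBr v x y : dot v (x - y) = dot v x - dot v y.
Proof. by rewrite dotDr dotNr. Qed.
Lemma dotDl v x y : dot (x + y) v = dot x v + dot y v.
Proof. by rewrite dotC dotDr !(dotC v). Qed.
Lemma dotZl v (s : R) x : dot (s *: x) v = s * dot x v.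
Proof. by rewrite dotC dotZr (dotC v). Qed.
Lemma dotNl v x : dot (- x) v = - dot x v.
Proof. by rewrite dotC dotNr (dotC v). Qed.
Lemma dot_ge0 x : 0 <= dot x x.
Proof. by rewrite /dot addr_ge0// -expr2 sqr_ge0. Qed.

(** The inverse of [env]. It is comparable with 1 + |x|^2 up to powers, and being a product it
    splits over the coordinates. *)
Definition wt x : R := oneDsqr x.1 * oneDsqr x.2.

Lemma wt_ge1 x : 1 <= wt x.
Proof. by rewrite mulr_ege1. Qed.
Lemma wt_gt0 x : 0 < wt x. Proof. exact: lt_le_trans (wt_ge1 x). Qed.
Lemma envE x : env x = (wt x)^-1. Proof. by rewrite invfM. Qed.
Lemma dot_le_wt x : 1 + dot x x <= wt x.
Proof.
rewrite /wt /dot /oneDsqr; have := sqr_ge0 (x.1 * x.2).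
rewrite (_ : (x.1 * x.2) ^+ 2 = x.1 ^+ 2 * x.2 ^+ 2) ?exprMn// -!expr2; nra.
Qed.
Lemma continuous_wt : continuous wt.
Proof.
by apply: continuous_planeM; apply: continuous_planeD;
 do ?[exact: continuous_plane_cst|apply: continuous_planeX];
 [exact: continuous_plane_fst|exact: continuous_plane_snd].
Qed.

Lemma norm_dot_le x v : `|dot v x| <= (`|v.1| + `|v.2|) * wt x.
Proof.
have h (s : R) : `|s| <= oneDsqr s.
  by rewrite /oneDsqr -real_normK ?num_real//; have := normr_ge0 s; nra.
have h1 := h x.1; have h2 := h x.2; have o1 := oneDsqr_ge1 x.1; have o2 := oneDsqr_ge1 x.2.
apply: le_trans (ler_normD _ _) _; rewrite !normrM mulrDl /wt.
apply: lerD; apply: ler_wpM2l => //.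
  by apply: (le_trans h1); rewrite ler_peMr// (le_trans ler01).
by apply: (le_trans h2); rewrite ler_peMl// (le_trans ler01).
Qed.

(** An inequality of Peetre type: a shift costs a factor that depends on the shift alone, so
    dominating functions survive translation and convolution. *)
Lemma wt_shift x b : wt x <= 4 * wt b * wt (x + b).
Proof.
have h (s t : R) : oneDsqr s <= 2 * oneDsqr t * oneDsqr (s + t).
  rewrite /oneDsqr.
  (* The excess over 1 + s ^ 2 is displayed as a sum of squares. *)
  have -> : 2 * (1 + t ^+ 2) * (1 + (s + t) ^+ 2) = 1 + s ^+ 2 + (s + 2 * t) ^+ 2 + 1 + 2 * (t * (s + t)) ^+ 2 by ring.
  by have := sqr_ge0 (s + 2 * t); have := sqr_ge0 (t * (s + t)); lra.
rewrite /wt; apply: (@le_trans _ _ ((2 * oneDsqr b.1 * oneDsqr (x.1 + b.1)) * (2 * oneDsqr b.2 * oneDsqr (x.2 + b.2)))).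
  by rewrite ler_pM// (le_trans ler01)//.
by rewrite /=; apply: eq_refl_le || (rewrite le_eqVlt; apply/orP; left; apply/eqP; ring).
Qed.

Lemma env_shift x b : env (x + b) <= 4 * wt b * env x.
Proof.
rewrite !envE ler_pdivlMr ?wt_gt0// mulrC ler_pdivrMr ?wt_gt0//.
exact: wt_shift.
Qed.

Lemma wt_scale_le (t : R) v : `|t| <= 1 -> wt (t *: v) <= wt v.
Proof.
move=> t1; have t2 : t ^+ 2 <= 1 by rewrite -real_normK ?num_real// expr_le1.
have h (s : R) : 1 + (t * s) ^+ 2 <= 1 + s ^+ 2.
  by rewrite lerD2l exprMn ler_piMl ?sqr_ge0.
by rewrite /wt; apply: ler_pM; rewrite ?(le_trans ler01)//; exact: h.
Qed.

(** The integral of F (x + t v) does not depend on t; differentiating under the integral at t = 0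
    gives the claim. Applied to a product it is integration by parts. *)
Lemma pint_derive_eq0 F dF v (C : R) : continuous F -> continuous dF ->
  (forall x, is_derive x v F (dF x)) ->
  (forall x, `|F x| <= C * env x) -> (forall x, `|dF x| <= C * env x) ->
  pint dF = 0.
Proof.
move=> cF cdF FD FC dFC.
have C0 : 0 <= C.
  by have := le_trans (normr_ge0 _) (FC 0); rewrite pmulr_lge0// env_gt0.
have iF : pintegrable F by apply: (pintegrable_env (pmeas_continuous cF) FC).
have D1 : is_derive (0 : R) 1 (fun t : R => pint (fun x => F (x + t *: v))) (pint (fun x => dF (x + 0 *: v))).
  apply: (@is_derive_pint _ (fun t x => F (x + t *: v)) (fun t x => dF (x + t *: v))
    (fun x => C * (4 * wt v) * env x) 0 1 ltr01).
  - by move=> t _; exact: pintegrable_shift.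
  - by move=> t x _; apply/is_derive_line.
  - by apply: pintegrableZ; exact: integrable_env.
  - move=> t x; rewrite subr0 => /ltW t1; apply: (le_trans (dFC _)).
    rewrite -mulrA ler_wpM2l//; apply: (le_trans (env_shift _ _)).
    by rewrite ler_wpM2r ?env_ge0// ler_wpM2l// wt_scale_le.
have D2 : is_derive (0 : R) 1 (fun t : R => pint (fun x => F (x + t *: v))) 0.
  rewrite (_ : (fun t : R => _) = (fun=> pint F)); first exact: has_deriv_cst.
  by apply/funext => t; rewrite pint_shift.
rewrite -[RHS](is_derive_unique D1 D2); apply: eq_pint => x.
by rewrite scale0r addr0.
Qed.

End Plane.

(** * Gaussian moments *)

Section ExponentialBounds.
Variable R : realType.
Implicit Types (t : R).

Lemma cvg_series_expR t : series (exp_coeff t) n @[n --> \oo] --> expR t.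
Proof. exact: is_cvg_series_exp_coeff. Qed.

Lemma series_expR_le t n : 0 <= t -> series (exp_coeff t) n <= expR t.
Proof.
move=> t0; apply: nondecreasing_cvgn_le; last exact: is_cvg_series_exp_coeff.
apply/nondecreasing_seqP => m; rewrite /series /= big_nat_recr//= lerDl.
exact: exp_coeff_ge0.
Qed.

(** One term of the exponential series. It is the source of the factorial in the bound on Gaussian
    derivatives. *)
Lemma exprn_le_expR t n : 0 <= t -> t ^+ n <= n`!%:R * expR t.
Proof.
move=> t0; rewrite mulrC -ler_pdivrMr ?ltr0n ?fact_gt0//.
apply: le_trans (series_expR_le n.+1 t0).
rewrite /series /= big_nat_recr//= lerDr sumr_ge0// => i _.
exact: exp_coeff_ge0.
Qed.

Lemma even_series_le_expR t n : 0 <= t ->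
  \sum_(0 <= m < n) t ^+ (2 * m) / (2 * m)`!%:R <= expR t.
Proof.
move=> t0; apply: le_trans (series_expR_le (2 * n) t0).
elim: n => [|n IH]; first by rewrite muln0 /series /= !big_nil.
rewrite big_nat_recr//= /series /= mulnS add2n !big_nat_recr//=.
rewrite -addrA lerD//; last by rewrite lerDl; apply: exp_coeff_ge0.
Qed.

Lemma cvg_cos_series t :
  (\sum_(0 <= m < n) (- 1) ^+ m * (t ^+ (2 * m) / (2 * m)`!%:R)) @[n --> \oo] --> cos t.
Proof.
have := @cvg_cos_coeff' _ t; apply: cvg_trans; apply: near_eq_cvg; near=> n.
rewrite /series /=; apply: eq_bigr => m _.
by rewrite /cos_coeff' -mul2n mulrA.
Unshelve. all: by end_near. Qed.

(** Uniform in n, hence a dominating function for the partial sums once a Gaussian or a bounded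
    domain controls the exponential. *)
Lemma cos_series_le t n :
  `|\sum_(0 <= m < n) (- 1) ^+ m * (t ^+ (2 * m) / (2 * m)`!%:R)| <= expR `|t|.
Proof.
apply: le_trans (even_series_le_expR n (normr_ge0 t)).
apply: le_trans (ler_norm_sum _ _ _) _; apply: ler_sum => m _.
rewrite normrM normrX normrN normr1 expr1n mul1r normrM normrX normfV.
by rewrite (ger0_norm (ler0n _ _)).
Qed.

End ExponentialBounds.

(** * Gaussian integrals, their moments, and the transform of the Gaussian *)

Section Gaussian.
Variable R : realType.
Implicit Types (f g : R * R -> R) (x y v xi : R * R).

Definition gauss x : R := expR (- dot x x).

Lemma gauss_gt0 x : 0 < gauss x. Proof. exact: expR_gt0. Qed.

Lemma continuous_gaussc (c : R) : continuous (fun x => expR (- (c * dot x x))).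
Proof.
apply: (continuous_plane_comp (@continuous_expR R)); apply: continuous_planeN.
by apply: continuous_planeM; [exact: continuous_plane_cst|exact: continuous_dotxx].
Qed.

Lemma continuous_gauss : continuous gauss.
Proof.
apply: (continuous_plane_comp (@continuous_expR R)); apply: continuous_planeN.
exact: continuous_dotxx.
Qed.

Lemma wt_gaussc (c : R) n : 0 < c ->
  exists2 C : R, 0 <= C & forall x, wt x ^+ n * expR (- (c * dot x x)) <= C.
Proof.
(* From u ^ n <= n! exp u at u = c (1 + s ^ 2), one coordinate at a time; exp c compensates the 1 in
   u. *)
move=> c0; pose K := c^-1 ^+ n * n`!%:R * expR c.
have K0 : 0 <= K by rewrite !mulr_ge0 ?expR_ge0// exprn_ge0// invr_ge0 ltW.
have h (s : R) : oneDsqr s ^+ n * expR (- (c * s ^+ 2)) <= K.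
  rewrite expRN ler_pdivrMr ?expR_gt0// /K -!mulrA -expRD.
  rewrite -ler_pdivrMl ?exprn_gt0 ?invr_gt0// exprVn invrK -exprMn.
  rewrite (_ : c + c * s ^+ 2 = c * oneDsqr s); last by rewrite /oneDsqr; ring.
  by apply: exprn_le_expR; rewrite mulr_ge0// ?(ltW c0)// (le_trans ler01).
exists (K * K) => [|x]; first exact: mulr_ge0.
rewrite /wt /dot (_ : - (c * _) = - (c * x.1 ^+ 2) + - (c * x.2 ^+ 2)); last by ring.
by rewrite expRD exprMn mulrACA ler_pM// mulr_ge0 ?expR_ge0// exprn_ge0// (le_trans ler01).
Qed.

Lemma wt_gaussc_env (c : R) n : 0 < c ->
  exists2 C : R, 0 <= C & forall x, wt x ^+ n * expR (- (c * dot x x)) <= C * env x.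
Proof.
move=> c0; have [C C0 H] := wt_gaussc n.+1 c0; exists C => // x.
by rewrite envE ler_pdivlMr ?wt_gt0// mulrC mulrA -exprS.
Qed.

Lemma wt_gauss_env n :
  exists2 C : R, 0 <= C & forall x, wt x ^+ n * gauss x <= C * env x.
Proof.
have [C C0 H] := wt_gaussc_env n ltr01; exists C => // x.
by have := H x; rewrite mul1r.
Qed.

Lemma dot_gauss_env xi n :
  exists2 C : R, 0 <= C & forall x, `|dot xi x ^+ n * gauss x| <= C * env x.
Proof.
have [C C0 H] := wt_gauss_env n; exists ((`|xi.1| + `|xi.2|) ^+ n * C) => [|x].
  by rewrite mulr_ge0// exprn_ge0// addr_ge0.
rewrite normrM normrX (ger0_norm (ltW (gauss_gt0 x))) -mulrA.
apply: (@le_trans _ _ (((`|xi.1| + `|xi.2|) * wt x) ^+ n * gauss x)).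
  apply: ler_wpM2r; first exact/ltW/gauss_gt0.
  by rewrite lerXn2r ?nnegrE ?norm_dot_le// mulr_ge0 ?addr_ge0// ltW// wt_gt0.
rewrite exprMn -mulrA; apply: ler_wpM2l; last exact: H.
by rewrite exprn_ge0// addr_ge0.
Qed.

Lemma continuous_dot_gauss xi n : continuous (fun x => dot xi x ^+ n * gauss x).
Proof.
apply: continuous_planeM; last exact: continuous_gauss.
by apply: continuous_planeX; exact: continuous_dot.
Qed.

Lemma pintegrable_dot_gauss xi n : pintegrable (fun x => dot xi x ^+ n * gauss x).
Proof.
have [C _ H] := dot_gauss_env xi n.
apply: pintegrable_env H; apply: pmeas_continuous.
exact: continuous_dot_gauss.
Qed.

Lemma pintegrable_gauss : pintegrable gauss.
Proof.
have := pintegrable_dot_gauss 0 0; apply: eq_pintegrable => x.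
by rewrite expr0 mul1r.
Qed.

Lemma pint_gauss : pint gauss = pi.
Proof.
have i1 := @integrableT_gauss R.
have E : gauss =1 (fun x => gauss_fun x.1 * gauss_fun x.2).
  by move=> x; rewrite /gauss /gauss_fun -expRD /dot -!expr2 opprD.
rewrite (eq_pint E); apply: etrans; first exact: (Rintegral_prod i1 i1).
rewrite /Rintegral integralT_gauss /= -expr2 sqr_sqrtr//.
exact: pi_ge0.
Qed.

(** The derivative of (xi . x)^(n + 1) exp (- |x|^2) along xi, called [dF] in the proof, has
    integral 0. *)
Lemma gauss_moment_rec xi n :
  2 * pint (fun x => dot xi x ^+ n.+2 * gauss x) =
  n.+1%:R * dot xi xi * pint (fun x => dot xi x ^+ n * gauss x).
Proof.
have [C1 C10 H1] := dot_gauss_env xi n.+1.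
have [C2 C20 H2] := dot_gauss_env xi n.
have [C3 C30 H3] := dot_gauss_env xi n.+2.
have i1 := pintegrable_dot_gauss xi n.
have i3 := pintegrable_dot_gauss xi n.+2.
pose dF x := n.+1%:R * dot xi xi * (dot xi x ^+ n * gauss x) -
  2 * (dot xi x ^+ n.+2 * gauss x).
have cdF : continuous dF.
  by apply: continuous_planeB; apply: continuous_planeM;
    do ?[exact: continuous_plane_cst|exact: continuous_dot_gauss].
have DF x : is_derive x xi (fun x => dot xi x ^+ n.+1 * gauss x) (dF x).
  apply/is_derive_line0.
  rewrite (_ : (fun _ => _) = (fun s : R => (dot xi x + s * dot xi xi) ^+ n.+1 *
      expR (- (dot x x + 2 * s * dot xi x + s ^+ 2 * dot xi xi)))); last first.
    apply/funext => s; rewrite /gauss dotDr dotZr; congr (_ * expR (- _)).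
    by rewrite dotDl dotDr dotZr dotDr dotZl dotZl dotZr (dotC x xi); ring.
  apply/has_derivP; apply: has_deriv_eq; first by derive_rules.
  by rewrite /= /dF /gauss expr0n /= !(mul0r, mulr0, addr0) (exprS _ n.+1); ring.
have := @pint_derive_eq0 _ _ dF xi (C1 + (n.+1%:R * dot xi xi * C2 + 2 * C3))
  (@continuous_dot_gauss xi n.+1) cdF DF.
have K0 : 0 <= n.+1%:R * dot xi xi :> R by rewrite mulr_ge0// dot_ge0.
have -> : pint dF = n.+1%:R * dot xi xi * pint (fun x => dot xi x ^+ n * gauss x)
   - 2 * pint (fun x => dot xi x ^+ n.+2 * gauss x).
  by rewrite pintB ?pintZ//; exact: pintegrableZ.
move=> H; apply/esym/eqP; rewrite -subr_eq0; apply/eqP/H => x.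
  apply: (le_trans (H1 x)); apply: ler_wpM2r; first exact: env_ge0.
  by rewrite lerDl addr_ge0// mulr_ge0.
apply: (@le_trans _ _ ((n.+1%:R * dot xi xi * C2 + 2 * C3) * env x)); last first.
  by rewrite ler_wpM2r ?env_ge0// lerDr.
rewrite /dF; apply: le_trans (ler_normB _ _) _; rewrite [leRHS]mulrDl; apply: lerD.
  by rewrite normrM (ger0_norm K0) -[leRHS]mulrA ler_wpM2l.
by rewrite normrM ger0_norm// -[leRHS]mulrA ler_wpM2l.
Qed.

(** The factor (2 m)! / (4 ^ m m!) is the normalised even moment of exp (- s ^ 2) on the line; the
    disc moments, and through them the coefficients of J_0, inherit it. *)
Lemma gauss_moment xi m : pint (fun x => dot xi x ^+ (2 * m) * gauss x) =
  pi * ((2 * m)`!%:R / (4 ^+ m * m`!%:R)) * dot xi xi ^+ m.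
Proof.
elim: m => [|m IH].
  rewrite (_ : pi * _ * _ = pi); last by rewrite muln0 fact0 !expr0; field.
  by rewrite -pint_gauss; apply: eq_pint => x; rewrite expr0 mul1r.
have := gauss_moment_rec xi (2 * m); rewrite IH.
have -> : (2 * m.+1 = (2 * m).+2)%N by rewrite mulnS.
move=> H.
apply: (mulfI (_ : (2 : R) != 0)) => //.
rewrite mulrA H !factS !natrM !exprS.
have h1 : (m`!%:R : R) != 0 by rewrite pnatr_eq0 -lt0n fact_gt0.
have h2 : (4 ^+ m : R) != 0 by rewrite expf_neq0.
have h3 : (m.+1%:R : R) != 0 by [].
have -> : ((2 * m).+2%:R : R) = 2 * m.+1%:R by rewrite -natrM mulnS.
move: (m.+1%:R) ((2 * m).+1%:R) ((2 * m)`!%:R) h3 => a b c h3.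
by field; rewrite h1 h2 h3.
Qed.

Lemma norm_dot_le_half x y : `|dot x y| <= 2^-1 * dot x x + 2^-1 * dot y y.
Proof.
have h1 := dot_ge0 (x + y); have h2 := dot_ge0 (x - y).
move: h1 h2; rewrite !dotDr !dotDl !dotNr !dotNl (dotC y x) => h1 h2.
by rewrite ler_norml; apply/andP; split; lra.
Qed.

(** Half of the Gaussian pays for the exponential, the other half stays integrable. *)
Lemma exp_dot_gauss_le xi x :
  expR `|dot xi x| * gauss x <= expR (2^-1 * dot xi xi) * expR (- (2^-1 * dot x x)).
Proof.
rewrite -!expRD ler_expR; have := norm_dot_le_half xi x; lra.
Qed.

(** Integrated term by term, the even moments turn the cosine series into the exponential series at
    - |xi|^2 / 4. *)
Lemma gauss_fourier xi : pint (fun x => cos (dot xi x) * gauss x) =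
  pi * expR (- (dot xi xi / 4)).
Proof.
have h0 : (0 : R) < 2^-1 by [].
have [C C0 HC] := wt_gaussc_env 0 h0.
pose S n x := \sum_(0 <= m < n) (- 1) ^+ m * (dot xi x ^+ (2 * m) / (2 * m)`!%:R).
have cS n : continuous (S n).
  elim: n => [|n IH]; first by rewrite /S; move=> x; under eq_fun do rewrite big_nil; exact: cvg_cst.
  rewrite (_ : S n.+1 = fun x => S n x + (- 1) ^+ n * (dot xi x ^+ (2 * n) / (2 * n)`!%:R)).
    apply: continuous_planeD => //; apply: continuous_planeM; first exact: continuous_plane_cst.
    apply: continuous_planeM; last exact: continuous_plane_cst.
    by apply: continuous_planeX; exact: continuous_dot.
  by apply/funext => x; rewrite /S big_nat_recr.
have L1 : pint (fun x => S n x * gauss x) @[n --> \oo] --> pint (fun x => cos (dot xi x) * gauss x).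
  apply: (@pint_cvg _ (fun n x => S n x * gauss x) _
      (fun x => expR (2^-1 * dot xi xi) * C * env x)).
  - move=> n; apply: pmeas_continuous.
    by apply: continuous_planeM => //; exact: continuous_gauss.
  - by move=> x; apply: cvgM; [exact: cvg_cos_series|exact: cvg_cst].
  - by apply: pintegrableZ; exact: integrable_env.
  - move=> n x; rewrite normrM (ger0_norm (ltW (gauss_gt0 x))).
    apply: (@le_trans _ _ (expR `|dot xi x| * gauss x)).
      apply: ler_wpM2r; first exact/ltW/gauss_gt0.
      exact: cos_series_le.
    apply: (le_trans (exp_dot_gauss_le _ _)); rewrite -mulrA ler_wpM2l ?expR_ge0//.
    by have := HC x; rewrite expr0 mul1r.
have E n : pint (fun x => S n x * gauss x) = pi * series (exp_coeff (- (dot xi xi / 4))) n.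
  have iS k : pintegrable (fun x => S k x * gauss x).
    elim: k => [|k IH].
      apply: (@eq_pintegrable _ (fun x => 0 * gauss x)); last exact: (pintegrableZ 0 pintegrable_gauss).
      by move=> x; rewrite /S big_nil.
    have := pintegrableD IH (pintegrableZ ((- 1) ^+ k / (2 * k)`!%:R) (pintegrable_dot_gauss xi (2 * k))).
    apply: eq_pintegrable => x; rewrite /S big_nat_recr//=; ring.
  elim: n => [|n IH].
    rewrite /series /= big_nil mulr0 -[RHS](mul0r (pint gauss)) -pintZ; last exact: pintegrable_gauss.
    by apply: eq_pint => x; rewrite /S big_nil.
  have -> : (fun x => S n.+1 x * gauss x) =
     (fun x => S n x * gauss x + ((- 1) ^+ n / (2 * n)`!%:R) * (dot xi x ^+ (2 * n) * gauss x)).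
    by apply/funext => x; rewrite /S big_nat_recr//=; ring.
  rewrite pintD//; last by apply: pintegrableZ; exact: pintegrable_dot_gauss.
  rewrite IH pintZ; last exact: pintegrable_dot_gauss.
  rewrite gauss_moment /series /= big_nat_recr//= mulrDr; congr (_ + _).
  have -> : exp_coeff (- (dot xi xi / 4)) n = (- 1) ^+ n * dot xi xi ^+ n / 4 ^+ n / n`!%:R.
    by rewrite /exp_coeff/= -[in LHS]mulN1r exprMn expr_div_n mulrA.
  have h1 : (n`!%:R : R) != 0 by rewrite pnatr_eq0 -lt0n fact_gt0.
  have h2 : (4 ^+ n : R) != 0 by rewrite expf_neq0.
  have h3 : ((2 * n)`!%:R : R) != 0 by rewrite pnatr_eq0 -lt0n fact_gt0.
  by field; rewrite h1 h2 h3.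
have L2 : pint (fun x => S n x * gauss x) @[n --> \oo] --> pi * expR (- (dot xi xi / 4)).
  rewrite (_ : (fun n => _) = (fun n => pi * series (exp_coeff (- (dot xi xi / 4))) n)).
    by apply: cvgM; [exact: cvg_cst|exact: cvg_series_expR].
  exact/funext.
by rewrite -(cvg_lim _ L1)// -(cvg_lim _ L2).
Qed.

(** Dominated convergence: by [wt_shift] the Gaussian absorbs the polynomial growth of f, uniformly
    in 0 <= s k <= 1. The factor pi is the mass of [gauss]. *)
Lemma gauss_approx_identity f (C : R) n (s : nat -> R) x : continuous f ->
  (forall y, `|f y| <= C * wt y ^+ n) ->
  (forall k, 0 <= s k <= 1) -> s k @[k --> \oo] --> 0 ->
  pint (fun z => f (x + s k *: z) * gauss z) @[k --> \oo] --> f x * pi.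
Proof.
move=> cf fC s01 s0.
have C0 : 0 <= C.
  by have := le_trans (normr_ge0 _) (fC 0); rewrite pmulr_lge0// exprn_gt0// wt_gt0.
have [D D0 HD] := wt_gauss_env n.
rewrite -pint_gauss -pintZ; last exact: pintegrable_gauss.
apply: (@pint_cvg _ (fun k z => f (x + s k *: z) * gauss z) _
  (fun z => C * (4 * wt (- x)) ^+ n * (D * env z))).
- move=> k; apply: pmeasM; last by apply: pmeas_continuous; exact: continuous_gauss.
  rewrite (_ : (fun z => _) = (fun z => f (s k *: z + x))).
    by apply: pmeas_affine; exact: pmeas_continuous.
  by apply/funext => z; rewrite addrC.
- move=> z; apply: cvgM; last exact: cvg_cst.
  apply: (@continuous_cvg _ _ _ _ _ (fun k => x + s k *: z) f); first exact: cf.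
  rewrite -[X in _ --> X]addr0 -[X in _ + X](scale0r z).
  by apply: cvgD; [exact: cvg_cst|apply: cvgZ; [exact: s0|exact: cvg_cst]].
- by do 2! apply: pintegrableZ; exact: integrable_env.
- move=> k z; rewrite normrM (ger0_norm (ltW (gauss_gt0 z))).
  apply: (@le_trans _ _ (C * (4 * wt (- x) * wt z) ^+ n * gauss z)).
    apply: ler_wpM2r; first exact/ltW/gauss_gt0.
    apply: (le_trans (fC _)); apply: ler_wpM2l => //.
    have w0 y : 0 <= wt y by exact/ltW/wt_gt0.
    rewrite lerXn2r ?nnegrE// ?mulr_ge0//.
    apply: (le_trans (wt_shift _ (- x))); rewrite ler_wpM2l ?mulr_ge0//.
    rewrite addrAC subrr add0r; apply: wt_scale_le.
    by have /andP[? ?] := s01 k; rewrite ger0_norm.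
  rewrite exprMn -!mulrA; apply: ler_wpM2l => //; apply: ler_wpM2l.
    by rewrite exprn_ge0// mulr_ge0// ltW// wt_gt0.
  exact: HD.
Qed.

End Gaussian.

(** Turns a domain of integration into a factor, so that integrals run over the whole space. *)
Definition iverson (R : realType) (b : bool) : R := b%:R.
Arguments iverson {R} b.

Lemma iverson_ge0 (R : realType) b : 0 <= iverson b :> R.
Proof. exact: ler0n. Qed.

Lemma iverson_le1 (R : realType) b : iverson b <= 1 :> R.
Proof. by case: b; rewrite /iverson ?ler01. Qed.

(** * Integrals on the line: fundamental theorem, negative powers near 0 *)

Section OneDimension.
Variable R : realType.
Local Notation leb := (@lebesgue_measure R).
Local Notation mR := (measurableTypeR R).

Lemma is_derive_powR (p t : R) : 0 < t ->
  is_derive t 1 (fun s => s `^ p) (p * t `^ (p - 1)).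
Proof.
move=> t0; have ti : t \in `]0, +oo[ by rewrite in_itv/= t0.
by apply: DeriveDef; [exact: derivable_powR|rewrite -derive1E powR_derive1].
Qed.

Lemma is_derive_cvgP (f : R -> R) (r l : R) : is_derive r 1 f l <->
  (e^-1 * (f (r + e) - f r)) @[e --> 0^'] --> l.
Proof.
have E : (fun h : R => h^-1 *: ((f \o shift r) (h *: (1 : R)) - f r)) =
    (fun e : R => e^-1 * (f (r + e) - f r)).
  apply/funext => h /=; congr (_ * (f _ - _)).
  by rewrite [h *: 1]mulr1 addrC.
split => [[fd <-]|fl]; first by move: fd; rewrite /derive /derivable E.
apply: DeriveDef.
  by rewrite /derivable E; apply/cvg_ex; exists l.
by rewrite /derive E; exact: cvg_lim.
Qed.

Lemma integral_FTC (f F : R -> R) (a b : R) : a < b ->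
  (forall t, a <= t <= b -> has_deriv F t (f t)) ->
  (forall t, a <= t <= b -> {for t, continuous f}) ->
  (\int[leb]_(t in `[a, b]) (f t)%:E = (F b - F a)%:E)%E.
Proof.
move=> ab FD cf; rewrite EFinB.
have cF t : a <= t <= b -> {for t, continuous F}.
  by move=> tab; exact: is_derive_continuous (FD t tab).
apply: continuous_FTC2 => //.
- apply: continuous_in_subspaceT => t /set_mem /=; rewrite in_itv/= => tab.
  exact: cf.
- split.
  + by move=> t; rewrite in_itv/= => /andP[at' tb]; case: (FD t); rewrite ?(ltW at') ?(ltW tb).
  + by apply: cvg_at_right_filter; apply: cF; rewrite lexx ltW.
  + by apply: cvg_at_left_filter; apply: cF; rewrite lexx ltW.
- move=> t; rewrite in_itv/= => /andP[at' tb]; rewrite derive1E.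
  by case: (FD t); rewrite ?(ltW at') ?(ltW tb)// => _ ->.
Qed.

(** Monotone convergence as an integrability test. Both singular integrands below are exhausted by
    cutting out a neighbourhood of 0. *)
Lemma nondecreasing_bounded_integrable d (T : measurableType d)
    (mu : {measure set T -> \bar R}) (f_ : nat -> T -> R) (f : T -> R) (C : R) :
  (forall n, measurable_fun setT (f_ n)) -> (forall n x, 0 <= f_ n x) ->
  (forall x, {homo f_ ^~ x : m n / (m <= n)%N >-> m <= n}) ->
  (forall x, f_ n x @[n --> \oo] --> f x) ->
  (forall n, (\int[mu]_x (f_ n x)%:E <= C%:E)%E) ->
  mu.-integrable setT (EFin \o f).
Proof.
move=> mf f0 nf ff fC.
have mlim : measurable_fun setT f.
  by apply: (measurable_fun_cvg mf) => x _; exact: ff.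
have fge0 x : 0 <= f x.
  rewrite -(cvg_lim _ (ff x))//; apply: limr_ge; last exact: nearW.
  by apply/cvg_ex; exists (f x); exact: ff.
apply/integrableP; split; first exact/measurable_EFinP.
have := @cvg_monotone_convergence _ _ _ mu setT measurableT (fun n x => (f_ n x)%:E).
have E : (fun x => `|(EFin \o f) x|)%E = (fun x => limn (fun n => (f_ n x)%:E)).
  apply/funext => x /=; rewrite ger0_norm//; apply/esym/cvg_lim => //.
  by apply: cvg_EFin; [exact: nearW|exact: ff].
rewrite E => H.
have {}H := H (fun n => (measurable_EFinP setT (f_ n)).2 (mf n))
  (fun n x _ => f0 n x) (fun x _ m n mn => nf x m n mn).
apply: (@le_lt_trans _ _ C%:E); last exact: ltry.
rewrite -(cvg_lim _ H)//; apply: lime_le; first by apply/cvg_ex; eexists; exact: H.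
by apply: nearW.
Qed.

Lemma measurable_le_cst (c : R) : measurable_fun [set: R] (fun t : R => iverson (c <= t) : R).
Proof.
rewrite (_ : (fun t => _) = \1_(`[c, +oo[%classic)); first exact: measurable_indic.
apply/funext => t; rewrite indicE; rewrite /iverson; congr (nat_of_bool _)%:R.
by apply/idP/idP; rewrite inE/= in_itv/= andbT.
Qed.

Lemma measurable_lt_cst (c : R) : measurable_fun [set: R] (fun t : R => iverson (t < c) : R).
Proof.
rewrite (_ : (fun t => _) = \1_(`]-oo, c[%classic)); first exact: measurable_indic.
apply/funext => t; rewrite indicE; rewrite /iverson; congr (nat_of_bool _)%:R.
by apply/idP/idP; rewrite inE/= in_itv/=.
Qed.

Lemma measurable_cst_le (c : R) : measurable_fun [set: R] (fun t : R => iverson (t <= c) : R).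
Proof.
rewrite (_ : (fun t => _) = \1_(`]-oo, c]%classic)); first exact: measurable_indic.
apply/funext => t; rewrite indicE; rewrite /iverson; congr (nat_of_bool _)%:R.
by apply/idP/idP; rewrite inE/= in_itv/=.
Qed.

Lemma measurable_powR (p : R) : measurable_fun [set: R] (fun t : R => t `^ p).
Proof. exact: measurable_powR. Qed.

Lemma powR_pos_integrable (p : R) : 0 < p < 1 ->
  leb.-integrable setT (EFin \o (fun t : mR => iverson ((0 : R) < t <= 1) * (t : R) `^ (- p) : R)).
Proof.
move=> /andP[p0 p1].
have q0 : 0 < 1 - p by rewrite subr_gt0.
(* The cut-off 1 / (n + 2) is strictly below 1, so the interval on which the primitive is evaluated
   is never degenerate. *)
pose f_ (n : nat) (t : mR) : R := iverson (n.+2%:R^-1 <= (t : R)) * (iverson ((t : R) <= 1) * (t : R) `^ (- p)).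
apply: (@nondecreasing_bounded_integrable _ _ leb f_ _ (1 - p)^-1).
- move=> n; apply: measurable_funM; first exact: measurable_le_cst.
  by apply: measurable_funM; [exact: measurable_cst_le|exact: measurable_powR].
- by move=> n t; rewrite !mulr_ge0 ?powR_ge0 ?iverson_ge0.
- move=> t m n mn; rewrite /f_ ler_wpM2r ?mulr_ge0 ?powR_ge0 ?iverson_ge0// ler_nat.
  have : (n.+2%:R^-1 : R) <= m.+2%:R^-1 by rewrite lef_pV2 ?posrE// ler_nat.
  move=> h; case: (leP m.+2%:R^-1 (t : R)) => // h1.
  by rewrite (le_trans h h1).
- move=> t; have [t0|t0] := ltP 0 t; last first.
    rewrite /iverson /= mul0r (_ : (fun n => f_ n t) = fun=> 0); first exact: cvg_cst.
    apply/funext => n; by rewrite /f_ /iverson leNgt (le_lt_trans t0) ?mul0r.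
  apply: cvg_near_cst; near=> n.
  rewrite /f_ /iverson /= (_ : (_ <= t) = true) ?mul1r//.
  apply: (@le_trans _ _ n.+1%:R^-1); first by rewrite lef_pV2 ?posrE// ler_nat.
  by apply: ltW; near: n; exact: near_infty_natSinv_lt (PosNum t0).
- move=> n.
  set a : R := n.+2%:R^-1.
  have a0 : 0 < a by rewrite invr_gt0.
  have a1 : a < 1 by rewrite invf_lt1// ltr1n.
  rewrite (_ : (fun t => _) = (fun t : mR => ((fun t : mR => ((t : R) `^ (- p))%:E) \_ (`[a, 1%R]%classic : set mR)) t)); last first.
    apply/funext => t; rewrite /f_ /iverson patchE; have [] := boolP (t \in `[a, 1]%classic).
      by rewrite inE /= in_itv/= => /andP[-> ->]; rewrite !mul1r.
    rewrite notin_setE /= in_itv/= => /negP/nandP[] /negbTE ->; rewrite ?mul0r ?mulr0//.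
  rewrite -integral_mkcond.
  rewrite (@integral_FTC (fun t => t `^ (- p)) (fun t => (1 - p)^-1 * t `^ (1 - p)) a 1)//.
  + rewrite lee_fin -mulrBr ler_piMr ?invr_ge0 ?(ltW q0)// powR1.
    by rewrite lerBlDr lerDl powR_ge0.
  + move=> t /andP[at' _]; have t0 : 0 < t by exact: lt_le_trans at'.
    apply: has_deriv_eq; first by apply: has_derivM; [exact: has_deriv_cst|exact: is_derive_powR].
    rewrite /= mulr0 addr0 mulrA mulVf ?gt_eqF// mul1r.
    by congr (_ `^ _); ring.
  + move=> t /andP[at' _]; have t0 : 0 < t by exact: lt_le_trans at'.
    exact: (is_derive_continuous (is_derive_powR (- p) t0)).
Unshelve. all: by end_near. Qed.

End OneDimension.

(** * Radial integrals *)

Section Modulus.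
Variable R : realType.
Implicit Types (x y v xi : R * R).

Lemma modulus_ge0 x : 0 <= modulus x. Proof. exact: sqrtr_ge0. Qed.

Lemma sqr_modulus x : modulus x ^+ 2 = dot x x.
Proof. by rewrite sqr_sqrtr// dot_ge0. Qed.

Lemma modulusZ (s : R) x : modulus (s *: x) = `|s| * modulus x.
Proof.
rewrite /modulus dotZr dotZl mulrA -expr2 sqrtrM ?sqr_ge0//.
by rewrite sqrtr_sqr.
Qed.

Lemma modulusN x : modulus (- x) = modulus x.
Proof. by rewrite /modulus dotNr dotNl opprK. Qed.

Lemma continuous_modulus : continuous (@modulus R).
Proof.
apply: (continuous_plane_comp (@sqrt_continuous R)); exact: continuous_dotxx.
Qed.

Lemma pmeas_modulus : pmeas (@modulus R).
Proof. by apply: pmeas_continuous; exact: continuous_modulus. Qed.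

Lemma norm_fst_modulus x : `|x.1| <= modulus x.
Proof.
rewrite -sqrtr_sqr /modulus ler_wsqrtr// /dot -expr2 lerDl -expr2; exact: sqr_ge0.
Qed.

Lemma norm_snd_modulus x : `|x.2| <= modulus x.
Proof.
rewrite -sqrtr_sqr /modulus ler_wsqrtr// /dot -!expr2 lerDr; exact: sqr_ge0.
Qed.

Lemma modulus_le_norms x : modulus x <= `|x.1| + `|x.2|.
Proof.
rewrite /modulus -[leRHS]ger0_norm ?addr_ge0// -sqrtr_sqr ler_wsqrtr//.
rewrite /dot -!expr2 sqrrD !real_normK ?num_real//.
have := mulr_ge0 (normr_ge0 x.1) (normr_ge0 x.2); rewrite -[_ *+ 2]mulr_natl; lra.
Qed.

Lemma modulus_eq0 x : (modulus x == 0) = (x == 0).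
Proof.
apply/idP/idP => [|/eqP->]; last first.
  by rewrite /modulus /dot /= !mulr0 addr0 sqrtr0.
move=> /eqP h; have := norm_fst_modulus x; have := norm_snd_modulus x.
rewrite h !normr_le0; case: x {h} => a b /= /eqP -> /eqP ->; exact: eqxx.
Qed.

Lemma norm_dot_modulus x y : `|dot x y| <= modulus x * modulus y.
Proof.
rewrite -ler_sqr ?nnegrE ?mulr_ge0 ?modulus_ge0//.
rewrite exprMn !sqr_modulus real_normK ?num_real// /dot.
by have := sqr_ge0 (x.1 * y.2 - x.2 * y.1); nra.
Qed.

Lemma pmeas_iverson_lt (r : R) : pmeas (fun y => iverson (modulus y < r)).
Proof. exact: (pmeas_comp (measurable_lt_cst r) pmeas_modulus). Qed.

Lemma pmeas_iverson_ge (a : R) : pmeas (fun y => iverson (a <= modulus y)).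
Proof. exact: (pmeas_comp (measurable_le_cst a) pmeas_modulus). Qed.

Lemma iversonM (b c : bool) : iverson b * iverson c = iverson (b && c) :> R.
Proof. by case: b; case: c; rewrite /iverson /= ?mulr1 ?mulr0. Qed.

Lemma pmeas_annulus (a r : R) : pmeas (fun y => iverson (a <= modulus y < r)).
Proof.
rewrite (_ : (fun y => _) = (fun y => iverson (a <= modulus y) * iverson (modulus y < r))).
  by apply: pmeasM; [exact: pmeas_iverson_ge|exact: pmeas_iverson_lt].
by apply/funext => y; rewrite iversonM.
Qed.

Lemma pmeas_comp_modulus (h : R -> R) : measurable_fun setT h ->
  pmeas (fun y => h (modulus y)).
Proof. by move=> mh; exact: (pmeas_comp mh pmeas_modulus). Qed.

(** Polynomials on discs thereby inherit integrability from the Gaussian moments. *)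
Lemma iverson_modulus_gauss (r : R) y :
  iverson (modulus y < r) <= expR (r ^+ 2) * gauss y.
Proof.
rewrite /gauss -expRD -sqr_modulus.
have [h|_] := ltP (modulus y) r; last by rewrite expR_ge0.
rewrite /iverson -[X in X <= _]expR0 ler_expR subr_ge0.
by rewrite lerXn2r ?nnegrE ?modulus_ge0 ?ltW// (le_lt_trans (modulus_ge0 y)).
Qed.

End Modulus.

(** * Integrals of a radial factor against a fixed weight *)

Section Radial.
Variable R : realType.
Implicit Types (x y v xi : R * R).
Variables (g : R * R -> R) (h : R -> R) (a : R).
Hypotheses (g_ge0 : forall y, 0 <= g y).
Hypothesis disc_g : forall r, pintegrable (fun y => iverson (modulus y < r) * g y).
Hypotheses (mg : pmeas g) (mh : measurable_fun setT h).
Hypothesis h_bounded : forall r, exists M : R, forall s, a <= s < r -> `|h s| <= M.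

Let G r := pint (fun y => iverson (modulus y < r) * g y).
Let H r := pint (fun y => iverson (a <= modulus y < r) * (h (modulus y) * g y)).

Lemma radial_integrable r :
  pintegrable (fun y => iverson (a <= modulus y < r) * (h (modulus y) * g y)).
Proof.
have [M HM] := h_bounded r.
apply: (@pintegrable_dominated _ (fun y => `|M| * (iverson (modulus y < r) * g y))).
- apply: pmeasM; first exact: pmeas_annulus.
  by apply: pmeasM => //; exact: pmeas_comp_modulus.
- exact: pintegrableZ.
- move=> y; rewrite !normrM (ger0_norm (iverson_ge0 _ _)) (ger0_norm (g_ge0 y)).
  rewrite mulrCA; have [/andP[h1 h2]|_] := boolP (a <= modulus y < r).
    rewrite h2; rewrite ler_wpM2r ?mulr_ge0 ?iverson_ge0//.
    by apply: (le_trans (HM _ _)); rewrite ?h1// ler_norm.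
  by rewrite {1}/iverson mul0r mulr0 !mulr_ge0 ?iverson_ge0.
Qed.

Lemma radial_increment (r1 r2 k e : R) : a <= r1 -> r1 <= r2 ->
  (forall s, r1 <= s < r2 -> `|h s - k| <= e) ->
  `|H r2 - H r1 - k * (G r2 - G r1)| <= e * (G r2 - G r1).
Proof.
move=> ar1 r12 hk.
have i1 := radial_integrable r1; have i2 := radial_integrable r2.
have j1 := disc_g r1; have j2 := disc_g r2.
rewrite /H /G -!pintB// -!pintZ//; try exact: pintegrableB.
rewrite -pintB; [|exact: pintegrableB|by apply: pintegrableZ; exact: pintegrableB].
apply: norm_pint_le.
- apply: pintegrableB; first exact: pintegrableB.
  by apply: pintegrableZ; exact: pintegrableB.
- by apply: pintegrableZ; exact: pintegrableB.
- move=> y; set m := modulus y.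
  have [m1|m1] := ltP m r1.
    have m2 : m < r2 by exact: lt_le_trans r12.
    by rewrite m2 !subrr !mulr0 subrr normr0.
  rewrite (le_trans ar1 m1) /= ; have [m2|m2] := ltP m r2; last first.
    by rewrite /iverson !mul0r !subrr !mulr0 subrr normr0.
  rewrite /iverson !mul1r !mul0r !subr0 -mulrBl normrM (ger0_norm (g_ge0 y)).
  by rewrite ler_wpM2r// hk// m1 m2.
Qed.

(** Stands in for polar coordinates. On a thin annulus at radius r, h differs from h r by at most e,
    so the increment of H differs from h r times that of G by at most e times the increment of G. *)
Lemma radial_derive (r c : R) : a < r -> {for r, continuous h} ->
  is_derive r 1 G c -> is_derive r 1 H (h r * c).
Proof.
move=> ar ch /is_derive_cvgP Gc; apply/is_derive_cvgP.
pose Q e := e^-1 * (G (r + e) - G r).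
pose P e := e^-1 * (H (r + e) - H r).
rewrite -[X in _ --> X]add0r.
rewrite (_ : (fun e => _) = (fun e => (P e - h r * Q e) + h r * Q e)); last first.
  by apply/funext => e; rewrite subrK.
apply: cvgD; last by apply: cvgM; [exact: cvg_cst|exact: Gc].
apply/cvgr0Pnorm_le => e e0.
(* Near r the difference quotients of G are at most |c| + 1, so closeness of h within e / (|c| + 1)
   leaves an error of at most e. *)
have c1 : 0 < `|c| + 1 by rewrite ltr_pwDr.
have e'0 : 0 < e / (`|c| + 1) by rewrite divr_gt0.
have Qb : \forall x \near (0 : R)^', `|Q x| <= `|c| + 1.
  have : `|Q x| @[x --> (0 : R)^'] --> `|c| by apply: cvg_norm; exact: Gc.
  move=> /cvgrPdist_le/(_ 1 ltr01); apply: filterS => x.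
  by rewrite ler_distlC => /andP[_]; rewrite addrC.
have [d /= d0 hd] : \forall s \near r, `|h r - h s| <= e / (`|c| + 1).
  by move: ch => /cvgrPdist_le/(_ _ e'0).
have dd : 0 < Num.min d (r - a) by rewrite lt_min d0 subr_gt0.
near=> x.
have x0 : x != 0 by near: x; exact: nbhs_dnbhs_neq.
have xd : `|x| < Num.min d (r - a) by near: x; exact: dnbhs0_lt.
move: xd; rewrite lt_min => /andP[xd xra].
have key : `|H (r + x) - H r - h r * (G (r + x) - G r)| <= e / (`|c| + 1) * `|G (r + x) - G r|.
  have [xp|xn] := ltP 0 x.
    apply: le_trans (radial_increment (ltW ar) (_ : r <= r + x) _ (k := h r) (e := e / (`|c| + 1))) _.
    - by rewrite lerDl ltW.
    - move=> s /andP[rs sr]; rewrite distrC; apply: hd => /=.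
      rewrite distrC ger0_norm ?subr_ge0//; apply: lt_trans xd.
      by rewrite gtr0_norm// ltrBlDl.
    - by rewrite ler_wpM2l ?(ltW e'0)// ler_norm.
  have {xn} xn : x < 0 by rewrite lt_neqAle x0.
  have -> : H (r + x) - H r - h r * (G (r + x) - G r) = - (H r - H (r + x) - h r * (G r - G (r + x))) by ring.
  rewrite normrN (distrC (G _)).
  apply: le_trans (radial_increment (_ : a <= r + x) (_ : r + x <= r) _ (k := h r) (e := e / (`|c| + 1))) _.
  - by move: xra; rewrite ltr0_norm// => xra; lra.
  - by rewrite gerDl ltW.
  - move=> s /andP[rs sr]; rewrite distrC; apply: hd => /=.
    rewrite gtr0_norm ?subr_gt0//; apply: le_lt_trans xd.
    by rewrite ltr0_norm//; lra.
  - by rewrite ler_wpM2l ?(ltW e'0)// ler_norm.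
have -> : P x - h r * Q x = x^-1 * (H (r + x) - H r - h r * (G (r + x) - G r)).
  by rewrite /P /Q; ring.
rewrite normrM normfV mulrC ler_pdivrMr ?normr_gt0//.
apply: (le_trans key).
have -> : `|G (r + x) - G r| = `|x| * `|Q x|.
  by rewrite /Q normrM normfV mulrA mulfV ?mul1r// normr_eq0.
rewrite (mulrC `|x|) mulrA ler_wpM2r//.
rewrite -mulrA ler_piMr ?(ltW e0)// mulrC ler_pdivrMr// mul1r.
near: x; exact: Qb.
Unshelve. all: by end_near. Qed.

End Radial.

(** * Moments of (xi . y)^(2 m) over discs *)

Section DiscMoments.
Variable R : realType.
Implicit Types (x y v xi : R * R).

Definition disc_moment xi m (r : R) : R :=
  pint (fun y => iverson (modulus y < r) * dot xi y ^+ (2 * m)).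

Lemma dot_even_ge0 xi m y : 0 <= dot xi y ^+ (2 * m).
Proof. by rewrite exprM exprn_ge0// sqr_ge0. Qed.

Lemma pmeas_dot_even xi m : pmeas (fun y => dot xi y ^+ (2 * m)).
Proof.
by apply: pmeas_continuous; apply: continuous_planeX; exact: continuous_dot.
Qed.

Lemma disc_moment_integrable xi m r :
  pintegrable (fun y => iverson (modulus y < r) * dot xi y ^+ (2 * m)).
Proof.
apply: (@pintegrable_dominated _ (fun y => expR (r ^+ 2) * (dot xi y ^+ (2 * m) * gauss y))).
- by apply: pmeasM; [exact: pmeas_iverson_lt|exact: pmeas_dot_even].
- by apply: pintegrableZ; exact: pintegrable_dot_gauss.
- move=> y; rewrite ger0_norm; last by rewrite mulr_ge0 ?iverson_ge0 ?dot_even_ge0.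
  rewrite mulrCA mulrC ler_wpM2l ?dot_even_ge0//.
  exact: iverson_modulus_gauss.
Qed.

(** The area contributes r ^ 2, the integrand its degree of homogeneity 2 m. *)
Lemma disc_moment_scale xi m (r : R) : 0 < r ->
  disc_moment xi m r = r ^+ (2 * m).+2 * disc_moment xi m 1.
Proof.
move=> r0; rewrite /disc_moment (pint_affine 0 r0); last exact: disc_moment_integrable.
have -> : r ^+ (2 * m).+2 = r ^+ 2 * r ^+ (2 * m) by rewrite -exprD add2n.
rewrite -mulrA -(pintZ _ (disc_moment_integrable xi m 1)).
congr (_ * _); apply: eq_pint => y; rewrite addr0 modulusZ dotZr exprMn.
rewrite gtr0_norm// mulrCA; congr (_ * (iverson _ * _)).
by rewrite -[X in _ < X]mulr1 ltr_pM2l.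
Qed.

Lemma disc_moment_derive xi m (r : R) : 0 < r ->
  is_derive r 1 (disc_moment xi m) ((2 * m).+2%:R * r ^+ (2 * m).+1 * disc_moment xi m 1).
Proof.
move=> r0; apply/is_derive_cvgP.
have : is_derive r 1 (fun s => s ^+ (2 * m).+2 * disc_moment xi m 1)
   ((2 * m).+2%:R * r ^+ (2 * m).+1 * disc_moment xi m 1).
  move: (disc_moment xi m 1) (2 * m)%N => C k.
  apply/has_derivP/has_deriv_eq.
    by apply: has_derivM; [apply: has_derivX; exact: has_deriv_id|exact: has_deriv_cst].
  by rewrite /= mulr0 add0r mulr1 mulrC.
move/is_derive_cvgP; apply: cvg_trans; apply: near_eq_cvg; near=> e.
rewrite (@disc_moment_scale _ _ r)// (@disc_moment_scale _ _ (r + e))//.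
suff : `|e| < r by rewrite ltr_norml => /andP[+ _]; rewrite -subr_gt0 opprK addrC.
by near: e; exact: dnbhs0_lt.
Unshelve. all: by end_near. Qed.

(** The regularised upper incomplete gamma function Gamma (m + 1, r ^ 2) / m!. It is an explicit
    primitive for the radial Gaussian density, equal to 1 at r = 0 and tending to 0 at infinity. *)
Definition exp_tail m (r : R) : R := expR (- r ^+ 2) * series (exp_coeff (r ^+ 2)) m.+1.

Lemma exp_tail_derive m (r : R) :
  is_derive r 1 (exp_tail m) (- (2 * r ^+ (2 * m).+1 / m`!%:R * expR (- r ^+ 2))).
Proof.
elim: m => [|m IH].
  rewrite (_ : exp_tail 0 = (fun s => expR (- s ^+ 2))); last first.
    apply/funext => s; rewrite /exp_tail /series /= big_nat1 /exp_coeff/=.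
    by rewrite expr0 fact0 divr1 mulr1.
  apply/has_derivP/has_deriv_eq; first by derive_rules.
  by rewrite /= fact0 expr1; field.
rewrite (_ : exp_tail m.+1 = (fun s => exp_tail m s +
    expR (- s ^+ 2) * (s ^+ (2 * m).+2 * (m.+1)`!%:R^-1))); last first.
  apply/funext => s; rewrite /exp_tail {1}/series /= big_nat_recr//= mulrDr.
  by congr (_ + _ * _); rewrite /exp_coeff/= -exprM mulnS.
have e2 : ((2 * m).+2%:R : R) = 2 * m.+1%:R by rewrite -natrM mulnS.
apply/has_derivP/has_deriv_eq.
  apply: has_derivD; first exact: IH.
  apply: has_derivM.
    by apply: has_deriv_exp; apply: has_derivN; apply: has_derivX; exact: has_deriv_id.
  by apply: has_derivM; [apply: has_derivX; exact: has_deriv_id|exact: has_deriv_cst].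
rewrite /= e2 mulnS add2n factS natrM.
have h1 : (m`!%:R : R) != 0 by rewrite pnatr_eq0 -lt0n fact_gt0.
have h3 : (m.+1%:R : R) != 0 by [].
move: (m.+1%:R) (m`!%:R) (2 * m)%N h1 h3 => b c k h1 h3.
by rewrite !(exprS r k) !exprS; field; rewrite h1 h3.
Qed.

(** With u = r ^ 2, each u ^ (k + 1) / k! is k + 1 <= m + 1 times a term of the exponential
    series. *)
Lemma exp_tail_le m (r : R) : 0 < r -> 0 <= exp_tail m r <= m.+1%:R / r ^+ 2.
Proof.
move=> r0; have r2 : 0 < r ^+ 2 by rewrite exprn_gt0.
apply/andP; split.
  by rewrite mulr_ge0 ?expR_ge0// sumr_ge0// => i _; exact/exp_coeff_ge0/ltW.
rewrite ler_pdivlMr// /exp_tail expRN -mulrA ler_pdivrMl ?expR_gt0// mulrC.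
move: (r ^+ 2) r2 => u u0.
apply: (@le_trans _ _ (m.+1%:R * (\sum_(0 <= k < m.+1) exp_coeff u k.+1))).
  rewrite mulr_sumr /series /= mulr_sumr !big_mkord; apply: ler_sum => k _.
  have h3 : (k.+1%:R : R) != 0 by [].
  have h4 : (k`!%:R : R) != 0 by rewrite pnatr_eq0 -lt0n fact_gt0.
  rewrite [leLHS](_ : _ = k.+1%:R * exp_coeff u k.+1); last first.
    rewrite /exp_coeff/= factS natrM (exprS u k).
    by move: (k.+1%:R) (k`!%:R) (u ^+ k) h3 h4 => b c v h3 h4; field; rewrite h3 h4.
  by rewrite ler_wpM2r ?ler_nat ?ltn_ord//; exact/exp_coeff_ge0/ltW.
rewrite mulrC ler_wpM2r//; apply: le_trans (series_expR_le m.+2 (ltW u0)).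
by rewrite /series /= [leRHS]big_nat_recl// lerDr; exact/exp_coeff_ge0/ltW.
Qed.

(** The function [D] below is constant on r > 0: the derivative of the Gaussian integral over a
    disc, known up to C by scaling, cancels against that of [exp_tail]. Its limit at 0 is (m + 1)!
    C, at infinity the Gaussian moment; comparing them determines C. *)
Lemma disc_moment1 xi m : disc_moment xi m 1 =
  pi * ((2 * m)`!%:R / (4 ^+ m * m`!%:R * (m.+1)`!%:R)) * dot xi xi ^+ m.
Proof.
set C := disc_moment xi m 1.
have C0 : 0 <= C by apply: pint_ge0 => y; rewrite mulr_ge0 ?iverson_ge0 ?dot_even_ge0.
pose h (s : R) := expR (- s ^+ 2).
have ch : continuous h.
  by move=> s; apply: (@is_derive_continuous _ _ s (expR (- s ^+ 2) * - (2%:R * s ^+ 1 * 1)));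
    apply: has_deriv_exp; apply: has_derivN; apply: has_derivX; exact: has_deriv_id.
have h01 s : 0 <= h s <= 1 by rewrite expR_ge0 -expR0 ler_expR oppr_le0 sqr_ge0.
(* The lower radius -1 lies below every modulus, so the annulus is the whole disc. *)
pose Phi r := pint (fun y => iverson (- 1 <= modulus y < r) * (h (modulus y) * dot xi y ^+ (2 * m))).
have hb (r : R) : exists M : R, forall s, - 1 <= s < r -> `|h s| <= M.
  by exists 1 => s _; have /andP[? ?] := h01 s; rewrite ger0_norm.
have mh := continuous_measurable_fun ch.
pose D r := Phi r + (m.+1)`!%:R * C * exp_tail m r.
have DD (r : R) : 0 < r -> is_derive r 1 D 0.
  move=> r0.
  have P1 : is_derive r 1 Phi (h r * ((2 * m).+2%:R * r ^+ (2 * m).+1 * C)).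
    apply: (radial_derive (dot_even_ge0 xi m) (disc_moment_integrable xi m) (pmeas_dot_even xi m) mh hb).
    - by rewrite (lt_trans _ r0)// ltrN10.
    - exact: ch.
    - exact: disc_moment_derive.
  apply/has_derivP/has_deriv_eq.
    by apply: has_derivD; [exact: P1|apply: has_derivM; [exact: has_deriv_cst|exact: exp_tail_derive]].
  rewrite /= /h factS natrM -[(2 * m).+2%:R]/((2 + 2 * m)%:R) -mulnS natrM.
  have h1 : (m`!%:R : R) != 0 by rewrite pnatr_eq0 -lt0n fact_gt0.
  by field.
have Dc (r1 r2 : R) : 0 < r1 -> r1 <= r2 -> D r2 = D r1.
  move=> r10 r12; apply/eqP; rewrite -subr_eq0 -normr_le0 -(mul0r (r2 - r1)).
  apply: (@derivative_bound_within _ D (fun=> 0)) => //.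
  - by move=> t /andP[rt _]; apply: DD; exact: lt_trans rt.
  - apply: continuous_in_subspaceT => t /set_mem /=; rewrite in_itv/= => /andP[rt _].
    by apply: is_derive_continuous (DD t _); exact: lt_le_trans rt.
  - by move=> t _; rewrite normr0.
have sinv : (n.+1%:R^-1 : R) @[n --> \oo] --> (0 : R) by exact: cvg_harmonic.
have L1 : D n.+1%:R^-1 @[n --> \oo] --> (m.+1)`!%:R * C.
  rewrite -[X in _ --> X]add0r; apply: cvgD.
    apply: (@squeeze_cvgr _ _ _ _ (fun=> 0) (fun n => n.+1%:R^-1 ^+ (2 * m).+2 * C)).
    - apply: nearW => n; apply/andP; split.
        apply: pint_ge0 => y; have /andP[? ?] := h01 (modulus y).
        by rewrite !mulr_ge0 ?iverson_ge0 ?dot_even_ge0.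
      rewrite -disc_moment_scale ?invr_gt0//; apply: le_pint.
      + exact: (radial_integrable (dot_even_ge0 xi m) (disc_moment_integrable xi m) (pmeas_dot_even xi m) mh hb).
      + exact: disc_moment_integrable.
      + move=> y; have /andP[? ?] := h01 (modulus y).
        apply: ler_pM; rewrite ?iverson_ge0 ?mulr_ge0 ?dot_even_ge0//.
          by case: (- 1 <= _); rewrite //= iverson_ge0.
        by rewrite ler_piMl ?dot_even_ge0.
    - exact: cvg_cst.
    - rewrite -(mul0r C); apply: cvgM; last exact: cvg_cst.
      rewrite -(expr0n _ (2 * m).+2 : 0 ^+ _ = 0).
      by apply: (continuous_cvg _ (@exprn_continuous R (2 * m).+2 0)); exact: sinv.
  rewrite -[X in _ --> X]mulr1; apply: cvgM; first exact: cvg_cst.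
  have e0 : exp_tail m 0 = 1.
    rewrite /exp_tail expr0n /= oppr0 expR0 mul1r; exact: series_exp_coeff0.
  have := continuous_cvg _ (is_derive_continuous (exp_tail_derive m 0)) sinv.
  by rewrite e0; apply.
have L2 : D n.+1%:R @[n --> \oo] --> pint (fun y => dot xi y ^+ (2 * m) * gauss y).
  rewrite -[X in _ --> X]addr0; apply: cvgD.
    apply: (@pint_cvg _ _ _ (fun y => dot xi y ^+ (2 * m) * gauss y)).
    - move=> n; apply: pmeasM; first exact: pmeas_annulus.
      by apply: pmeasM; [exact: pmeas_comp_modulus|exact: pmeas_dot_even].
    - move=> y; apply: cvg_near_cst; near=> n.
      have -> : (- 1 <= modulus y < n.+1%:R) = true.
        rewrite (le_trans _ (modulus_ge0 y)) ?lerN10//=.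
        rewrite (@lt_trans _ _ n%:R) ?ltr_nat//.
        by near: n; exact: nbhs_infty_gtr.
      by rewrite /iverson mul1r mulrC /h sqr_modulus.
    - exact: pintegrable_dot_gauss.
    - move=> n y; rewrite mulrC /h sqr_modulus -/(gauss y).
      have g0 := mulr_ge0 (ltW (gauss_gt0 y)) (dot_even_ge0 xi m y).
      rewrite ger0_norm; last by rewrite mulr_ge0 ?iverson_ge0.
      by rewrite (mulrC (dot _ _ ^+ _)) ler_piMr ?iverson_le1.
  apply: (@squeeze_cvgr _ _ _ _ (fun=> 0) (fun n => (m.+1)`!%:R * C * (m.+1%:R / n.+1%:R ^+ 2))).
  - apply: nearW => n; have /andP[t1 t2] := @exp_tail_le m n.+1%:R (ltr0Sn _ n).
    apply/andP; split; first by apply: mulr_ge0 => //; apply: mulr_ge0.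
    by apply: ler_wpM2l => //; rewrite mulr_ge0.
  - exact: cvg_cst.
  - rewrite -(mulr0 ((m.+1)`!%:R * C)); apply: cvgM; first exact: cvg_cst.
    rewrite -(mulr0 m.+1%:R); apply: cvgM; first exact: cvg_cst.
    rewrite (_ : (fun n => _) = (fun n => (n.+1%:R^-1 ^+ 2 : R))).
      rewrite -(expr0n _ 2 : 0 ^+ _ = 0).
      by apply: (continuous_cvg _ (@exprn_continuous R 2 0)); exact: sinv.
    by apply/funext => n; rewrite exprVn.
have E : (m.+1)`!%:R * C = pint (fun y => dot xi y ^+ (2 * m) * gauss y).
  have ED : (fun n => D n.+1%:R^-1) = (fun n => D n.+1%:R).
    apply/funext => n; apply/esym/Dc; first by rewrite invr_gt0.
    by rewrite (@le_trans _ _ 1)// ?invf_le1// ?ler1n.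
  by move: L1; rewrite ED => L1; rewrite -(cvg_lim _ L1)// -(cvg_lim _ L2).
have h1 : (m`!%:R : R) != 0 by rewrite pnatr_eq0 -lt0n fact_gt0.
have h2 : (4 ^+ m : R) != 0 by rewrite expf_neq0.
have h4 : ((m.+1)`!%:R : R) != 0 by rewrite pnatr_eq0 -lt0n fact_gt0.
apply: (mulfI h4); rewrite E gauss_moment.
by move: h1 h4; move: (m`!%:R) ((m.+1)`!%:R) => b c h1 h4; field; rewrite h1 h2 h4.
Unshelve. all: by end_near. Qed.

End DiscMoments.

(** * Continuity of integrals depending on a parameter *)

Section ParameterContinuity.
Variable R : realType.

Lemma iverson_true : iverson true = 1 :> R. Proof. by []. Qed.
Lemma iverson_false : iverson false = 0 :> R. Proof. by []. Qed.

Lemma pint_continuous (V : pseudoMetricType R) (F : V -> R * R -> R) (p : V) (D : set V)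
    (g : R * R -> R) : nbhs p D -> (forall s, D s -> pmeas (F s)) ->
  (forall x, {for p, continuous (F ^~ x)}) -> pintegrable g ->
  (forall s x, D s -> `|F s x| <= g x) -> {for p, continuous (fun s => pint (F s))}.
Proof.
move=> nD mF cF ig Fg; apply: continuous_seq => u up.
have [N _ HN] : \forall n \near \oo, D (u n) by exact: up.
(* Only a tail of the sequence lies in D, where domination holds. *)
rewrite -(cvg_shiftn N); apply: (@pint_cvg _ (fun n => F (u (n + N)%N)) _ g) => //.
- by move=> n; have Du : D (u (n + N)%N) := HN _ (leq_addl n N); exact: mF.
- move=> x; rewrite (cvg_shiftn N (fun n => F (u n) x)).
  exact: (cvg_comp _ _ up (cF x)).
- by move=> n x; have Du : D (u (n + N)%N) := HN _ (leq_addl n N); exact: Fg.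
Qed.

End ParameterContinuity.

(** * Integrands on the line dominated by a negative power *)

Section Line.
Variable R : realType.
Local Notation leb := (@lebesgue_measure R).
Local Notation mR := (measurableTypeR R).

(** Used with p = al: the integrands below behave at worst like t ^ (1 - 2 al) near 0, and 1 - 2 al
    >= - al because al <= 1. *)
Definition edge (p t : R) : R := iverson (0 < t <= 1) * t `^ (- p).

Lemma edge_ge0 p t : 0 <= edge p t.
Proof. by rewrite mulr_ge0 ?iverson_ge0 ?powR_ge0. Qed.

Lemma edge_ge1 (p t : R) : 0 < p -> 0 < t <= 1 -> 1 <= edge p t.
Proof.
move=> p0 /[dup] t01 /andP[t0 t1]; rewrite /edge t01 mul1r -(powRr0 t).
by apply: ger_powR; rewrite ?t01// oppr_le0 ltW.
Qed.

Lemma lint_dominated (p K : R) (f : R -> R) : 0 < p < 1 -> measurable_fun setT f ->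
  (forall t, `|f t| <= K * edge p t) -> leb.-integrable setT (EFin \o (f : mR -> R)).
Proof.
move=> p01 mf fK.
have i1 := integrableZl measurableT K (powR_pos_integrable p01).
exact: (@dominated_integrable_real _ _ _ leb setT f (fun t => K * edge p t) measurableT mf i1 (fun t _ => fK t)).
Qed.

Lemma lint_cvg (p K : R) (f_ : nat -> R -> R) (f : R -> R) : 0 < p < 1 ->
  (forall n, measurable_fun setT (f_ n)) ->
  (forall t, f_ n t @[n --> \oo] --> f t) ->
  (forall n t, `|f_ n t| <= K * edge p t) ->
  (\int[leb]_t f_ n t) @[n --> \oo] --> \int[leb]_t f t.
Proof.
move=> p01 mf ff fK.
have i1 := integrableZl measurableT K (powR_pos_integrable p01).
exact: (@dominated_cvg_Rintegral _ _ _ leb setT f_ f (fun t => K * edge p t) measurableT mf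
  (fun t _ => ff t) i1 (fun n t _ => fK n t)).
Qed.

Lemma measurable_iverson_itv (a b : R) : measurable_fun setT (fun t : R => iverson (a <= t <= b) : R).
Proof.
rewrite (_ : (fun t => _) = (fun t => iverson (a <= t) * iverson (t <= b))).
  by apply: measurable_funM; [exact: measurable_le_cst|exact: measurable_cst_le].
by apply/funext => t; rewrite iversonM.
Qed.

Lemma Rintegral_iverson (a b : R) (f : R -> R) :
  \int[leb]_(t in `[a, b]) f t = \int[leb]_t (iverson (a <= t <= b) * f t).
Proof.
rewrite Rintegral_mkcond; apply: eq_Rintegral => t _; rewrite patchE.
have [] := boolP (t \in `[a, b]%classic).
  by rewrite inE /= in_itv/= => ->; rewrite mul1r.
by rewrite notin_setE /= in_itv/= => /negP/negbTE ->; rewrite mul0r.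
Qed.

End Line.

(** * The singular kernel on annuli; integrability of |y|^(- 2 al) on the disc *)

Section AnnulusMoment.
Variable R : realType.
Local Notation leb := (@lebesgue_measure R).
Implicit Types (x y v xi : R * R).

(** Kept as an inverse, as in the kernel of [K]; for p <> 0 its value at s = 0 is 0 by convention,
    so the centre needs no exception in the estimates. *)
Definition ipow (p s : R) : R := (s `^ p)^-1.

Lemma ipowE p s : ipow p s = s `^ (- p). Proof. by rewrite /ipow powRN. Qed.

Lemma ipow_ge0 p s : 0 <= ipow p s. Proof. by rewrite invr_ge0 powR_ge0. Qed.

Lemma measurable_ipow p : measurable_fun setT (ipow p).
Proof. by rewrite (_ : ipow p = (fun s => s `^ (- p))); [exact: measurable_powR|apply/funext => s; exact: ipowE]. Qed.

Lemma continuous_ipow p (s : R) : 0 < s -> {for s, continuous (ipow p)}.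
Proof.
move=> s0; rewrite (_ : ipow p = (fun s => s `^ (- p))); last by apply/funext => t; exact: ipowE.
exact: (is_derive_continuous (is_derive_powR (- p) s0)).
Qed.

Lemma ipow_le p (a s : R) : 0 <= p -> 0 < a -> a <= s -> ipow p s <= ipow p a.
Proof.
move=> p0 a0 ast; have s0 := lt_le_trans a0 ast.
by rewrite lef_pV2 ?posrE ?powR_gt0// ge0_ler_powR// ?nnegrE ltW.
Qed.

Lemma pmeas_ipow_modulus p : pmeas (fun y => ipow p (modulus y)).
Proof. apply: pmeas_comp_modulus; exact: measurable_ipow. Qed.

Lemma ipow_bounded p (a : R) : 0 <= p -> 0 < a ->
  forall r, exists M : R, forall s, a <= s < r -> `|ipow p s| <= M.
Proof.
move=> p0 a0 r; exists (ipow p a) => s /andP[ast _].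
by rewrite ger0_norm ?ipow_ge0// ipow_le.
Qed.

Lemma annulus_integrable p (a r : R) xi m : 0 <= p -> 0 < a ->
  pintegrable (fun y => iverson (a <= modulus y < r) * (ipow p (modulus y) * dot xi y ^+ (2 * m))).
Proof.
move=> p0 a0.
exact: (radial_integrable (dot_even_ge0 xi m) (disc_moment_integrable xi m) (pmeas_dot_even xi m)
  (measurable_ipow p) (ipow_bounded p0 a0)).
Qed.

Lemma annulus_moment p (a : R) xi m : 0 <= p -> 0 < a < 1 ->
  pint (fun y => iverson (a <= modulus y < 1) * (ipow p (modulus y) * dot xi y ^+ (2 * m))) =
  \int[leb]_t (iverson (a <= t <= 1) *
     (ipow p t * ((2 * m).+2%:R * t ^+ (2 * m).+1 * disc_moment xi m 1))).
Proof.
move=> p0 /andP[a0 a1]; rewrite -Rintegral_iverson.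
have a20 : 0 < a / 2 by rewrite divr_gt0.
have a2a : a / 2 < a by lra.
(* Starting from radius a / 2 makes [Phi] differentiable also at the end point a, where
   [radial_derive] asks for a strictly larger radius. *)
pose Phi r := pint (fun y => iverson (a / 2 <= modulus y < r) * (ipow p (modulus y) * dot xi y ^+ (2 * m))).
rewrite /Rintegral (@integral_FTC _ _ Phi)//=.
- rewrite /Phi -pintB; [|exact: annulus_integrable..]; apply: eq_pint => y.
  rewrite -mulrBl; congr (_ * _); have [h|h] := ltP (modulus y) a.
    by rewrite (lt_trans h a1) andbT /iverson /= subrr.
  by rewrite (le_trans (ltW a2a) h) /= /iverson subr0.
- move=> t /andP[at' _]; apply: (radial_derive (dot_even_ge0 xi m) (disc_moment_integrable xi m)
     (pmeas_dot_even xi m) (measurable_ipow p) (ipow_bounded p0 a20)).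
  + exact: lt_le_trans at'.
  + by apply: continuous_ipow; exact: lt_le_trans at'.
  + by apply: disc_moment_derive; exact: lt_le_trans at'.
- move=> t /andP[at' _]; apply: cvgM; first by apply: continuous_ipow; exact: lt_le_trans at'.
  apply: cvgM; last exact: cvg_cst.
  by apply: cvgM; [exact: cvg_cst|exact: exprn_continuous].
Qed.

Lemma powR_2D (s al : R) : 0 < s -> s `^ (2 + 2 * al) = s ^+ 2 * s `^ (2 * al).
Proof.
move=> s0; rewrite powRD; last by rewrite (gt_eqF s0) implybT.
by rewrite (powR_mulrn 2 (ltW s0)).
Qed.

Definition disc_sing (al : R) y : R := iverson (modulus y < 1) * ipow (2 * al) (modulus y).

(** Exhaustion by annuli, whose integrals become integrals on the line bounded by that of
    [edge al]. *)
Lemma disc_sing_integrable (al : R) : 0 < al < 1 -> pintegrable (disc_sing al).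
Proof.
move=> al01; have /andP[al0 al1] := al01.
pose a (n : nat) : R := n.+2%:R^-1.
have a01 n : 0 < a n < 1 by rewrite invr_gt0 ltr0n invf_lt1// ltr1n.
(* For xi = 0 and m = 0 the factor [dot] to the power 0 is 1, so the annulus moment is the integral
   of the kernel itself. *)
pose f_ n y := iverson (a n <= modulus y < 1) * (ipow (2 * al) (modulus y) * dot (0 : R * R) y ^+ (2 * 0)).
have f0 n y : 0 <= f_ n y by rewrite !mulr_ge0 ?iverson_ge0 ?ipow_ge0 ?dot_even_ge0.
have al20 : 0 <= 2 * al by rewrite mulr_ge0// ltW.
have if_ n : pintegrable (f_ n) by apply: annulus_integrable => //; case/andP: (a01 n).
have mono m n t : (m <= n)%N -> iverson (a m <= t) <= iverson (a n <= t) :> R.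
  move=> mn; have amn : a n <= a m by rewrite lef_pV2 ?posrE// ler_nat.
  by case: (leP (a m) t) => h; rewrite ?iverson_ge0// (le_trans amn h).
apply: (@nondecreasing_bounded_integrable _ _ _ (@plane_measure R) f_ _
    (2 * disc_moment (0 : R * R) 0 1 * \int[leb]_t edge al t)).
- by move=> n; exact: (pintegrable_meas (if_ n)).
- exact: f0.
- move=> y m n mn; rewrite ler_wpM2r ?mulr_ge0 ?ipow_ge0 ?dot_even_ge0//.
  by rewrite -!iversonM ler_wpM2r ?iverson_ge0// mono.
- move=> y; apply: cvg_near_cst; have [->|y0] := eqVneq y 0.
    apply: nearW => n; rewrite /f_ /disc_sing.
    rewrite (_ : modulus 0 = 0); last by apply/eqP; rewrite modulus_eq0.
    rewrite (_ : ipow (2 * al) 0 = 0) ?mul0r ?mulr0// /ipow powR0 ?invr0//.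
    by rewrite gt_eqF// mulr_gt0.
  have my0 : 0 < modulus y by rewrite lt_neqAle modulus_ge0 andbT eq_sym modulus_eq0.
  near=> n; rewrite /f_ /disc_sing muln0 expr0 mulr1.
  rewrite (_ : (a n <= modulus y) = true)//.
  apply: (@le_trans _ _ n.+1%:R^-1); first by rewrite lef_pV2 ?posrE// ler_nat.
  by apply: ltW; near: n; exact: near_infty_natSinv_lt (PosNum my0).
- move=> n; have fin := integrable_fin_num measurableT (if_ n).
  rewrite -[X in (X <= _)%E](fineK fin) lee_fin.
  rewrite (_ : fine _ = pint (f_ n))// /f_ annulus_moment//.
  rewrite -RintegralZl//; last exact: powR_pos_integrable.
  have C0 : 0 <= disc_moment (0 : R * R) 0 1.
    by apply: pint_ge0 => y; rewrite mulr_ge0 ?iverson_ge0 ?dot_even_ge0.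
  have key t : 0 <= iverson (a n <= t <= 1) * (ipow (2 * al) t * ((2 * 0).+2%:R * t ^+ (2 * 0).+1 * disc_moment (0 : R * R) 0 1)) <= 2 * disc_moment (0 : R * R) 0 1 * edge al t.
    have [/andP[h1 h2]|_] := boolP (a n <= t <= 1); last first.
      rewrite iverson_false mul0r lexx /=; apply: mulr_ge0; last exact: edge_ge0.
      exact: mulr_ge0.
    have t0 : 0 < t by apply: lt_le_trans h1; case/andP: (a01 n).
    rewrite iverson_true mul1r muln0 expr1.
    rewrite !mulr_ge0 ?ipow_ge0 ?(ltW t0)//=.
    have -> : ipow (2 * al) t * (2 * t * disc_moment 0 0 1) = disc_moment 0 0 1 * (2 * (t * ipow (2 * al) t)) by ring.
    rewrite [leRHS](_ : _ = disc_moment 0 0 1 * (2 * edge al t)); last by ring.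
    rewrite ler_wpM2l// ler_wpM2l//.
    rewrite /edge t0 h2 /iverson mul1r ipowE -[X in X * _]powRr1 ?(ltW t0)//.
    rewrite -powRD ?(gt_eqF t0) ?implybT//; apply: ger_powR; first by rewrite t0 h2.
    by lra.
  apply: le_Rintegral => //.
  + apply: (@lint_dominated _ al (2 * disc_moment (0 : R * R) 0 1)) => //.
      apply: measurable_funM; first exact: measurable_iverson_itv.
      apply: measurable_funM; first exact: measurable_ipow.
      by apply: measurable_funM => //; apply: measurable_funM.
    by move=> t; have /andP[k1 k2] := key t; rewrite ger0_norm.
  + exact: (integrableZl measurableT _ (powR_pos_integrable al01)).
  + by move=> t _; have /andP[] := key t.
Unshelve. all: by end_near. Qed.

End AnnulusMoment.

(** * The symbol and the dispersion relation *)

Section Bessel.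
Variable R : realType.
Local Notation leb := (@lebesgue_measure R).
Implicit Types (x y v xi : R * R).

Definition bessel_term (r : R) (m : nat) : R := (- 1) ^+ m / (m`!%:R ^+ 2) * (r / 2) ^+ (2 * m).

Lemma bessel_term_le r m : `|bessel_term r m| <= exp_coeff ((r / 2) ^+ 2) m.
Proof.
have q0 : 0 <= ((r / 2) ^+ 2) ^+ m by rewrite exprn_ge0// sqr_ge0.
rewrite /bessel_term /exp_coeff/= exprM; move: (_ ^+ m) q0 => q q0.
rewrite !normrM normrX normrN normr1 expr1n mul1r.
rewrite normfV (ger0_norm (sqr_ge0 _)) (ger0_norm q0) mulrC ler_wpM2l//.
have f0 : (0 : R) < m`!%:R by rewrite ltr0n fact_gt0.
rewrite lef_pV2 ?posrE ?exprn_gt0// expr2 ler_peMl ?(ltW f0)//.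
by rewrite ler1n fact_gt0.
Qed.

Lemma bessel_series_cvg r : series (bessel_term r) n @[n --> \oo] --> bessel_J0 r.
Proof.
suff : cvgn (series (bessel_term r)) by [].
apply: normed_cvg; apply: (@series_le_cvg _ _ (exp_coeff ((r / 2) ^+ 2))).
- by move=> n /=; exact: normr_ge0.
- by move=> n; apply: exp_coeff_ge0; exact: sqr_ge0.
- exact: bessel_term_le.
- exact: is_cvg_series_exp_coeff.
Qed.

(** The zeroth term is 1, hence the n + 1 terms; the rest contains a factor (r / 2)^2, and this
    quadratic vanishing makes the integrand of [omega] integrable at 0. *)
Lemma one_sub_bessel_le r n :
  `|1 - series (bessel_term r) n.+1| <= (r / 2) ^+ 2 * expR ((r / 2) ^+ 2).
Proof.
have -> : 1 - series (bessel_term r) n.+1 = - \sum_(0 <= m < n) bessel_term r m.+1.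
  rewrite /series /= big_nat_recl// /bessel_term fact0 muln0 !expr0 expr1n invr1 !mulr1.
  by rewrite opprD addrA subrr add0r.
rewrite normrN; apply: le_trans (ler_norm_sum _ _ _) _.
apply: (@le_trans _ _ ((r / 2) ^+ 2 * series (exp_coeff ((r / 2) ^+ 2)) n)); last first.
  by rewrite ler_wpM2l ?sqr_ge0// series_expR_le// sqr_ge0.
rewrite /series /= mulr_sumr; apply: ler_sum => m _.
apply: (le_trans (bessel_term_le _ _)); rewrite /exp_coeff/= exprS mulrA.
have q0 : 0 <= (r / 2) ^+ 2 by exact: sqr_ge0.
rewrite ler_wpM2l//; first by rewrite mulr_ge0// exprn_ge0.
by rewrite lef_pV2 ?posrE ?ltr0n ?fact_gt0// ler_nat factS leq_pmull.
Qed.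

Lemma measurable_bessel_series (c : R) n :
  measurable_fun setT (fun t : R => series (bessel_term (c * t)) n).
Proof.
elim: n => [|n IH].
  by rewrite (_ : (fun t => _) = fun=> 0)//; apply/funext => t; rewrite /series /= big_nil.
rewrite (_ : (fun t => _) = (fun t => series (bessel_term (c * t)) n + bessel_term (c * t) n)).
  apply: measurable_funD => //; apply: measurable_funM => //.
  rewrite (_ : (fun t : R => _) = (fun t => (c / 2 * t) ^+ (2 * n))).
    by apply: measurable_funX; exact: measurable_funM.
  by apply/funext => t; rewrite mulrAC.
by apply/funext => t; rewrite /series /= big_nat_recr.
Qed.

Lemma measurable_bessel (c : R) : measurable_fun setT (fun t : R => bessel_J0 (c * t)).
Proof.
apply: (measurable_fun_cvg (measurable_bessel_series c)) => t _.
exact: bessel_series_cvg.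
Qed.

Lemma dot_modulus_even xi m : dot xi xi ^+ m = modulus xi ^+ (2 * m).
Proof. by rewrite -sqr_modulus exprM. Qed.

Definition cos_partial xi n y : R :=
  \sum_(0 <= m < n) (- 1) ^+ m * (dot xi y ^+ (2 * m) / (2 * m)`!%:R).

(** Partial sums of the cosine correspond to partial sums of J_0 with the same number of terms, so
    the identity is an induction on n using linearity only. *)
Lemma annulus_cos_partial al (a : R) xi n : 0 < al < 1 -> 0 < a < 1 ->
  pint (fun y => iverson (a <= modulus y < 1) *
    (ipow (2 + 2 * al) (modulus y) * (1 - cos_partial xi n y))) =
  \int[leb]_t (iverson (a <= t <= 1) * (ipow (2 + 2 * al) t *
     (2 * pi * t * (1 - series (bessel_term (modulus xi * t)) n)))).
Proof.
move=> al01 a01; have /andP[al0 al1] := al01; have /andP[a0 a1] := a01.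
set p := 2 + 2 * al; have p0 : 0 <= p by rewrite addr_ge0// mulr_ge0// ltW.
pose L m y := iverson (a <= modulus y < 1) * (ipow p (modulus y) * dot xi y ^+ (2 * m)).
have iL m : pintegrable (L m) by exact: annulus_integrable.
pose M m t : R := iverson (a <= t <= 1) * (ipow p t * (t ^+ (2 * m).+1)).
have iM m : leb.-integrable setT (EFin \o M m).
  apply: (@lint_dominated _ al (ipow p a)) => //.
    apply: measurable_funM; first exact: measurable_iverson_itv.
    by apply: measurable_funM; [exact: measurable_ipow|].
  move=> t; rewrite /M; have [/andP[h1 h2]|_] := boolP (a <= t <= 1); last first.
    by rewrite {1}/iverson mul0r normr0 mulr_ge0 ?ipow_ge0 ?edge_ge0.
  have t0 : 0 < t by exact: lt_le_trans h1.
  rewrite {1}/iverson mul1r ger0_norm ?mulr_ge0 ?ipow_ge0 ?exprn_ge0 ?(ltW t0)//.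
  apply: ler_pM; rewrite ?ipow_ge0 ?exprn_ge0 ?(ltW t0)//; first exact: ipow_le.
  apply: (@le_trans _ _ 1); last by apply: edge_ge1; rewrite ?t0.
  by rewrite exprn_ile1// ltW.
have LM m : pint (L m) = (2 * m).+2%:R * disc_moment xi m 1 * \int[leb]_t M m t.
  rewrite annulus_moment// -RintegralZl//; apply: eq_Rintegral => t _.
  by rewrite /M; ring.
(* Here J_0 appears: (2 m)! cancels against the disc moment, and (2 m + 2) / (m! (m + 1)!) is 2 /
   m!^2. *)
have cE m : (- 1) ^+ m / (2 * m)`!%:R * ((2 * m).+2%:R * disc_moment xi m 1) =
    2 * pi * ((- 1) ^+ m / (m`!%:R ^+ 2) * (modulus xi / 2) ^+ (2 * m)).
  rewrite disc_moment1 dot_modulus_even expr_div_n (exprM 2 2 m).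
  have -> : (2 ^+ 2 : R) = 4 by rewrite -natrX.
  have -> : ((2 * m).+2%:R : R) = 2 * m.+1%:R by rewrite -natrM mulnS.
  rewrite factS natrM.
  have h1 : (m`!%:R : R) != 0 by rewrite pnatr_eq0 -lt0n fact_gt0.
  have h2 : (4 ^+ m : R) != 0 by rewrite expf_neq0.
  have h3 : ((2 * m)`!%:R : R) != 0 by rewrite pnatr_eq0 -lt0n fact_gt0.
  have h4 : (m.+1%:R : R) != 0 by [].
  move: (m`!%:R) (4 ^+ m) ((2 * m)`!%:R) (m.+1%:R) h1 h2 h3 h4 => b c d e h1 h2 h3 h4.
  by field; rewrite h1 h2 h3 h4.
have L0 : pint (L 0%N) = 2 * pi * \int[leb]_t M 0%N t.
  rewrite LM; congr (_ * _); have := cE 0%N.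
  by rewrite muln0 !expr0 fact0 expr1n invr1 !mul1r mulr1 => ->.
elim: n => [|n IH].
  rewrite (_ : (fun y => _) = L 0%N); last first.
    by apply/funext => y; rewrite /L /cos_partial big_nil subr0 muln0 expr0.
  rewrite L0 -RintegralZl//; apply: eq_Rintegral => t _.
  by rewrite /M /series /= big_nil muln0 expr1; ring.
pose F n y := iverson (a <= modulus y < 1) * (ipow p (modulus y) * (1 - cos_partial xi n y)).
have FS k y : F k.+1 y = F k y - (- 1) ^+ k / (2 * k)`!%:R * L k y.
  by rewrite /F /L /cos_partial big_nat_recr//=; ring.
have iF k : pintegrable (F k).
  elim: k => [|k IHk].
    apply: eq_pintegrable (iL 0%N) => y.
    by rewrite /L /F /cos_partial big_nil subr0 muln0 expr0.
  have := pintegrableB IHk (pintegrableZ ((- 1) ^+ k / (2 * k)`!%:R) (iL k)).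
  by apply: eq_pintegrable => y; rewrite FS.
pose G n t := iverson (a <= t <= 1) * (ipow p t *
     (2 * pi * t * (1 - series (bessel_term (modulus xi * t)) n))).
pose c k := 2 * pi * ((- 1) ^+ k / (k`!%:R ^+ 2) * (modulus xi / 2) ^+ (2 * k)).
have GS k t : G k.+1 t = G k t - c k * M k t.
  rewrite /G /M /c /series /= big_nat_recr//= /bessel_term.
  have -> : (modulus xi * t / 2) ^+ (2 * k) = (modulus xi / 2) ^+ (2 * k) * t ^+ (2 * k).
    by rewrite -exprMn mulrAC.
  by rewrite (exprS t (2 * k)); ring.
have iG k : leb.-integrable setT (EFin \o G k).
  elim: k => [|k IHk].
    have := integrableZl measurableT (2 * pi) (iM 0%N); congr (integrable _ _ _).
    apply/funext => t /=; congr EFin; rewrite /G /M /series /= big_nil muln0 expr1; ring.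
  have := integrableB measurableT IHk (integrableZl measurableT (c k) (iM k)).
  by congr (integrable _ _ _); apply/funext => t /=; rewrite GS.
rewrite -[LHS]/(pint (F n.+1)) (eq_pint (FS n)) pintB//; last exact: pintegrableZ.
rewrite pintZ// LM mulrA cE -/(c n) [pint (F n)]IH.
rewrite -RintegralZl// -RintegralB//; [|exact: iG|exact: (integrableZl measurableT (c n) (iM n))].
by apply: eq_Rintegral => t _; rewrite -GS.
Qed.

Lemma one_sub_cos_le (t : R) : 0 <= 1 - cos t <= t ^+ 2 / 2.
Proof.
rewrite subr_ge0 cos_le1 /=.
(* Half-angle formula: 1 - cos t = 2 sin^2 (t / 2). *)
have -> : t = (t / 2) *+ 2 by rewrite -mulr_natr; field.
rewrite cos_mulr2n cos2sin2; set u := t / 2.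
have h : sin u ^+ 2 <= u ^+ 2.
  rewrite -[leLHS]real_normK ?num_real// -[leRHS]real_normK ?num_real//.
  rewrite lerXn2r ?nnegrE//.
  have := @derivative_bound _ (@sin R) (@cos R) 1 0 u (fun t => is_derive_sin t).
  rewrite sin0 !subr0 mul1r; apply => s; rewrite ler_norml.
  by rewrite cos_geN1 cos_le1.
rewrite -[_ *+ 2]mulr_natl -[u *+ 2]mulr_natl exprMn; lra.
Qed.

End Bessel.

Lemma cvg_seq_eq (R : realType) (u v : nat -> R) (a b : R) : u =1 v ->
  u n @[n --> \oo] --> a -> v n @[n --> \oo] --> b -> a = b.
Proof. by move=> /funext -> ua ub; rewrite -(cvg_lim _ ua)// -(cvg_lim _ ub). Qed.

(** * The symbol, its continuity and scaling, and its expression through J_0 *)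

Section Singular.
Variable R : realType.
Local Notation leb := (@lebesgue_measure R).
Implicit Types (x y v xi : R * R).
Variable al : R.
Hypothesis al01 : 0 < al < 1.

Let al0 : 0 < al. Proof. by case/andP: al01. Qed.
Let p0 : 0 < 2 + 2 * al. Proof. by rewrite addr_gt0// mulr_gt0. Qed.

Lemma modulus0 : modulus (0 : R * R) = 0.
Proof. by apply/eqP; rewrite modulus_eq0. Qed.

Lemma modulus_gt0 y : (0 < modulus y) = (y != 0).
Proof. by rewrite lt_neqAle modulus_ge0 andbT eq_sym modulus_eq0. Qed.

Lemma ipow0 p : p != 0 -> ipow p 0 = 0 :> R.
Proof. by move=> p0'; rewrite /ipow powR0// invr0. Qed.

(** Two powers of |y| bring the kernel down to |y|^(- 2 al), integrable in the plane because 2 al <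
    2. *)
Lemma ipow_sqr y : ipow (2 + 2 * al) (modulus y) * modulus y ^+ 2 <= ipow (2 * al) (modulus y).
Proof.
have [->|y0] := eqVneq y 0.
  by rewrite modulus0 expr0n mulr0 ipow_ge0.
rewrite -modulus_gt0 in y0.
rewrite /ipow powR_2D// invfM mulrAC mulVf ?mul1r//.
by rewrite gt_eqF// exprn_gt0.
Qed.

Definition ball_sing (r : R) y : R := iverson (modulus y < r) * ipow (2 * al) (modulus y).

Lemma ball_sing_ge0 r y : 0 <= ball_sing r y.
Proof. by rewrite mulr_ge0 ?iverson_ge0 ?ipow_ge0. Qed.

Lemma ipowM p (s t : R) : 0 <= s -> 0 <= t -> ipow p (s * t) = ipow p s * ipow p t.
Proof. by move=> s0 t0; rewrite /ipow powRM// invfM. Qed.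

Lemma ball_sing_integrable r : 0 < r -> pintegrable (ball_sing r).
Proof.
move=> r0; have ri0 : 0 < r^-1 by rewrite invr_gt0.
have := pintegrableZ (ipow (2 * al) r) (pintegrable_affine 0 ri0 (disc_sing_integrable al01)).
apply: eq_pintegrable => y; rewrite addr0 /disc_sing /ball_sing.
rewrite modulusZ (gtr0_norm ri0) mulrCA -ipowM ?(ltW r0) ?mulr_ge0 ?(ltW ri0) ?modulus_ge0//.
by rewrite mulVKf ?gt_eqF// ltr_pdivrMl// mulr1.
Qed.

(** The predicate selects radii, so discs and annuli share one estimate, which is then uniform in
    the inner radius. *)
Definition singular (P : pred R) (f : R * R -> R) y : R :=
  iverson (P (modulus y)) * (ipow (2 + 2 * al) (modulus y) * f y).

Lemma singular_le (P : pred R) (r C : R) f : (forall s, P s -> s < r) -> 0 <= C ->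
  (forall y, modulus y < r -> `|f y| <= C * modulus y ^+ 2) ->
  forall y, `|singular P f y| <= C * ball_sing r y.
Proof.
move=> Pr C0 fC y; rewrite /singular !normrM (ger0_norm (iverson_ge0 _ _)) (ger0_norm (ipow_ge0 _ _)).
have [h|_] := boolP (P _); last by rewrite iverson_false mul0r mulr_ge0 ?ball_sing_ge0.
rewrite iverson_true mul1r /ball_sing (Pr _ h) iverson_true mul1r.
apply: (@le_trans _ _ (ipow (2 + 2 * al) (modulus y) * (C * modulus y ^+ 2))).
  by rewrite ler_wpM2l ?ipow_ge0// fC// Pr.
by rewrite mulrCA ler_wpM2l// ipow_sqr.
Qed.

Lemma pmeas_singular (P : pred R) f : pmeas (fun y => iverson (P (modulus y)) : R) -> pmeas f ->
  pmeas (singular P f).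
Proof. by move=> mP mf; apply: pmeasM => //; apply: pmeasM => //; exact: pmeas_ipow_modulus. Qed.

Definition in_disc (r : R) : pred R := fun s => s < r.
Definition in_annulus (a r : R) : pred R := fun s => a <= s < r.

Lemma in_annulus_lt (a r s : R) : in_annulus a r s -> s < r. Proof. by case/andP. Qed.

(** Eventually constant: for y <> 0 as soon as a <= |y|, and at y = 0 the kernel is 0 by
    convention. *)
Lemma singular_annulus_cvg (r : R) f y : singular (in_annulus a r) f y @[a --> 0^'+] --> singular (in_disc r) f y.
Proof.
apply: cvg_near_cst; have [->|y0] := eqVneq y 0.
  by apply: nearW => a; rewrite /singular modulus0 ipow0 ?gt_eqF// mul0r !mulr0.
rewrite -modulus_gt0 in y0.
near=> a; rewrite /singular /in_annulus /in_disc (_ : (a <= modulus y) = true)//.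
by apply/ltW; near: a; exact: nbhs_right_lt.
Unshelve. all: by end_near. Qed.

Lemma one_sub_cos_dot_le xi y : `|1 - cos (dot xi y)| <= (modulus xi ^+ 2 / 2) * modulus y ^+ 2.
Proof.
have /andP[h1 h2] := one_sub_cos_le (dot xi y); rewrite ger0_norm//.
apply: (le_trans h2); rewrite [leRHS]mulrAC ler_wpM2r ?invr_ge0// -exprMn -real_normK ?num_real//.
by rewrite lerXn2r ?nnegrE ?mulr_ge0 ?modulus_ge0// norm_dot_modulus.
Qed.

(** The Fourier multiplier of [K] is - 2 kappa times this function at r = delta. *)
Definition symbol (r : R) xi : R := pint (singular (in_disc r) (fun y => 1 - cos (dot xi y))).

Lemma pmeas_one_sub_cos xi : pmeas (fun y => 1 - cos (dot xi y)).
Proof.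
apply: pmeas_continuous; apply: continuous_planeB; first exact: continuous_plane_cst.
by apply: (continuous_plane_comp (@continuous_cos R)); exact: continuous_dot.
Qed.

Lemma singular_cos_le (P : pred R) r xi : (forall s, P s -> s < r) ->
  forall y, `|singular P (fun y => 1 - cos (dot xi y)) y| <= modulus xi ^+ 2 / 2 * ball_sing r y.
Proof.
move=> Pr; apply: singular_le => // [|y _]; last exact: one_sub_cos_dot_le.
by rewrite divr_ge0// sqr_ge0.
Qed.

Lemma singular_cos_integrable r xi : 0 < r ->
  pintegrable (singular (in_disc r) (fun y => 1 - cos (dot xi y))).
Proof.
move=> r0; apply: (pintegrable_dominated (g := fun y => modulus xi ^+ 2 / 2 * ball_sing r y)).
- by apply: pmeas_singular; [exact: pmeas_iverson_lt|exact: pmeas_one_sub_cos].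
- by apply: pintegrableZ; exact: ball_sing_integrable.
- exact: singular_cos_le.
Qed.

Lemma symbol_ge0 r xi : 0 <= symbol r xi.
Proof.
apply: pint_ge0 => y; have /andP[h _] := one_sub_cos_le (dot xi y).
by rewrite !mulr_ge0 ?iverson_ge0 ?ipow_ge0.
Qed.

Lemma symbol_le r xi : 0 < r -> symbol r xi <= modulus xi ^+ 2 / 2 * pint (ball_sing r).
Proof.
move=> r0; rewrite -pintZ; last exact: ball_sing_integrable.
apply: le_pint; first exact: singular_cos_integrable.
  by apply: pintegrableZ; exact: ball_sing_integrable.
move=> y; apply: le_trans (ler_norm _) _; exact: singular_cos_le.
Qed.

Lemma continuous_symbol r : 0 < r -> continuous (symbol r).
Proof.
move=> r0 xi; pose D : set (R * R) := [set z | modulus z < modulus xi + 1].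
apply: (@pint_continuous _ _ (fun z => singular (in_disc r) (fun y => 1 - cos (dot z y))) xi D
  (fun y => (modulus xi + 1) ^+ 2 / 2 * ball_sing r y)).
- have /cvgrPdist_lt/(_ 1 ltr01) := @continuous_modulus R xi.
  by apply: filterS => z; rewrite ltr_distlC => /andP[_].
- by move=> z _; apply: pmeas_singular; [exact: pmeas_iverson_lt|exact: pmeas_one_sub_cos].
- move=> y; apply: cvgM; first exact: cvg_cst.
  apply: cvgM; first exact: cvg_cst.
  apply: cvgB; first exact: cvg_cst.
  rewrite (_ : (fun z => _) = (fun z => cos (dot y z))); last by apply/funext => z; rewrite dotC.
  rewrite dotC; apply: (continuous_plane_comp (@continuous_cos R)); exact: continuous_dot.
- by apply: pintegrableZ; exact: ball_sing_integrable.
- move=> z y Dz; apply: (le_trans (@singular_cos_le (in_disc r) r z (fun _ h => h) y)).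
  rewrite ler_wpM2r ?ball_sing_ge0// ler_wpM2r ?invr_ge0//.
  by rewrite lerXn2r ?nnegrE ?addr_ge0 ?modulus_ge0 ?(ltW Dz).
Qed.

(** Substituting r y for y gives r ^ 2 from the area and r ^ (- 2 - 2 al) from the kernel. *)
Lemma symbol_scale r xi : 0 < r -> symbol r xi = (r `^ (2 * al))^-1 * symbol 1 (r *: xi).
Proof.
move=> r0; rewrite /symbol (pint_affine 0 r0); last exact: singular_cos_integrable.
rewrite -[RHS]pintZ; last exact: singular_cos_integrable.
have -> : (r `^ (2 * al))^-1 = r ^+ 2 * ipow (2 + 2 * al) r.
  by rewrite /ipow powR_2D// invfM mulrA mulfV ?mul1r// gt_eqF// exprn_gt0.
rewrite -[LHS]pintZ; last first.
  rewrite (_ : (fun y => _) = (fun y => singular (in_disc r) (fun y => 1 - cos (dot xi y)) (r *: y + 0))); last by [].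
  by apply: pintegrable_affine => //; exact: singular_cos_integrable.
apply: eq_pint => y; rewrite addr0 /singular modulusZ (gtr0_norm r0) ipowM ?(ltW r0) ?modulus_ge0//.
rewrite dotZl dotZr (_ : in_disc r _ = in_disc 1 (modulus y)); last first.
  by rewrite /in_disc -[X in _ < X]mulr1 ltr_pM2l.
ring.
Qed.

(** The number of terms tends to infinity first, on an annulus where the kernel is bounded; the
    inner radius shrinks only afterwards. *)
Lemma annulus_bessel (a : R) xi : 0 < a < 1 ->
  pint (singular (in_annulus a 1) (fun y => 1 - cos (dot xi y))) =
  \int[leb]_t (iverson (a <= t <= 1) * (ipow (2 + 2 * al) t *
     (2 * pi * t * (1 - bessel_J0 (modulus xi * t))))).
Proof.
move=> a01; have /andP[a0 a1] := a01; set p := 2 + 2 * al.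
have L1 : pint (fun y => iverson (a <= modulus y < 1) *
    (ipow p (modulus y) * (1 - cos_partial xi n.+1 y))) @[n --> \oo] -->
    pint (singular (in_annulus a 1) (fun y => 1 - cos (dot xi y))).
  (* The factor expR (1 ^+ 2) is the price for replacing the unit disc by a Gaussian. *)
  apply: (@pint_cvg _ _ _ (fun y => (expR (1 ^+ 2) * (ipow p a * (1 + expR (modulus xi)))) * gauss y)).
  - move=> n; apply: pmeasM; first exact: pmeas_annulus.
    apply: pmeasM; first exact: pmeas_ipow_modulus.
    apply: pmeasB; first exact: pmeas_cst.
    rewrite /cos_partial; elim: n.+1 => [|k IH].
      rewrite (_ : (fun y => _) = fun=> 0); first exact: pmeas_cst.
      by apply/funext => y; rewrite big_nil.
    rewrite (_ : (fun y => _) = (fun y => \sum_(0 <= m < k) (- 1) ^+ m * (dot xi y ^+ (2 * m) / (2 * m)`!%:R)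
         + (- 1) ^+ k * (dot xi y ^+ (2 * k) / (2 * k)`!%:R))).
      apply: pmeasD => //; apply: pmeasM; first exact: pmeas_cst.
      by apply: pmeasM; [exact: pmeas_dot_even|exact: pmeas_cst].
    by apply/funext => y; rewrite big_nat_recr.
  - move=> y; apply: cvgM; first exact: cvg_cst.
    apply: cvgM; first exact: cvg_cst.
    apply: cvgB; first exact: cvg_cst.
    have := @cvg_cos_series _ (dot xi y); rewrite -cvg_shiftS; exact.
  - by apply: pintegrableZ; exact: pintegrable_gauss.
  - move=> n y; rewrite !normrM (ger0_norm (iverson_ge0 _ _)) (ger0_norm (ipow_ge0 _ _)).
    have E0 : 0 <= ipow p a * (1 + expR (modulus xi)) by rewrite mulr_ge0 ?ipow_ge0// addr_ge0// expR_ge0.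
    have [/andP[h1 h2]|_] := boolP (a <= modulus y < 1); last first.
      by rewrite iverson_false mul0r mulr_ge0 ?(ltW (gauss_gt0 _))// mulr_ge0 ?expR_ge0.
    rewrite iverson_true mul1r -mulrA (mulrC _ (gauss y)) mulrA.
    have := iverson_modulus_gauss 1 y; rewrite h2 iverson_true => g1.
    apply: (@le_trans _ _ (ipow p a * (1 + expR (modulus xi)))); last first.
      by rewrite ler_peMl.
    apply: ler_pM; rewrite ?ipow_ge0 ?normr_ge0//; first by apply: ipow_le => //; exact: ltW.
    apply: le_trans (ler_normB _ _) _; rewrite normr1 lerD2l.
    apply: le_trans (cos_series_le _ _) _; rewrite ler_expR.
    apply: le_trans (norm_dot_modulus _ _) _.
    by rewrite ler_piMr ?modulus_ge0// ltW.
have L2 : \int[leb]_t (iverson (a <= t <= 1) * (ipow p t *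
     (2 * pi * t * (1 - series (bessel_term (modulus xi * t)) n.+1)))) @[n --> \oo] -->
   \int[leb]_t (iverson (a <= t <= 1) * (ipow p t *
     (2 * pi * t * (1 - bessel_J0 (modulus xi * t))))).
  pose q := (modulus xi / 2) ^+ 2; have q0 : 0 <= q by exact: sqr_ge0.
  have pi0 : 0 <= pi :> R by exact: pi_ge0.
  apply: (@lint_cvg _ al (ipow p a * (2 * pi * (q * expR q)))) => //.
  - move=> n; apply: measurable_funM; first exact: measurable_iverson_itv.
    apply: measurable_funM; first exact: measurable_ipow.
    apply: measurable_funM; first exact: measurable_funM.
    by apply: measurable_funB => //; exact: measurable_bessel_series.
  - move=> t; do 3 (apply: cvgM; first exact: cvg_cst).
    apply: cvgB; first exact: cvg_cst.
    have := @bessel_series_cvg _ (modulus xi * t); rewrite -cvg_shiftS; exact.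
  - move=> n t; rewrite !normrM (ger0_norm (iverson_ge0 _ _)) (ger0_norm (ipow_ge0 _ _)).
    have E0 : 0 <= ipow p a * (2 * pi * (q * expR q)).
      apply: mulr_ge0; first exact: ipow_ge0.
      by apply: mulr_ge0; apply: mulr_ge0 => //; exact: expR_ge0.
    have [/andP[h1 h2]|_] := boolP (a <= t <= 1); last first.
      by rewrite iverson_false mul0r mulr_ge0 ?edge_ge0.
    have t0 := lt_le_trans a0 h1.
    rewrite iverson_true mul1r; apply: (@le_trans _ _ (ipow p a * (2 * pi * (q * expR q)))); last first.
      by rewrite ler_peMr// edge_ge1// t0.
    apply: ler_pM; rewrite ?ipow_ge0 ?mulr_ge0//; first by apply: ipow_le => //; exact: ltW.
    rewrite (ger0_norm pi0) (gtr0_norm t0) (ger0_norm (ler0n _ 2)).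
    apply: ler_pM; rewrite ?mulr_ge0 ?(ltW t0)//.
      by rewrite ler_piMr// mulr_ge0.
    apply: le_trans (one_sub_bessel_le _ _) _.
    have e : (modulus xi * t / 2) ^+ 2 <= q.
      by rewrite mulrAC exprMn ler_piMr// expr_le1// ltW.
    by apply: ler_pM; rewrite ?sqr_ge0 ?expR_ge0// ler_expR.
by apply: (cvg_seq_eq _ L1 L2) => n; exact: annulus_cos_partial.
Qed.

(** Both sides of [annulus_bessel] converge as the inner radius tends to 0, dominated by [ball_sing]
    on the left and by [edge al] on the right. *)
Lemma symbol1_bessel xi : symbol 1 xi =
  2 * pi * \int[leb]_(z in `[0, 1]) ((1 - bessel_J0 (modulus xi * z)) / z `^ (1 + 2 * al)).
Proof.
pose a (n : nat) : R := n.+2%:R^-1.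
have a01 n : 0 < a n < 1 by rewrite invr_gt0 ltr0n invf_lt1// ltr1n.
have acvg : a n @[n --> \oo] --> (0 : R)^'+.
  move=> A; rewrite /at_right /within /= => nA.
  have a0 : a n @[n --> \oo] --> (0 : R).
    by have := @cvg_harmonic R; rewrite -cvg_shiftS; apply.
  have : \forall n \near \oo, 0 < a n -> A (a n) := a0 _ nA.
  by apply: filterS => n; apply; case/andP: (a01 n).
have L1 : pint (singular (in_annulus (a n) 1) (fun y => 1 - cos (dot xi y))) @[n --> \oo] --> symbol 1 xi.
  apply: (@pint_cvg _ _ _ (fun y => modulus xi ^+ 2 / 2 * ball_sing 1 y)).
  - by move=> n; apply: pmeas_singular; [exact: pmeas_annulus|exact: pmeas_one_sub_cos].
  - move=> y; exact: (cvg_comp _ _ acvg (@singular_annulus_cvg 1 (fun y => 1 - cos (dot xi y)) y)).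
  - by apply: pintegrableZ; exact: ball_sing_integrable.
  - by move=> n; apply: singular_cos_le => s; exact: in_annulus_lt.
have p10 : 1 + 2 * al != 0 by rewrite gt_eqF// addr_gt0// mulr_gt0.
pose f t : R := iverson (0 <= t <= 1) * (2 * pi * ((1 - bessel_J0 (modulus xi * t)) / t `^ (1 + 2 * al))).
pose q := (modulus xi / 2) ^+ 2; have q0 : 0 <= q by exact: sqr_ge0.
have pi0 : 0 <= pi :> R by exact: pi_ge0.
(* The factor t from the circumference lowers the exponent from 2 + 2 al to 1 + 2 al. *)
have fa n t : iverson (a n <= t <= 1) * (ipow (2 + 2 * al) t *
     (2 * pi * t * (1 - bessel_J0 (modulus xi * t)))) = iverson (a n <= t) * f t.
  have [h|_] := leP (a n) t; last by rewrite iverson_false !mul0r.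
  have t0 : 0 < t by apply: lt_le_trans h; case/andP: (a01 n).
  rewrite /f iverson_true mul1r (ltW t0) /=; congr (_ * _).
  have -> : ipow (2 + 2 * al) t = (t * t `^ (1 + 2 * al))^-1.
    have tE : t = t `^ 1 by rewrite powRr1 ?ltW.
    rewrite /ipow {2}tE -powRD ?(gt_eqF t0) ?implybT//.
    by congr ((_ `^ _)^-1); ring.
  have h1 : t `^ (1 + 2 * al) != 0 by rewrite gt_eqF// powR_gt0.
  have h2 : t != 0 by rewrite gt_eqF.
  by move: (t `^ _) (bessel_J0 _) h1 => b c h1; field; rewrite h1 h2.
have bes t : `|1 - bessel_J0 (modulus xi * t)| <= (modulus xi * t / 2) ^+ 2 * expR ((modulus xi * t / 2) ^+ 2).
  have h : `|1 - series (bessel_term (modulus xi * t)) n.+1| @[n --> \oo] --> `|1 - bessel_J0 (modulus xi * t)|.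
    apply: cvg_norm; apply: cvgB; first exact: cvg_cst.
    have := @bessel_series_cvg _ (modulus xi * t); rewrite -cvg_shiftS; exact.
  rewrite -(cvg_lim _ h)//; apply: limr_le; first by apply/cvg_ex; eexists; exact: h.
  by apply: nearW => n; exact: one_sub_bessel_le.
have mf : measurable_fun setT f.
  apply: measurable_funM; first exact: measurable_iverson_itv.
  apply: measurable_funM => //; apply: measurable_funM.
    by apply: measurable_funB => //; exact: measurable_bessel.
  exact: (measurable_ipow (1 + 2 * al)).
have fle t : `|f t| <= 2 * pi * (q * expR q) * edge al t.
  rewrite /f normrM (ger0_norm (iverson_ge0 _ _)).
  have E0 : 0 <= 2 * pi * (q * expR q) by apply: mulr_ge0; apply: mulr_ge0 => //; exact: expR_ge0.
  have [/andP[t0 t1]|_] := boolP (0 <= t <= 1); last by rewrite iverson_false mul0r mulr_ge0 ?edge_ge0.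
  move: t0; rewrite le_eqVlt => /predU1P[<-|t0].
    by rewrite powR0// invr0 !mulr0 normr0 mulr0 mulr_ge0 ?edge_ge0.
  rewrite iverson_true mul1r !normrM (ger0_norm pi0) (ger0_norm (ler0n _ 2)) -[leRHS]mulrA.
  rewrite ler_wpM2l//; first by rewrite mulr_ge0.
  rewrite normfV (ger0_norm (powR_ge0 _ _)) -/(ipow _ _).
  apply: (@le_trans _ _ (q * expR q * t ^+ 2 * ipow (1 + 2 * al) t)).
    rewrite ler_wpM2r ?ipow_ge0//; apply: (le_trans (bes t)).
    have -> : (modulus xi * t / 2) ^+ 2 = q * t ^+ 2 by rewrite mulrAC exprMn.
    rewrite [leRHS]mulrAC; apply: ler_wpM2l; first by apply: mulr_ge0 => //; exact: sqr_ge0.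
    by rewrite ler_expR ler_piMr// expr_le1// ltW.
  have qe0 : 0 <= q * expR q := mulr_ge0 q0 (expR_ge0 q).
  rewrite -[leLHS]mulrA ler_wpM2l//.
  rewrite /edge t0 t1 iverson_true mul1r ipowE -(powR_mulrn 2 (ltW t0)).
  rewrite -powRD ?(gt_eqF t0) ?implybT//; apply: ger_powR; first by rewrite t0 t1.
  by case/andP: al01 => _ al1; lra.
have L2 : \int[leb]_t (iverson (a n <= t) * f t) @[n --> \oo] --> \int[leb]_t f t.
  apply: (@lint_cvg _ al (2 * pi * (q * expR q))) => //.
  - by move=> n; apply: measurable_funM => //; exact: measurable_le_cst.
  - move=> t; apply: cvg_near_cst; have [t0|t0] := ltP 0 t; last first.
      apply: nearW => n; suff -> : f t = 0 by rewrite mulr0.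
      move: t0; rewrite le_eqVlt => /predU1P[->|t0].
        by rewrite /f powR0// invr0 !mulr0.
      by rewrite /f leNgt t0 iverson_false mul0r.
    near=> n; rewrite (_ : (a n <= t) = true) ?iverson_true ?mul1r//.
    apply: (@le_trans _ _ n.+1%:R^-1); first by rewrite lef_pV2 ?posrE// ler_nat.
    by apply: ltW; near: n; exact: near_infty_natSinv_lt (PosNum t0).
  - move=> n t; rewrite normrM (ger0_norm (iverson_ge0 _ _)).
    by apply: le_trans (fle t); rewrite ler_piMl ?normr_ge0 ?iverson_le1.
have -> : symbol 1 xi = \int[leb]_t f t.
  apply: (cvg_seq_eq _ L1 L2) => n; rewrite annulus_bessel//.
  by apply: eq_Rintegral => t _; exact: fa.
have ig : leb.-integrable setT (EFin \o (fun t : measurableTypeR R => iverson ((0:R) <= t <= 1) * ((1 - bessel_J0 (modulus xi * t)) / (t : R) `^ (1 + 2 * al)))).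
  have i0 := integrableZl measurableT (2 * pi)^-1 (lint_dominated al01 mf fle).
  move: i0; congr (integrable _ _ _); apply/funext => t /=; congr EFin; rewrite /f.
  by rewrite mulrCA mulKf// mulf_neq0// lt0r_neq0// pi_gt0.
rewrite Rintegral_iverson -RintegralZl//; apply: eq_Rintegral => t _.
by rewrite mulrCA.
Unshelve. all: by end_near. Qed.

Lemma omega_symbol (kappa rho delta : R) xi : 0 < kappa -> 0 < rho -> 0 < delta ->
  omega kappa rho delta al (modulus xi) = Num.sqrt (2 * kappa / rho * symbol delta xi).
Proof.
move=> k0 r0 d0; rewrite symbol_scale// symbol1_bessel /omega; congr Num.sqrt.
rewrite modulusZ (gtr0_norm d0) (mulrC delta).
have h1 : delta `^ (2 * al) != 0 by rewrite gt_eqF// powR_gt0.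
have h2 : rho != 0 by rewrite gt_eqF.
by move: (Rintegral _ _ _) (delta `^ _) h1 => b c h1; field; rewrite h1 h2.
Qed.

End Singular.

(** * Fourier transforms of Schwartz functions *)

Section Components.
Variable R : realType.

Lemma is_derive_quotient (V W : normedModType R) (f : V -> W) (x v : V) (d : W) :
  is_derive x v f d <-> h^-1 *: (f (h *: v + x) - f x) @[h --> (0 : R)^'] --> d.
Proof.
split=> [[fd <-]|H]; first exact: fd.
by apply: DeriveDef; [apply/cvg_ex; exists d|exact: cvg_lim].
Qed.

Lemma is_derive_fst (f : R * R -> R * R) x v d :
  is_derive x v f d -> is_derive x v (fun y => (f y).1) d.1.
Proof.
move/is_derive_quotient => H; apply/is_derive_quotient.
exact: (cvg_comp _ _ H (@cvg_fst _ _ _ _ _)).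
Qed.

Lemma is_derive_snd (f : R * R -> R * R) x v d :
  is_derive x v f d -> is_derive x v (fun y => (f y).2) d.2.
Proof.
move/is_derive_quotient => H; apply/is_derive_quotient.
exact: (cvg_comp _ _ H (@cvg_snd _ _ _ _ _)).
Qed.

Lemma is_derive_pair (f g : R * R -> R) x v a b :
  is_derive x v f a -> is_derive x v g b ->
  is_derive x v (fun y => (f y, g y)) (a, b).
Proof.
move=> /is_derive_quotient H1 /is_derive_quotient H2; apply/is_derive_quotient.
exact: (cvg_pair H1 H2).
Qed.

(** Indexed by a boolean like [basis_vector], so one proof serves both components and both
    directions. *)
Definition component (c : bool) (x : R * R) : R := if c then x.2 else x.1.

Lemma is_derive_component c (f : R * R -> R * R) x v d :
  is_derive x v f d -> is_derive x v (fun y => component c (f y)) (component c d).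
Proof. by case: c; [exact: is_derive_snd|exact: is_derive_fst]. Qed.

Lemma continuous_component c (f : R * R -> R * R) : continuous f ->
  continuous (fun y => component c (f y)).
Proof.
move=> cf x; case: c; [exact: (cvg_comp _ _ (cf x) (@cvg_snd _ _ _ _ _))|].
exact: (cvg_comp _ _ (cf x) (@cvg_fst _ _ _ _ _)).
Qed.

Lemma norm_component c (x : R * R) : `|component c x| <= modulus x.
Proof. by case: c; [exact: norm_snd_modulus|exact: norm_fst_modulus]. Qed.

End Components.

(** * Cosine and sine transforms: decay and inversion *)

Section RapidDecay.
Variable R : realType.
Implicit Types (x y xi : R * R).

(* A scalar Schwartz function together with all its iterated derivatives. *)
Record rapid (D : seq bool -> R * R -> R) : Prop := {
  rapid_continuous : forall s, continuous (D s);
  rapid_derive : forall s i x, is_derive x (basis_vector R i) (D s) (D (i :: s) x);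
  rapid_decay : forall s n, exists C : R, forall x, wt x ^+ n * `|D s x| <= C }.

(** Bounds the weight by the monomials occurring in [schwartz], by cases on s ^ 2 <= 1. *)
Lemma oneDsqrX_le (s : R) n : oneDsqr s ^+ n <= 2 ^+ n * (1 + s ^+ (2 * n)).
Proof.
have s2 : 0 <= s ^+ 2 by exact: sqr_ge0.
rewrite /oneDsqr exprM; move: (s ^+ 2) s2 => u u0.
have un : 0 <= u ^+ n by exact: exprn_ge0.
have [u1|u1] := leP u 1.
  apply: (@le_trans _ _ (2 ^+ n)).
    by rewrite lerXn2r ?nnegrE//; lra.
  by rewrite ler_peMr ?exprn_ge0// lerDl.
apply: (@le_trans _ _ ((2 * u) ^+ n)).
  by rewrite lerXn2r ?nnegrE ?mulr_ge0 ?addr_ge0//; lra.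
by rewrite exprMn ler_wpM2l ?exprn_ge0// lerDr.
Qed.

Lemma schwartz_rapid (f : R * R -> R * R) c : schwartz f ->
  rapid (fun s x => component c (pderiv s f x)).
Proof.
move=> [Cf bf]; split.
- move=> s; apply: continuous_component; have [_] := Cf (size s) s; exact.
- move=> s i x; apply: is_derive_component.
  have [/(_ (ltnSn _) i x) fd _] := Cf (size s).+1 s.
  by apply: DeriveDef => //; rewrite /=.
- move=> s n.
  (* Expanding (1 + x1 ^ (2 n)) (1 + x2 ^ (2 n)) calls for four seminorms. *)
  have [C0 H0] := bf 0%N 0%N s; have [C1 H1] := bf (2 * n)%N 0%N s.
  have [C2 H2] := bf 0%N (2 * n)%N s; have [C3 H3] := bf (2 * n)%N (2 * n)%N s.
  exists (4 ^+ n * (C0 + C1 + C2 + C3)) => x.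
  have h a b C : (forall x, modulus ((x.1 ^+ a * x.2 ^+ b) *: pderiv s f x) <= C) ->
      x.1 ^+ a * x.2 ^+ b * `|component c (pderiv s f x)| <= C.
    move=> /(_ x); apply: le_trans; rewrite modulusZ.
    apply: le_trans (ler_wpM2l (normr_ge0 _) (norm_component c _)).
    by rewrite ler_wpM2r// ler_norm.
  have := h _ _ _ H0; have := h _ _ _ H1; have := h _ _ _ H2; have := h _ _ _ H3.
  rewrite !expr0 !mul1r mulr1 /wt exprMn.
  set a := _ ^+ _; set b := _ ^+ _; set d := `|_| => h3 h2 h1 h0.
  apply: (@le_trans _ _ ((2 ^+ n * (1 + a)) * (2 ^+ n * (1 + b)) * d)).
    apply: ler_wpM2r; first exact: normr_ge0.
    apply: ler_pM; rewrite ?exprn_ge0 ?oneDsqrX_le//;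
      by rewrite (le_trans ler01) ?oneDsqr_ge1.
  have -> : (4 ^+ n : R) = 2 ^+ n * 2 ^+ n by rewrite -exprMn; congr (_ ^+ _); rewrite -natrM.
  have -> : 2 ^+ n * (1 + a) * (2 ^+ n * (1 + b)) * d = 2 ^+ n * 2 ^+ n * (d + a * d + b * d + a * b * d) by ring.
  rewrite ler_wpM2l ?mulr_ge0 ?exprn_ge0//; lra.
Qed.

Variable D : seq bool -> R * R -> R.
Hypothesis rD : rapid D.

Lemma rapid_env s : exists2 C : R, 0 <= C & forall x, `|D s x| <= C * env x.
Proof.
have [C HC] := rapid_decay rD s 1; exists C => [|x].
  by apply: le_trans (HC 0); rewrite mulr_ge0// expr1 ltW ?wt_gt0.
by rewrite envE ler_pdivlMr ?wt_gt0// mulrC -[wt x]expr1.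
Qed.

Lemma rapid_bounded s : exists C : R, forall x, `|D s x| <= C.
Proof. by have [C HC] := rapid_decay rD s 0; exists C => x; have := HC x; rewrite mul1r. Qed.

Lemma rapid_integrable s : pintegrable (D s).
Proof.
have [C _ H] := rapid_env s; apply: pintegrable_env H.
by apply: pmeas_continuous; exact: rapid_continuous.
Qed.

Lemma rapid_norm_integrable s : pintegrable (fun x => `|D s x|).
Proof.
have [C _ H] := rapid_env s; apply: (@pintegrable_env _ C); last by move=> x; rewrite normr_id.
by apply: pmeas_comp => //; apply: pmeas_continuous; exact: rapid_continuous.
Qed.

Definition cos_transform s xi : R := pint (fun x => D s x * cos (dot xi x)).
Definition sin_transform s xi : R := pint (fun x => D s x * sin (dot xi x)).

Lemma continuous_cos_dot xi : continuous (fun x => cos (dot xi x)).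
Proof. by apply: (continuous_plane_comp (@continuous_cos R)); exact: continuous_dot. Qed.

Lemma continuous_sin_dot xi : continuous (fun x => sin (dot xi x)).
Proof. by apply: (continuous_plane_comp (@continuous_sin R)); exact: continuous_dot. Qed.

Lemma norm_cos_le1 (t : R) : `|cos t| <= 1.
Proof. by rewrite ler_norml cos_geN1 cos_le1. Qed.

Lemma norm_sin_le1 (t : R) : `|sin t| <= 1.
Proof. by rewrite ler_norml sin_geN1 sin_le1. Qed.

Lemma dominated_bounded f (h : R * R -> R) : pintegrable f -> pmeas h -> (forall x, `|h x| <= 1) ->
  pintegrable (fun x => f x * h x).
Proof.
move=> i1 mh h1; have mf := pintegrable_meas i1.
have : pintegrable (fun x => `|f x * h x|) -> pintegrable (fun x => f x * h x).
  move=> i2; apply: (pintegrable_dominated (g := fun x => `|f x * h x|)) => //.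
  exact: pmeasM.
apply; apply: (@pintegrable_dominated _ (fun x => `|f x|)).
- by apply: pmeas_comp => //; exact: pmeasM.
- have := integrable_abse i1; exact.
- by move=> x; rewrite normr_id normrM ler_piMr.
Qed.

Lemma cos_transform_integrable s xi : pintegrable (fun x => D s x * cos (dot xi x)).
Proof.
apply: dominated_bounded; first exact: rapid_integrable.
  by apply: pmeas_continuous; exact: continuous_cos_dot.
by move=> x; exact: norm_cos_le1.
Qed.

Lemma sin_transform_integrable s xi : pintegrable (fun x => D s x * sin (dot xi x)).
Proof.
apply: dominated_bounded; first exact: rapid_integrable.
  by apply: pmeas_continuous; exact: continuous_sin_dot.
by move=> x; exact: norm_sin_le1.
Qed.

Lemma is_derive_dot xi v x : is_derive x v (dot xi) (dot xi v).
Proof.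
apply/is_derive_line0; rewrite (_ : (fun t : R => _) = (fun t => dot xi x + t * dot xi v)).
  by apply/has_derivP/has_deriv_eq; [derive_rules|rewrite /= mulr0 add0r add0r mulr1].
by apply/funext => t; rewrite dotDr dotZr.
Qed.

Lemma is_derive_plane_comp (h dh : R -> R) (f : R * R -> R) x v d :
  (forall t : R, is_derive t 1 h (dh t)) -> is_derive x v f d ->
  is_derive x v (fun y => h (f y)) (dh (f x) * d).
Proof.
move=> hd /is_derive_line0 fd; apply/is_derive_line0.
by apply: has_deriv_comp fd; rewrite scale0r addr0; exact: hd.
Qed.

Lemma is_derive_planeM (f g : R * R -> R) x v a b :
  is_derive x v f a -> is_derive x v g b ->
  is_derive x v (fun y => f y * g y) (f x * b + g x * a).
Proof.
move=> /is_derive_line0 fd /is_derive_line0 gd; apply/is_derive_line0.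
have := has_derivM fd gd; rewrite scale0r addr0; exact.
Qed.

Lemma is_derive_cos_dot xi v x :
  is_derive x v (fun y => cos (dot xi y)) (- sin (dot xi x) * dot xi v).
Proof. by apply: (is_derive_plane_comp (@is_derive_cos R)); exact: is_derive_dot. Qed.

Lemma is_derive_sin_dot xi v x :
  is_derive x v (fun y => sin (dot xi y)) (cos (dot xi x) * dot xi v).
Proof. by apply: (is_derive_plane_comp (@is_derive_sin R)); exact: is_derive_dot. Qed.

(** A general bounded factor T covers the cosine and the sine at once. *)
Lemma transform_ibp s i (T dT : R * R -> R) : continuous T -> continuous dT ->
  (exists C : R, forall x, `|dT x| <= C) ->
  (forall x, is_derive x (basis_vector R i) T (dT x)) -> (forall x, `|T x| <= 1) ->
  pint (fun x => D (i :: s) x * T x) = - pint (fun x => D s x * dT x).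
Proof.
move=> cT cdT [K HK] Td T1.
have [C1 C10 H1] := rapid_env s; have [C2 C20 H2] := rapid_env (i :: s).
have K0 : 0 <= K by apply: le_trans (HK 0).
have b1 x : `|D s x * dT x| <= C1 * K * env x.
  rewrite normrM [leRHS]mulrAC; apply: ler_pM => //.
have b2 x : `|D (i :: s) x * T x| <= C2 * env x.
  by rewrite normrM -[leRHS]mulr1; apply: ler_pM.
have c1 : continuous (fun x => D s x * dT x) by apply: continuous_planeM => //; exact: rapid_continuous.
have c2 : continuous (fun x => D (i :: s) x * T x) by apply: continuous_planeM => //; exact: rapid_continuous.
apply/eqP; rewrite eq_sym -subr_eq0 -opprD oppr_eq0; apply/eqP.
rewrite -pintD; [|exact: (pintegrable_env (pmeas_continuous c1) b1)|exact: (pintegrable_env (pmeas_continuous c2) b2)].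
rewrite (_ : (fun x => _) = (fun x => D s x * dT x + T x * D (i :: s) x)); last first.
  by apply/funext => x; rewrite (mulrC (T x)).
apply: (@pint_derive_eq0 _ (fun x => D s x * T x) _ (basis_vector R i) (C1 + (C1 * K + C2))).
- by apply: continuous_planeM => //; exact: rapid_continuous.
- by apply: continuous_planeD => //; apply: continuous_planeM => //; exact: rapid_continuous.
- by move=> x; exact: (is_derive_planeM (rapid_derive rD s i x) (Td x)).
- move=> x; apply: (@le_trans _ _ (C1 * env x)).
    by rewrite normrM -[leRHS]mulr1; apply: ler_pM.
  by rewrite ler_wpM2r ?env_ge0// lerDl addr_ge0// mulr_ge0.
- move=> x; apply: le_trans (ler_normD _ _) _; rewrite (mulrC (T x)) !mulrDl.
  by rewrite -[leLHS]add0r lerD ?mulr_ge0 ?env_ge0// lerD.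
Qed.

Lemma cos_transform_derive s i xi :
  cos_transform (i :: s) xi = dot xi (basis_vector R i) * sin_transform s xi.
Proof.
rewrite /cos_transform (@transform_ibp s i (fun x => cos (dot xi x))
  (fun x => - sin (dot xi x) * dot xi (basis_vector R i)) _ _ _ (is_derive_cos_dot xi (basis_vector R i))).
- rewrite -pintN; last first.
    have := pintegrableZ (- dot xi (basis_vector R i)) (sin_transform_integrable s xi).
    by apply: eq_pintegrable => x; ring.
  by rewrite -pintZ; [apply: eq_pint => x; ring|exact: sin_transform_integrable].
- exact: continuous_cos_dot.
- apply: continuous_planeM; last exact: continuous_plane_cst.
  by apply: continuous_planeN; exact: continuous_sin_dot.
- exists `|dot xi (basis_vector R i)| => x.
  by rewrite normrM normrN ler_piMl// norm_sin_le1.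
- by move=> x; exact: norm_cos_le1.
Qed.

Lemma sin_transform_derive s i xi :
  sin_transform (i :: s) xi = - dot xi (basis_vector R i) * cos_transform s xi.
Proof.
rewrite /sin_transform (@transform_ibp s i (fun x => sin (dot xi x))
  (fun x => cos (dot xi x) * dot xi (basis_vector R i)) _ _ _ (is_derive_sin_dot xi (basis_vector R i))).
- rewrite -pintN; last first.
    have := pintegrableZ (dot xi (basis_vector R i)) (cos_transform_integrable s xi).
    by apply: eq_pintegrable => x; ring.
  by rewrite -pintZ; [apply: eq_pint => x; ring|exact: cos_transform_integrable].
- exact: continuous_sin_dot.
- by apply: continuous_planeM; [exact: continuous_cos_dot|exact: continuous_plane_cst].
- exists `|dot xi (basis_vector R i)| => x.
  by rewrite normrM ler_piMl// norm_cos_le1.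
- by move=> x; exact: norm_sin_le1.
Qed.

Lemma norm_transform_le s (T : R * R -> R) : pmeas T -> (forall x, `|T x| <= 1) ->
  `|pint (fun x => D s x * T x)| <= pint (fun x => `|D s x|).
Proof.
move=> mT T1; apply: norm_pint_le; last by move=> x; rewrite normrM ler_piMr.
  by apply: dominated_bounded => //; exact: rapid_integrable.
exact: rapid_norm_integrable.
Qed.

Lemma dot_basis xi i : dot xi (basis_vector R i) = component i xi.
Proof. by case: i; rewrite /dot /= !(mulr0, mulr1, add0r, addr0). Qed.

Lemma wt_component xi : wt xi = (1 + component false xi ^+ 2) * (1 + component true xi ^+ 2).
Proof. by []. Qed.

(** A repeated derivative multiplies a transform by - xi_i ^ 2 and leads from cosine back to cosine.
    Hence wt xi * E s is a signed sum of four transforms of derivatives, all covered by the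
    induction hypothesis. *)
Lemma transform_decay_of (E : seq bool -> R * R -> R) :
  (forall s, exists C : R, forall xi, `|E s xi| <= C) ->
  (forall s i xi, E (i :: i :: s) xi = - component i xi ^+ 2 * E s xi) ->
  forall n s, exists C : R, forall xi, wt xi ^+ n * `|E s xi| <= C.
Proof.
move=> bE dE; elim=> [|n IH] s.
  by have [C HC] := bE s; exists C => xi; rewrite mul1r.
have [C0 H0] := IH s; have [C1 H1] := IH [:: false, false & s].
have [C2 H2] := IH [:: true, true & s]; have [C3 H3] := IH [:: true, true, false, false & s].
exists (C0 + C1 + C2 + C3) => xi.
rewrite exprSr -mulrA -(gtr0_norm (wt_gt0 xi)) -normrM (gtr0_norm (wt_gt0 xi)).
have -> : wt xi * E s xi = E s xi - E [:: false, false & s] xi - E [:: true, true & s] xi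
    + E [:: true, true, false, false & s] xi.
  by rewrite !dE wt_component; ring.
apply: le_trans (ler_wpM2l _ (_ : _ <= `|E s xi| + `|E [:: false, false & s] xi| + `|E [:: true, true & s] xi|
    + `|E [:: true, true, false, false & s] xi|)) _.
- by rewrite exprn_ge0// ltW// wt_gt0.
- by rewrite (le_trans (ler_normD _ _))// lerD2r (le_trans (ler_normB _ _))// lerD2r ler_normB.
- by rewrite !mulrDr !lerD.
Qed.

Lemma cos_transform_decay n s : exists C : R, forall xi, wt xi ^+ n * `|cos_transform s xi| <= C.
Proof.
apply: transform_decay_of => [s'|s' i xi].
  exists (pint (fun x => `|D s' x|)) => xi; apply: norm_transform_le.
    by apply: pmeas_continuous; exact: continuous_cos_dot.
  by move=> x; exact: norm_cos_le1.
by rewrite cos_transform_derive sin_transform_derive dot_basis; ring.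
Qed.

Lemma sin_transform_decay n s : exists C : R, forall xi, wt xi ^+ n * `|sin_transform s xi| <= C.
Proof.
apply: transform_decay_of => [s'|s' i xi].
  exists (pint (fun x => `|D s' x|)) => xi; apply: norm_transform_le.
    by apply: pmeas_continuous; exact: continuous_sin_dot.
  by move=> x; exact: norm_sin_le1.
by rewrite sin_transform_derive cos_transform_derive dot_basis; ring.
Qed.

Lemma continuous_cos_transform s : continuous (cos_transform s).
Proof.
move=> xi; apply: (@pint_continuous _ _ (fun z x => D s x * cos (dot z x)) xi setT (fun x => `|D s x|)).
- exact: filterT.
- by move=> z _; apply: pintegrable_meas; exact: cos_transform_integrable.
- move=> x; apply: cvgM; first exact: cvg_cst.
  rewrite (_ : (fun z => _) = (fun z => cos (dot x z))); last by apply/funext => z; rewrite dotC.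
  rewrite dotC; exact: continuous_cos_dot.
- exact: rapid_norm_integrable.
- by move=> z x _; rewrite normrM ler_piMr// norm_cos_le1.
Qed.

Lemma continuous_sin_transform s : continuous (sin_transform s).
Proof.
move=> xi; apply: (@pint_continuous _ _ (fun z x => D s x * sin (dot z x)) xi setT (fun x => `|D s x|)).
- exact: filterT.
- by move=> z _; apply: pintegrable_meas; exact: sin_transform_integrable.
- move=> x; apply: cvgM; first exact: cvg_cst.
  rewrite (_ : (fun z => _) = (fun z => sin (dot x z))); last by apply/funext => z; rewrite dotC.
  rewrite dotC; exact: continuous_sin_dot.
- exact: rapid_norm_integrable.
- by move=> z x _; rewrite normrM ler_piMr// norm_sin_le1.
Qed.

Lemma cos_transform_even s xi : cos_transform s (- xi) = cos_transform s xi.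
Proof. by apply: eq_pint => x; rewrite dotNl cosN. Qed.

Lemma sin_transform_odd s xi : sin_transform s (- xi) = - sin_transform s xi.
Proof.
rewrite -pintN; last exact: sin_transform_integrable.
by apply: eq_pint => x; rewrite dotNl sinN mulrN.
Qed.

(** After a Gaussian factor is inserted in xi, the integrals may be exchanged, and [gauss_fourier]
    turns the inner one into a narrow Gaussian around x. *)
Lemma transform_inversion x :
  pint (fun xi => cos (dot xi x) * cos_transform [::] xi + sin (dot xi x) * sin_transform [::] xi) =
  (2 * pi) ^+ 2 * D [::] x.
Proof.
pose f := D [::]; pose U xi := cos (dot xi x) * cos_transform [::] xi + sin (dot xi x) * sin_transform [::] xi.
have UE xi : U xi = pint (fun z => f z * cos (dot xi z - dot xi x)).
  rewrite /U -pintZ; last exact: cos_transform_integrable.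
  rewrite -pintZ; last exact: sin_transform_integrable.
  rewrite -pintD; [|by apply: pintegrableZ; exact: cos_transform_integrable
                   |by apply: pintegrableZ; exact: sin_transform_integrable].
  by apply: eq_pint => z; rewrite cosB /f; ring.
have cU : continuous U.
  have cd (h : R -> R) : continuous h -> continuous (fun xi => h (dot xi x)).
    move=> ch; rewrite (_ : (fun xi => _) = (fun xi => h (dot x xi))).
      by apply: (continuous_plane_comp ch); exact: continuous_dot.
    by apply/funext => xi; rewrite dotC.
  by apply: continuous_planeD; apply: continuous_planeM;
    [exact: (cd _ (@continuous_cos R))|exact: continuous_cos_transform
    |exact: (cd _ (@continuous_sin R))|exact: continuous_sin_transform].
have [C HC] : exists C : R, forall xi, `|U xi| <= C * env xi.
  have [C1 H1] := cos_transform_decay 1 [::]; have [C2 H2] := sin_transform_decay 1 [::].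
  exists (C1 + C2) => xi; rewrite envE ler_pdivlMr ?wt_gt0// mulrC -[wt xi]expr1.
  apply: le_trans (ler_wpM2l _ (ler_normD _ _)) _; first by rewrite exprn_ge0// ltW// wt_gt0.
  rewrite mulrDr !normrM; apply: lerD.
    apply: le_trans (H1 xi); rewrite ler_wpM2l ?exprn_ge0 ?(ltW (wt_gt0 _))//.
    by rewrite ler_piMl// norm_cos_le1.
  apply: le_trans (H2 xi); rewrite ler_wpM2l ?exprn_ge0 ?(ltW (wt_gt0 _))//.
  by rewrite ler_piMl// norm_sin_le1.
have iU : pintegrable U by exact: (pintegrable_env (pmeas_continuous cU) HC).
(* The 1 / 2 cancels the 4 in [gauss_fourier], so that the transform of gauss (c k xi) is a multiple
   of gauss ((k + 1) (z - x)). *)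
pose c (k : nat) : R := k.+1%:R^-1 / 2.
have c0 k : 0 < c k by rewrite divr_gt0// invr_gt0.
have cc : k.+1%:R^-1 @[k --> \oo] --> (0 : R) by exact: cvg_harmonic.
have L1 : pint (fun xi => gauss (c k *: xi) * U xi) @[k --> \oo] --> pint U.
  apply: (@pint_cvg _ _ _ (fun xi => `|U xi|)).
  - move=> k; apply: pmeasM; last exact: pmeas_continuous.
    have := pmeas_affine (c k) 0 (pmeas_continuous (@continuous_gauss R)).
    by congr pmeas; apply/funext => xi; rewrite addr0.
  - move=> xi; rewrite -[X in _ --> X]mul1r; apply: cvgM; last exact: cvg_cst.
    rewrite (_ : 1 = expR (- (0 ^+ 2 * dot xi xi))); last by rewrite expr0n mul0r oppr0 expR0.
    rewrite (_ : (fun k => _) = (fun k => expR (- (c k ^+ 2 * dot xi xi)))); last first.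
      by apply/funext => k; rewrite /gauss dotZl dotZr mulrA -expr2.
    have ch : continuous (fun t : R => expR (- (t ^+ 2 * dot xi xi))).
      move=> t; exact: (is_derive_continuous (has_deriv_exp (has_derivN
        (has_derivM (has_derivX 2 (has_deriv_id t)) (has_deriv_cst (dot xi xi) t))))).
    have c00 : c k @[k --> \oo] --> (0 : R).
      by rewrite -(mul0r 2^-1); apply: cvgM; [exact: cc|exact: cvg_cst].
    exact: (cvg_comp _ _ c00 (ch 0)).
  - by have := integrable_abse iU; exact.
  - move=> k xi; rewrite normrM ler_piMl// (ger0_norm (ltW (gauss_gt0 _))).
    by rewrite /gauss -[leRHS]expR0 ler_expR oppr_le0 dot_ge0.
(* The constant (2 pi)^2 arises as 4 pi * pi, one pi from [gauss_fourier] and one from the mass of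
   the Gaussian. *)
have L2 : (4 * pi) * pint (fun u => f (x + k.+1%:R^-1 *: u) * gauss u) @[k --> \oo] --> 4 * pi * (f x * pi).
  have [C0 HC0] := rapid_bounded [::].
  apply: cvgM; first exact: cvg_cst.
  apply: (@gauss_approx_identity _ _ C0 0) => //.
  - exact: rapid_continuous.
  - by move=> y; rewrite mulr1.
  - by move=> k; rewrite invr_ge0 ler0n invf_le1// ler1n.
rewrite (_ : (2 * pi) ^+ 2 * D [::] x = 4 * pi * (f x * pi)); last by rewrite /f; ring.
apply: (cvg_seq_eq _ L1 L2) => k.
rewrite (_ : (fun xi => _) = (fun xi => pint (fun z => gauss (c k *: xi) * (f z * cos (dot xi z - dot xi x))))); last first.
  apply/funext => xi; rewrite UE pintZ//; apply: dominated_bounded; first exact: rapid_integrable.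
    apply: pmeas_continuous; apply: (continuous_plane_comp (@continuous_cos R)).
    by apply: continuous_planeB; [exact: continuous_dot|exact: continuous_plane_cst].
  by move=> z; exact: norm_cos_le1.
have ig : pintegrable (fun xi => gauss (c k *: xi)).
  have := pintegrable_affine 0 (c0 k) (@pintegrable_gauss R).
  by apply: eq_pintegrable => xi; rewrite addr0.
rewrite (@pint_swap _ (fun xi z => gauss (c k *: xi) * (f z * cos (dot xi z - dot xi x)))
  (fun xi => gauss (c k *: xi)) (fun z => `|f z|)).
- have inner z : pint (fun xi => gauss (c k *: xi) * (f z * cos (dot xi z - dot xi x))) =
      4 * pi * (k.+1%:R ^+ 2 * (f z * gauss (k.+1%:R *: (z - x)))).
    have i1 : pintegrable (fun xi => gauss (c k *: xi) * cos (dot xi (z - x))).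
      apply: dominated_bounded => //; last by move=> xi; exact: norm_cos_le1.
      rewrite (_ : (fun xi => _) = (fun xi => cos (dot (z - x) xi))).
        by apply: pmeas_continuous; exact: continuous_cos_dot.
      by apply/funext => xi; rewrite dotC.
    rewrite (eq_pint (g := fun xi => f z * (gauss (c k *: xi) * cos (dot xi (z - x))))); last first.
      by move=> xi; rewrite dotBr mulrCA.
    rewrite pintZ// (@pint_affine _ (c k)^-1 0) ?invr_gt0//.
    rewrite (eq_pint (g := fun xi => cos (dot ((c k)^-1 *: (z - x)) xi) * gauss xi)); last first.
      move=> xi; rewrite addr0 scalerA divff ?gt_eqF// scale1r mulrC.
      by rewrite dotZl dotZl dotC.
    rewrite gauss_fourier /gauss !dotZl !dotZr /c.
    have k0 : (k.+1%:R : R) != 0 by [].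
    move: (k.+1%:R) k0 (dot (z - x) (z - x)) => K K0 d.
    rewrite (_ : (K^-1 / 2)^-1 * ((K^-1 / 2)^-1 * d) / 4 = K * (K * d)); last by field.
    by move: (expR _) => E; field.
  rewrite (eq_pint inner).
  have k0 : 0 < k.+1%:R :> R by [].
  have i2 : pintegrable (fun z => f z * gauss (k.+1%:R *: (z - x))).
    apply: dominated_bounded; first exact: rapid_integrable.
      have := pmeas_affine k.+1%:R (- (k.+1%:R *: x)) (pmeas_continuous (@continuous_gauss R)).
      by congr pmeas; apply/funext => z; rewrite scalerBr.
    move=> z; rewrite (ger0_norm (ltW (gauss_gt0 _))).
    by rewrite /gauss -[leRHS]expR0 ler_expR oppr_le0 dot_ge0.
  rewrite pintZ; last exact: pintegrableZ.
  rewrite pintZ//; congr (_ * _).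
  have ki0 : 0 < k.+1%:R^-1 :> R by rewrite invr_gt0.
  rewrite (pint_affine x ki0 i2) mulrA -exprMn mulfV// expr1n mul1r.
  apply: eq_pint => u; rewrite addrK scalerA mulfV// scale1r.
  by rewrite (addrC x).
- apply: pmeas2M.
    have := pmeas_affine (c k) 0 (pmeas_continuous (@continuous_gauss R)).
    move/pmeas2_fst; congr pmeas2; apply/funext => xi; apply/funext => z; by rewrite addr0.
  apply: pmeas2M; first exact: (pmeas2_snd (pintegrable_meas (rapid_integrable [::]))).
  apply: (pmeas2_comp (h := cos)); first exact: continuous_measurable_fun (@continuous_cos R).
  apply: pmeas2B; first exact: pmeas2_dot.
  apply: pmeas2_fst; rewrite (_ : (fun xi => _) = dot x); last by apply/funext => xi; rewrite dotC.
  by apply: pmeas_continuous; exact: continuous_dot.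
- exact: ig.
- exact: rapid_norm_integrable.
- move=> xi z; rewrite !normrM (ger0_norm (ltW (gauss_gt0 _))).
  by rewrite ler_wpM2l ?(ltW (gauss_gt0 _))// ler_piMr// norm_cos_le1.
Qed.

End RapidDecay.

(** * Oscillatory integrals *)

Section Fast.
Variable R : realType.
Implicit Types (x y v xi : R * R) (a b h : R * R -> R).

(** Measurability in place of continuity, because the amplitude [sinc] is obtained as a pointwise
    limit. *)
Definition fast a : Prop :=
  pmeas a /\ forall n, exists C : R, forall xi, wt xi ^+ n * `|a xi| <= C.

Lemma wtX_ge0 n xi : 0 <= wt xi ^+ n.
Proof. by rewrite exprn_ge0// ltW// wt_gt0. Qed.

Lemma fast_mul a h (K : R) m : fast a -> pmeas h -> (forall xi, `|h xi| <= K * wt xi ^+ m) ->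
  fast (fun xi => h xi * a xi).
Proof.
move=> [ma fa] mh hK; split; first exact: pmeasM.
have K0 : 0 <= K.
  have := le_trans (normr_ge0 _) (hK 0); rewrite pmulr_lge0// exprn_gt0// wt_gt0.
  exact.
move=> n; have [C HC] := fa (n + m)%N; exists (K * C) => xi.
rewrite normrM; apply: (@le_trans _ _ (wt xi ^+ n * ((K * wt xi ^+ m) * `|a xi|))).
  by rewrite ler_wpM2l ?wtX_ge0// ler_wpM2r.
have -> : wt xi ^+ n * (K * wt xi ^+ m * `|a xi|) = K * (wt xi ^+ (n + m) * `|a xi|).
  by rewrite exprD; ring.
exact: ler_wpM2l.
Qed.

Lemma fastD a b : fast a -> fast b -> fast (fun xi => a xi + b xi).
Proof.
move=> [ma fa] [mb fb]; split; first exact: pmeasD.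
move=> n; have [C HC] := fa n; have [C' HC'] := fb n; exists (C + C') => xi.
apply: le_trans (ler_wpM2l (wtX_ge0 _ _) (ler_normD _ _)) _.
by rewrite mulrDr lerD.
Qed.

Lemma fast_norm a : fast a -> fast (fun xi => `|a xi|).
Proof.
move=> [ma fa]; split; first by apply: pmeas_comp.
by move=> n; have [C HC] := fa n; exists C => xi; rewrite normr_id.
Qed.

Lemma fastN a : fast a -> fast (fun xi => - a xi).
Proof.
move=> [ma fa]; split.
  rewrite (_ : (fun xi => _) = (fun xi => (- 1) * a xi)); last by apply/funext => xi; rewrite mulN1r.
  by apply: pmeasM => //; exact: pmeas_cst.
by move=> n; have [C HC] := fa n; exists C => xi; rewrite normrN.
Qed.

Lemma fast_integrable a : fast a -> pintegrable a.
Proof.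
move=> [ma fa]; have [C HC] := fa 1%N; apply: (pintegrable_env (C := C)) => // xi.
by rewrite envE ler_pdivlMr ?wt_gt0// mulrC -[wt xi]expr1.
Qed.

Lemma norm_component_wt c xi : `|component c xi| <= 1 * wt xi ^+ 1.
Proof.
have := norm_dot_le xi (basis_vector R c); rewrite dotC dot_basis => h.
apply: (le_trans h); rewrite expr1 ler_wpM2r ?(ltW (wt_gt0 _))//.
by case: c {h}; rewrite /= normr0 normr1 ?add0r ?addr0.
Qed.

Lemma pmeas_component c : pmeas (@component R c).
Proof. by case: c; [exact: pmeas_snd|exact: pmeas_fst]. Qed.

Lemma fast_component c a : fast a -> fast (fun xi => component c xi * a xi).
Proof.
by move=> fa; apply: (fast_mul fa (pmeas_component c)); exact: norm_component_wt.
Qed.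

(** The real part of the integral of exp (- i xi . x) (a + i b). *)
Definition osc a b x : R := pint (fun xi => cos (dot xi x) * a xi + sin (dot xi x) * b xi).

Lemma continuous_cos_dotl x : continuous (fun xi => cos (dot xi x)).
Proof.
rewrite (_ : (fun xi => _) = (fun xi => cos (dot x xi))); first exact: continuous_cos_dot.
by apply/funext => xi; rewrite dotC.
Qed.

Lemma continuous_sin_dotl x : continuous (fun xi => sin (dot xi x)).
Proof.
rewrite (_ : (fun xi => _) = (fun xi => sin (dot x xi))); first exact: continuous_sin_dot.
by apply/funext => xi; rewrite dotC.
Qed.

Lemma pmeas_osc a b x : pmeas a -> pmeas b ->
  pmeas (fun xi => cos (dot xi x) * a xi + sin (dot xi x) * b xi).
Proof.
move=> ma mb; apply: pmeasD; apply: pmeasM => //; apply: pmeas_continuous.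
  exact: continuous_cos_dotl.
exact: continuous_sin_dotl.
Qed.

Lemma norm_osc_le a b x xi :
  `|cos (dot xi x) * a xi + sin (dot xi x) * b xi| <= `|a xi| + `|b xi|.
Proof.
apply: le_trans (ler_normD _ _) _; rewrite !normrM lerD//.
  by rewrite ler_piMl// norm_cos_le1.
by rewrite ler_piMl// norm_sin_le1.
Qed.

Lemma osc_integrable a b x : fast a -> fast b ->
  pintegrable (fun xi => cos (dot xi x) * a xi + sin (dot xi x) * b xi).
Proof.
move=> fa fb; apply: (pintegrable_dominated (g := fun xi => `|a xi| + `|b xi|)).
- by apply: pmeas_osc; [case: fa|case: fb].
- by apply: fast_integrable; apply: fastD; exact: fast_norm.
- exact: norm_osc_le.
Qed.

Lemma continuous_osc a b : fast a -> fast b -> continuous (osc a b).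
Proof.
move=> fa fb x; apply: (@pint_continuous _ _
  (fun x xi => cos (dot xi x) * a xi + sin (dot xi x) * b xi) x setT (fun xi => `|a xi| + `|b xi|)).
- exact: filterT.
- by move=> z _; apply: pmeas_osc; [case: fa|case: fb].
- move=> xi; apply: cvgD; apply: cvgM; try exact: cvg_cst.
    exact: continuous_cos_dot.
  exact: continuous_sin_dot.
- by apply: fast_integrable; apply: fastD; exact: fast_norm.
- by move=> z xi _; exact: norm_osc_le.
Qed.

Lemma osc_derive a b i x : fast a -> fast b ->
  is_derive x (basis_vector R i) (osc a b)
    (osc (fun xi => component i xi * b xi) (fun xi => - (component i xi * a xi)) x).
Proof.
move=> fa fb; apply/is_derive_line0; set v := basis_vector R i.
pose dF (t : R) xi := cos (dot xi (x + t *: v)) * (component i xi * b xi)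
   + sin (dot xi (x + t *: v)) * - (component i xi * a xi).
have fa' := fastN (fast_component i fa); have fb' := fast_component i fb.
have -> : osc (fun xi => component i xi * b xi) (fun xi => - (component i xi * a xi)) x = pint (dF 0).
  by apply: eq_pint => xi; rewrite /dF scale0r addr0.
apply: (@is_derive_pint _
  (fun t xi => cos (dot xi (x + t *: v)) * a xi + sin (dot xi (x + t *: v)) * b xi)
  dF (fun xi => `|component i xi * b xi| + `|- (component i xi * a xi)|) 0 1 ltr01).
- by move=> t _; exact: osc_integrable.
- move=> t xi _; rewrite /dF.
  have E : (fun t : R => dot xi (x + t *: v)) = (fun t : R => dot xi x + t * component i xi).
    by apply/funext => s; rewrite dotDr dotZr dot_basis.
  have hd : has_deriv (fun t : R => dot xi (x + t *: v)) t (component i xi).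
    rewrite E; apply: has_deriv_eq; first by derive_rules.
    by rewrite /= mulr0 !add0r mulr1.
  apply: has_deriv_eq.
    apply: has_derivD; apply: has_derivM; [|exact: has_deriv_cst| |exact: has_deriv_cst].
      by apply: has_deriv_cos; exact: hd.
    by apply: has_deriv_sin; exact: hd.
  by rewrite /=; ring.
- by apply: fast_integrable; apply: fastD; exact: fast_norm.
- move=> t xi _.
  exact: (norm_osc_le (fun xi => component i xi * b xi) (fun xi => - (component i xi * a xi))).
Qed.

(** Each letter i multiplies a + i b by - i xi_i: the real form of differentiation on the frequency
    side. *)
Definition word_coef (p : (R * R -> R) * (R * R -> R)) (s : seq bool) : (R * R -> R) * (R * R -> R) :=
  foldr (fun i q => (fun xi => component i xi * q.2 xi, fun xi => - (component i xi * q.1 xi))) p s.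

Lemma fast_word_coef p s : fast p.1 -> fast p.2 -> fast (word_coef p s).1 /\ fast (word_coef p s).2.
Proof.
move=> f1 f2; elim: s => [//|i s [IH1 IH2]]; split; first exact: fast_component.
by apply: fastN; exact: fast_component.
Qed.

Lemma word_coef_le p s xi :
  `|(word_coef p s).1 xi| + `|(word_coef p s).2 xi| <= wt xi ^+ size s * (`|p.1 xi| + `|p.2 xi|).
Proof.
elim: s => [|i s IH] /=; first by rewrite mul1r.
rewrite normrN !normrM -mulrDr exprS -mulrA addrC; apply: ler_pM; rewrite ?addr_ge0//.
by have := norm_component_wt i xi; rewrite mul1r expr1.
Qed.

Lemma pderiv_osc p q s : fast p.1 -> fast p.2 -> fast q.1 -> fast q.2 ->
  pderiv s (fun x => (osc p.1 p.2 x, osc q.1 q.2 x)) =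
  (fun x => (osc (word_coef p s).1 (word_coef p s).2 x, osc (word_coef q s).1 (word_coef q s).2 x)).
Proof.
move=> p1 p2 q1 q2; elim: s => [//|i s IH] /=; rewrite IH; apply/funext => x.
have [fp1 fp2] := fast_word_coef s p1 p2; have [fq1 fq2] := fast_word_coef s q1 q2.
by have [_ ->] := is_derive_pair (osc_derive i x fp1 fp2) (osc_derive i x fq1 fq2).
Qed.

Lemma Cn_osc p q n : fast p.1 -> fast p.2 -> fast q.1 -> fast q.2 ->
  Cn n (fun x => (osc p.1 p.2 x, osc q.1 q.2 x)).
Proof.
move=> p1 p2 q1 q2 s; rewrite pderiv_osc//.
have [fp1 fp2] := fast_word_coef s p1 p2; have [fq1 fq2] := fast_word_coef s q1 q2.
split=> [_ i x|_ x].
  by have [] := is_derive_pair (osc_derive i x fp1 fp2) (osc_derive i x fq1 fq2).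
exact: (cvg_pair (@continuous_osc _ _ fp1 fp2 x) (@continuous_osc _ _ fq1 fq2 x)).
Qed.

(** * The truncated operator on oscillatory integrals and its limit *)

Section Kernel.
Variables (al delta : R).
Hypotheses (al01 : 0 < al < 1) (delta_gt0 : 0 < delta).

Definition truncated_symbol (eps : R) xi : R :=
  pint (singular al (in_annulus eps delta) (fun y => 1 - cos (dot xi y))).

Let kernel (eps : R) y : R := singular al (in_annulus eps delta) (fun=> 1) y.

Lemma kernel_ge0 eps y : 0 <= kernel eps y.
Proof. by rewrite !mulr_ge0 ?iverson_ge0 ?ipow_ge0. Qed.

Lemma kernel_integrable eps : 0 < eps -> pintegrable (kernel eps).
Proof.
move=> e0; have p0 : 0 <= 2 + 2 * al.
  by have /andP[a0 _] := al01; rewrite addr_ge0// mulr_ge0// ltW.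
have := @annulus_integrable _ (2 + 2 * al) eps delta (0 : R * R) 0 p0 e0.
by apply: eq_pintegrable.
Qed.

Lemma kernel_bounded_integrable eps f : 0 < eps -> pmeas f -> (forall y, `|f y| <= 1) ->
  pintegrable (fun y => kernel eps y * f y).
Proof. by move=> e0 mf f1; apply: dominated_bounded => //; exact: kernel_integrable. Qed.

Lemma kernel_even eps y : kernel eps (- y) = kernel eps y.
Proof. by rewrite /kernel /singular modulusN. Qed.

Lemma kernel_sin eps xi : 0 < eps -> pint (fun y => kernel eps y * sin (dot xi y)) = 0.
Proof.
move=> e0; apply: pint_odd.
  apply: kernel_bounded_integrable => //; last by move=> y; exact: norm_sin_le1.
  by apply: pmeas_continuous; exact: continuous_sin_dot.
by move=> y; rewrite kernel_even dotNr sinN mulrN.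
Qed.

Lemma truncated_symbolE eps xi :
  truncated_symbol eps xi = pint (fun y => kernel eps y * (1 - cos (dot xi y))).
Proof. by apply: eq_pint => y; rewrite /kernel /singular; ring. Qed.

Lemma kernel_cos_integrable eps xi : 0 < eps ->
  pintegrable (fun y => kernel eps y * (1 - cos (dot xi y))).
Proof.
move=> e0; have i1 := kernel_integrable e0.
have i2 : pintegrable (fun y => kernel eps y * cos (dot xi y)).
  apply: kernel_bounded_integrable => //; last by move=> y; exact: norm_cos_le1.
  by apply: pmeas_continuous; exact: continuous_cos_dot.
have := pintegrableB i1 i2; apply: eq_pintegrable => y; ring.
Qed.

Lemma kernel_sin_integrable eps xi : 0 < eps ->
  pintegrable (fun y => kernel eps y * sin (dot xi y)).
Proof.
move=> e0; apply: kernel_bounded_integrable => //; last by move=> y; exact: norm_sin_le1.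
by apply: pmeas_continuous; exact: continuous_sin_dot.
Qed.

(** After exchanging integrals, the addition formulas split the difference into a multiple of 1 -
    cos (xi . y), which gives the truncated symbol, and a multiple of sin (xi . y), which integrates
    to 0 against the even kernel. *)
Lemma osc_truncated eps a b x : 0 < eps -> fast a -> fast b ->
  pint (singular al (in_annulus eps delta) (fun y => osc a b x - osc a b (x - y))) =
  osc (fun xi => truncated_symbol eps xi * a xi) (fun xi => truncated_symbol eps xi * b xi) x.
Proof.
move=> e0 fa fb.
pose F y xi := kernel eps y * ((cos (dot xi x) * a xi + sin (dot xi x) * b xi) -
  (cos (dot xi (x - y)) * a xi + sin (dot xi (x - y)) * b xi)).
have i1 := osc_integrable x fa fb.
have i2 y := osc_integrable (x - y) fa fb.
rewrite (eq_pint (g := fun y => pint (F y))); last first.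
  move=> y; rewrite [LHS]/singular /osc -pintB// /F pintZ; last exact: pintegrableB.
  by rewrite /kernel /singular; ring.
rewrite (@pint_swap _ F (kernel eps) (fun xi => 2 * (`|a xi| + `|b xi|))).
- apply: eq_pint => xi.
  rewrite (eq_pint (g := fun y => (cos (dot xi x) * a xi + sin (dot xi x) * b xi) *
     (kernel eps y * (1 - cos (dot xi y))) + (cos (dot xi x) * b xi - sin (dot xi x) * a xi) *
     (kernel eps y * sin (dot xi y)))); last first.
    by move=> y; rewrite /F dotBr cosB sinB; ring.
  have k1 := kernel_cos_integrable xi e0; have k2 := kernel_sin_integrable xi e0.
  rewrite pintD; [|exact: pintegrableZ|exact: pintegrableZ].
  by rewrite !pintZ// kernel_sin// -truncated_symbolE; ring.
- have [ma _] := fa; have [mb _] := fb.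
  have md : pmeas2 (fun y xi => dot xi (x - y)).
    rewrite (_ : (fun y => _) = (fun y xi => dot xi x - dot y xi)).
      apply: pmeas2B; last exact: pmeas2_dot.
      apply: pmeas2_snd; rewrite (_ : (fun xi => _) = dot x); last by apply/funext => xi; rewrite dotC.
      by apply: pmeas_continuous; exact: continuous_dot.
    by apply/funext => y; apply/funext => xi; rewrite dotBr (dotC y).
  have mc := continuous_measurable_fun (@continuous_cos R).
  have ms := continuous_measurable_fun (@continuous_sin R).
  apply: pmeas2M; first by apply: pmeas2_fst; exact: (pintegrable_meas (kernel_integrable e0)).
  apply: pmeas2B; first by apply: pmeas2_snd; exact: pmeas_osc.
  apply: pmeas2D; apply: pmeas2M; try exact: pmeas2_snd.
    exact: (pmeas2_comp mc md).
  exact: (pmeas2_comp ms md).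
- exact: kernel_integrable.
- by apply: pintegrableZ; apply: fast_integrable; apply: fastD; exact: fast_norm.
- move=> y xi; rewrite normrM (ger0_norm (kernel_ge0 _ _)) ler_wpM2l ?kernel_ge0//.
  apply: le_trans (ler_normB _ _) _.
  by have := norm_osc_le a b x xi; have := norm_osc_le a b (x - y) xi; lra.
Qed.

(** The bound is uniform in eps, as dominated convergence for eps tending to 0 requires. *)
Lemma norm_truncated_symbol_le eps xi :
  `|truncated_symbol eps xi| <= (pint (ball_sing al delta) / 2) * wt xi ^+ 1.
Proof.
apply: (@le_trans _ _ (modulus xi ^+ 2 / 2 * pint (ball_sing al delta))).
  rewrite -pintZ; last exact: ball_sing_integrable.
  have le := @singular_cos_le R al (in_annulus eps delta) delta xi (@in_annulus_lt _ eps delta).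
  apply: norm_pint_le => //; last by apply: pintegrableZ; exact: ball_sing_integrable.
  apply: pintegrable_dominated (le) => //; last by apply: pintegrableZ; exact: ball_sing_integrable.
  by apply: pmeas_singular; [exact: pmeas_annulus|exact: pmeas_one_sub_cos].
have b0 : 0 <= pint (ball_sing al delta) by apply: pint_ge0 => y; exact: ball_sing_ge0.
rewrite sqr_modulus expr1 [leLHS]mulrC -[leRHS]mulrA; apply: ler_wpM2l => //.
by have := dot_le_wt xi; lra.
Qed.

Lemma pmeas_truncated_symbol eps : 0 < eps -> pmeas (truncated_symbol eps).
Proof.
move=> e0; apply: pmeas_continuous => xi.
rewrite (_ : truncated_symbol eps = (fun xi => pint (fun y => kernel eps y * (1 - cos (dot xi y)))));
  last by apply/funext => z; rewrite truncated_symbolE.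
apply: (@pint_continuous _ _ (fun xi y => kernel eps y * (1 - cos (dot xi y))) xi setT (fun y => 2 * kernel eps y)).
- exact: filterT.
- by move=> z _; exact: (pintegrable_meas (kernel_cos_integrable z e0)).
- move=> y; apply: cvgM; first exact: cvg_cst.
  by apply: cvgB; [exact: cvg_cst|exact: continuous_cos_dotl].
- by apply: pintegrableZ; exact: kernel_integrable.
- move=> z y _; rewrite normrM (ger0_norm (kernel_ge0 _ _)) mulrC ler_wpM2r ?kernel_ge0//.
  apply: le_trans (ler_normB _ _) _; rewrite normr1.
  by have := norm_cos_le1 (dot z y); lra.
Qed.

Lemma truncated_symbol_cvg xi : truncated_symbol eps xi @[eps --> 0^'+] --> symbol al delta xi.
Proof.
apply: (@pint_cvg_within _ _ [set e : R | 0 < e] 0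
   (fun eps => singular al (in_annulus eps delta) (fun y => 1 - cos (dot xi y))) _
   (fun y => modulus xi ^+ 2 / 2 * ball_sing al delta y)).
- by move=> e _; apply: pmeas_singular; [exact: pmeas_annulus|exact: pmeas_one_sub_cos].
- by move=> y; exact: singular_annulus_cvg.
- by apply: pintegrableZ; exact: ball_sing_integrable.
- by move=> e y _; apply: singular_cos_le => // s; exact: in_annulus_lt.
Qed.

(** The principal value is computed in the frequency variable, where the truncated symbols are
    dominated by a fixed multiple of [wt]. *)
Lemma osc_kernel_cvg a b x : fast a -> fast b ->
  pint (singular al (in_annulus eps delta) (fun y => osc a b x - osc a b (x - y))) @[eps --> 0^'+] -->
  osc (fun xi => symbol al delta xi * a xi) (fun xi => symbol al delta xi * b xi) x.
Proof.
move=> fa fb.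
have H : osc (fun xi => truncated_symbol eps xi * a xi) (fun xi => truncated_symbol eps xi * b xi) x
    @[eps --> 0^'+] --> osc (fun xi => symbol al delta xi * a xi) (fun xi => symbol al delta xi * b xi) x.
  have [ma _] := fa; have [mb _] := fb.
  pose K := pint (ball_sing al delta) / 2.
  apply: (@pint_cvg_within _ _ [set e : R | 0 < e] 0
    (fun eps xi => cos (dot xi x) * (truncated_symbol eps xi * a xi) + sin (dot xi x) * (truncated_symbol eps xi * b xi)) _
    (fun xi => K * wt xi * (`|a xi| + `|b xi|))).
  - by move=> e e0; apply: pmeas_osc; apply: pmeasM => //; exact: pmeas_truncated_symbol.
  - move=> xi; apply: cvgD; apply: cvgM; try exact: cvg_cst;
      apply: cvgM; try exact: cvg_cst; exact: truncated_symbol_cvg.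
  - apply: fast_integrable.
    apply: (@fast_mul (fun xi => `|a xi| + `|b xi|) (fun xi => K * wt xi) `|K| 1).
    + by apply: fastD; exact: fast_norm.
    + apply: pmeasM; first exact: pmeas_cst.
      by apply: pmeas_continuous; exact: continuous_wt.
    + by move=> xi; rewrite normrM expr1 (gtr0_norm (wt_gt0 _)).
  - move=> e xi _; apply: (le_trans (norm_osc_le (fun xi => truncated_symbol e xi * a xi)
      (fun xi => truncated_symbol e xi * b xi) x xi)).
    rewrite !normrM -mulrDr ler_wpM2r ?addr_ge0//.
    by have := norm_truncated_symbol_le e xi; rewrite expr1.
apply: cvg_trans H; apply: near_eq_cvg; near=> e.
by rewrite osc_truncated//; near: e; exact: nbhs_right_gt.
Unshelve. all: by end_near. Qed.

End Kernel.

End Fast.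

(** * Existence *)

Section TimeDerivative.
Variable R : realType.

(** The half-line accumulates at t; a proper filter is what makes limits of difference quotients
    unique. *)
Lemma time_filter_proper (t : R) : 0 <= t ->
  ProperFilter (within [set s : R | 0 <= s] t^').
Proof.
move=> t0; apply: Build_ProperFilter => /nbhs_ballP[e /= e0 H].
apply: (H (t + e / 2)).
- by rewrite /ball /= opprD addrA subrr add0r normrN gtr0_norm ?divr_gt0//; lra.
- by rewrite /= gt_eqF// ltrDl divr_gt0.
- by rewrite /= addr_ge0// divr_ge0// ltW.
Qed.

(** The explicit solution is defined for all real times, so its derivatives are computed there and
    then restricted to the half-line. *)
Lemma quotient_within (g h : R -> R) (t d : R) : 0 <= t -> (forall s, 0 <= s -> g s = h s) ->
  is_derive t 1 h d -> (s - t)^-1 * (g s - g t) @[s --> within [set s : R | 0 <= s] t^'] --> d.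
Proof.
move=> t0 gh /is_derive_cvgP /cvgrPdist_lt hd; apply/cvgrPdist_lt => e e0.
have := hd e e0; rewrite /within /dnbhs /= => /nbhs_ballP[r /= r0 H].
apply/nbhs_ballP; exists r => //= s ts st s0.
rewrite (gh s s0) (gh t t0).
have := H (s - t); rewrite (addrC t) subrK; apply; last by rewrite subr_eq0.
by move: ts; rewrite /ball /= sub0r opprB.
Qed.

Lemma time_quotient_cvg (g : R -> R * R) (h1 h2 : R -> R) (t d1 d2 : R) : 0 <= t ->
  (forall s, 0 <= s -> g s = (h1 s, h2 s)) -> is_derive t 1 h1 d1 -> is_derive t 1 h2 d2 ->
  time_quotient g t s @[s --> within [set s : R | 0 <= s] t^'] --> (d1, d2).
Proof.
move=> t0 gh H1 H2; have := time_filter_proper t0 => F.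
have Q1 := @quotient_within (fun s => (g s).1) h1 t d1 t0 (fun s s0 => congr1 fst (gh s s0)) H1.
have Q2 := @quotient_within (fun s => (g s).2) h2 t d2 t0 (fun s s0 => congr1 snd (gh s s0)) H2.
exact: (cvg_pair Q1 Q2).
Qed.

Lemma time_derivable_pair (g : R -> R * R) (h1 h2 : R -> R) (t d1 d2 : R) : 0 <= t ->
  (forall s, 0 <= s -> g s = (h1 s, h2 s)) -> is_derive t 1 h1 d1 -> is_derive t 1 h2 d2 ->
  time_derivable g t /\ time_deriv g t = (d1, d2).
Proof.
move=> t0 gh H1 H2; have Q := time_quotient_cvg t0 gh H1 H2.
have F := time_filter_proper t0.
split; first by apply/cvg_ex; exists (d1, d2).
by rewrite /time_deriv; apply: (@cvg_lim ((R * R)%type : normedModType R)); [exact: norm_hausdorff|exact: Q].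
Qed.

End TimeDerivative.

(** * Positivity of the symbol away from 0 *)

Section Dispersion.
Variable R : realType.
Implicit Types (x y v xi : R * R).

Lemma norm_sin_le (u : R) : `|sin u| <= `|u|.
Proof.
have := @derivative_bound _ (@sin R) (@cos R) 1 0 u (fun t => is_derive_sin t).
by rewrite sin0 !subr0 mul1r; apply => s; exact: norm_cos_le1.
Qed.

Lemma half_le_sin (u : R) : 0 <= u <= 1 -> u / 2 <= sin u.
Proof.
move=> /andP[u0 u1].
have D (t : R) : is_derive t 1 (fun s => sin s - s) (cos t - 1).
  exact: (has_derivB (is_derive_sin t) (has_deriv_id t)).
have := @derivative_bound_within _ (fun s => sin s - s) (fun t => cos t - 1) (2^-1) 0 u u0
  (fun t _ => D t) (continuous_subspaceT (fun t => is_derive_continuous (D t))).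
rewrite sin0 !subr0 => H.
have : `|sin u - u| <= 2^-1 * u.
  apply: H => t /andP[t0 tu]; rewrite distrC.
  have /andP[h1 h2] := one_sub_cos_le t; rewrite ger0_norm//; apply: (le_trans h2).
  have t1 : t <= 1 by apply: le_trans u1; exact: ltW.
  by rewrite ler_piMl// expr_le1// ltW.
by rewrite ler_norml => /andP[h _]; lra.
Qed.

Lemma one_sub_cos_ge (s : R) : `|s| <= 1 -> s ^+ 2 / 8 <= 1 - cos s.
Proof.
move=> s1; rewrite -real_normK ?num_real//.
have -> : cos s = cos `|s| by case: (ger0P s) => // _; rewrite cosN.
move: (normr_ge0 s) s1; move: `|s| => u u0 u1.
have -> : cos u = cos ((u / 2) *+ 2) by congr cos; rewrite -mulr_natr; field.
rewrite cos_mulr2n cos2sin2.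
have h : u / 2 / 2 <= sin (u / 2) by apply: half_le_sin; apply/andP; split; lra.
have h2 : (u / 2 / 2) ^+ 2 <= sin (u / 2) ^+ 2.
  by rewrite lerXn2r ?nnegrE// ?(le_trans _ h)// !divr_ge0.
rewrite -[_ *+ 2]mulr_natl.
have : (u / 2 / 2) ^+ 2 = u ^+ 2 / 16 by field.
lra.
Qed.

(** On a small disc 1 - cos is bounded below by a square, whose disc moment is explicit and
    positive. Consequently [omega] vanishes at frequency 0 only. *)
Lemma symbol_gt0 (al delta : R) xi : 0 < al < 1 -> 0 < delta -> xi != 0 -> 0 < symbol al delta xi.
Proof.
move=> al01 d0 xi0; have m0 : 0 < modulus xi by rewrite modulus_gt0.
(* Small enough for the disc to lie within the horizon and for |xi . y| <= 1 on it. *)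
pose r := Num.min delta (modulus xi)^-1.
have r0 : 0 < r by rewrite lt_min d0 invr_gt0.
have rd : r <= delta by rewrite ge_min lexx.
have rm : r * modulus xi <= 1.
  by rewrite -ler_pdivlMr// mul1r ge_min lexx orbT.
have p0 : 0 <= 2 + 2 * al by have /andP[a0 _] := al01; rewrite addr_ge0// mulr_ge0// ltW.
apply: (@lt_le_trans _ _ (ipow (2 + 2 * al) r / 8 * disc_moment xi 1 r)).
  rewrite mulr_gt0//; first by rewrite divr_gt0// /ipow invr_gt0 powR_gt0.
  rewrite disc_moment_scale// disc_moment1 mulr_gt0 ?exprn_gt0//.
  have xx : 0 < dot xi xi by rewrite -sqr_modulus exprn_gt0.
  by rewrite mulr_gt0 ?exprn_gt0// mulr_gt0 ?pi_gt0// divr_gt0 ?mulr_gt0// ?ltr0n ?fact_gt0// exprn_gt0.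
rewrite -pintZ; last exact: disc_moment_integrable.
apply: le_pint; first by apply: pintegrableZ; exact: disc_moment_integrable.
  exact: singular_cos_integrable.
move=> y; rewrite /singular /in_disc.
have /andP[c0 _] := one_sub_cos_le (dot xi y).
have [h|h] := ltP (modulus y) r; last first.
  by rewrite iverson_false mul0r mulr0 !mulr_ge0 ?iverson_ge0 ?ipow_ge0.
rewrite (lt_le_trans h rd) iverson_true !mul1r.
have [->|y0] := eqVneq y 0.
  rewrite modulus0 ipow0 ?mul0r; last by rewrite gt_eqF// (lt_le_trans (ltr0Sn _ 1))// lerDl mulr_ge0// ltW//; case/andP: al01.
  by rewrite /dot /= !mulr0 addr0 expr0n mulr0.
rewrite -modulus_gt0 in y0.
rewrite -mulrA; apply: ler_pM; rewrite ?ipow_ge0//.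
- by rewrite mulr_ge0 ?invr_ge0 ?dot_even_ge0.
- by rewrite /ipow lef_pV2 ?posrE ?powR_gt0// ge0_ler_powR// ?nnegrE// ltW.
- rewrite mulrC; apply: one_sub_cos_ge; apply: le_trans (norm_dot_modulus _ _) _.
  by apply: le_trans rm; rewrite mulrC ler_wpM2r ?modulus_ge0// ltW.
Qed.

(** The difference lives at the origin, so a fixed multiple of the area of any disc around it bounds
    the integral. This reconciles [sinc] with the quotient by [omega], which differ at frequency
    0. *)
Lemma eq_pint_off0 (f g : R * R -> R) : pintegrable f -> pintegrable g ->
  (forall xi, xi != 0 -> f xi = g xi) -> pint f = pint g.
Proof.
move=> i1 i2 fg; apply/eqP; rewrite -subr_eq0 -normr_le0 -pintB//.
pose M := `|f 0 - g 0|; pose C := disc_moment (0 : R * R) 0 1.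
have H (n : nat) : `|pint (fun x => f x - g x)| <= M * (n.+1%:R^-1 ^+ 2 * C).
  have n0 : 0 < n.+1%:R^-1 :> R by rewrite invr_gt0.
  rewrite -(disc_moment_scale _ 0 n0) -pintZ; last exact: disc_moment_integrable.
  apply: norm_pint_le; first exact: pintegrableB.
    by apply: pintegrableZ; exact: disc_moment_integrable.
  move=> x; rewrite muln0 expr0 mulr1; have [->|x0] := eqVneq x 0.
    by rewrite modulus0 n0 iverson_true mulr1.
  by rewrite fg// subrr normr0; apply: mulr_ge0; [exact: normr_ge0|exact: iverson_ge0].
have L : M * (n.+1%:R^-1 ^+ 2 * C) @[n --> \oo] --> (0 : R).
  rewrite -(mulr0 M); apply: cvgM; first exact: cvg_cst.
  rewrite -(mul0r C); apply: cvgM; last exact: cvg_cst.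
  rewrite -(expr0n _ 2 : 0 ^+ _ = 0).
  have sinv : (n.+1%:R^-1 : R) @[n --> \oo] --> (0 : R) by exact: cvg_harmonic.
  exact: (cvg_comp _ _ sinv (@exprn_continuous R 2 0)).
rewrite -(cvg_lim _ L)//; apply: limr_ge; first by apply/cvg_ex; eexists; exact: L.
exact: nearW.
Qed.

End Dispersion.

(** * Harmonic oscillators in the frequency variable *)

Section Wave.
Variable R : realType.
Implicit Types (x y v xi : R * R).
Variable w : R * R -> R.
Hypotheses (w_ge0 : forall xi, 0 <= w xi) (cw : continuous w).
Variable K : R.
Hypothesis w_le : forall xi, w xi ^+ 2 <= K * wt xi.

(* sin (w t) / w, extended by its limit t at w = 0. *)
Definition sinc (t : R) xi : R := sin (w xi * t) / w xi + t * iverson (w xi <= 0).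

Definition wave (f g : R * R -> R) (t : R) xi : R := cos (w xi * t) * f xi + sinc t xi * g xi.

Lemma sincE t xi : w xi != 0 -> sinc t xi = sin (w xi * t) / w xi.
Proof.
move=> w0; rewrite /sinc leNgt lt_neqAle eq_sym w0 w_ge0 /= iverson_false.
by rewrite mulr0 addr0.
Qed.

Lemma sinc_zero t xi : w xi = 0 -> sinc t xi = t.
Proof. by move=> w0; rewrite /sinc w0 lexx mul0r sin0 mul0r add0r mulr1. Qed.

Lemma norm_sinc_le t xi : `|sinc t xi| <= `|t|.
Proof.
have [w0|w0] := eqVneq (w xi) 0; first by rewrite sinc_zero.
rewrite sincE// normrM normfV ler_pdivrMr ?normr_gt0//.
by rewrite mulrC -normrM norm_sin_le.
Qed.

Lemma pmeas_sinc t : pmeas (sinc t).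
Proof.
have mw : pmeas w by exact: pmeas_continuous.
apply: pmeasD; last first.
  apply: pmeasM; first exact: pmeas_cst.
  exact: (pmeas_comp (measurable_cst_le 0) mw).
(* The denominators w + 1 / (n + 1) are positive, so the approximations are continuous; where w = 0
   they vanish with the sine, as the quotient does. *)
apply: (@pmeas_cvg _ (fun n xi => sin (w xi * t) / (w xi + n.+1%:R^-1))).
  move=> n; apply: pmeas_continuous; apply: continuous_planeM.
    apply: (continuous_plane_comp (@continuous_sin R)).
    by apply: continuous_planeM => //; exact: continuous_plane_cst.
  move=> xi; apply: cvgV; last by apply: continuous_planeD => //; exact: continuous_plane_cst.
  by rewrite gt_eqF// (lt_le_trans (_ : 0 < n.+1%:R^-1))// ?invr_gt0// lerDr.
move=> xi; have [w0|w0] := eqVneq (w xi) 0.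
  by apply: cvg_near_cst; apply: nearW => n; rewrite w0 mul0r sin0 !mul0r.
apply: cvgM; first exact: cvg_cst.
apply: cvgV => //; rewrite -[X in _ --> X]addr0; apply: cvgD; first exact: cvg_cst.
exact: cvg_harmonic.
Qed.

Lemma continuous_cos_w t : continuous (fun xi => cos (w xi * t)).
Proof.
apply: (continuous_plane_comp (@continuous_cos R)).
by apply: continuous_planeM => //; exact: continuous_plane_cst.
Qed.

Lemma norm_wave_le f g t xi : `|wave f g t xi| <= `|f xi| + `|t| * `|g xi|.
Proof.
apply: le_trans (ler_normD _ _) _; rewrite !normrM lerD//.
  by rewrite ler_piMl// norm_cos_le1.
by rewrite ler_wpM2r// norm_sinc_le.
Qed.

Lemma fast_wave f g t : fast f -> fast g -> fast (wave f g t).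
Proof.
move=> ff fg; apply: fastD.
  apply: (@fast_mul _ _ (fun xi => cos (w xi * t)) 1 0) => //.
    by apply: pmeas_continuous; exact: continuous_cos_w.
  by move=> xi; rewrite mulr1 norm_cos_le1.
apply: (@fast_mul _ _ (sinc t) `|t| 0) => //; first exact: pmeas_sinc.
by move=> xi; rewrite mulr1 norm_sinc_le.
Qed.

Definition neg_sqr (f : R * R -> R) xi : R := - (w xi ^+ 2) * f xi.

Lemma fast_neg_sqr f : fast f -> fast (neg_sqr f).
Proof.
move=> ff; apply: (@fast_mul _ _ (fun xi => - (w xi ^+ 2)) K 1) => //.
  by apply: pmeas_continuous; apply: continuous_planeN; exact: continuous_planeX.
by move=> xi; rewrite normrN ger0_norm ?sqr_ge0// expr1.
Qed.

(** The derivative is again a [wave], so the same rule yields the second derivative. *)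
Lemma wave_derive f g (t : R) xi :
  is_derive t 1 (fun s => wave f g s xi) (wave g (neg_sqr f) t xi).
Proof.
rewrite /wave /neg_sqr; have [w0|w0] := eqVneq (w xi) 0.
  rewrite (_ : (fun s => _) = (fun s => f xi + s * g xi)); last first.
    by apply/funext => s; rewrite sinc_zero// w0 mul0r cos0 mul1r.
  rewrite sinc_zero// w0 mul0r cos0 expr0n oppr0 !mul0r mulr0 mul1r addr0.
  by apply: has_deriv_eq; [derive_rules|rewrite /= mulr0 !add0r mulr1].
rewrite (_ : (fun s => _) = (fun s => cos (w xi * s) * f xi + sin (w xi * s) * (g xi / w xi))); last first.
  by apply/funext => s; rewrite sincE// mulrAC mulrA.
rewrite sincE//; apply: has_deriv_eq; first by derive_rules.
by rewrite /=; move: (cos _) (sin _) => c s; field.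
Qed.

Lemma osc_wave_derive f g f' g' x (t : R) : fast f -> fast g -> fast f' -> fast g' ->
  is_derive t 1 (fun s => osc (wave f g s) (wave f' g' s) x)
    (osc (wave g (neg_sqr f) t) (wave g' (neg_sqr f') t) x).
Proof.
move=> ff fg ff' fg'; have fnf := fast_neg_sqr ff; have fnf' := fast_neg_sqr ff'.
(* For |s - t| < 1 one has |s| <= |t| + 1, which frees the bound of [norm_wave_le] from s. *)
pose G (f g : R * R -> R) xi : R := `|g xi| + (`|t| + 1) * `|neg_sqr f xi|.
have fG a b : fast a -> fast b -> fast (G a b).
  move=> fa fb; apply: fastD; first exact: fast_norm.
  apply: (@fast_mul _ _ (fun=> `|t| + 1) (`|t| + 1) 0).
  - by apply: fast_norm; exact: fast_neg_sqr.
  - exact: pmeas_cst.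
  - by move=> xi; rewrite mulr1 ger0_norm// addr_ge0.
apply: (@is_derive_pint _ (fun s xi => cos (dot xi x) * wave f g s xi + sin (dot xi x) * wave f' g' s xi)
  (fun s xi => cos (dot xi x) * wave g (neg_sqr f) s xi + sin (dot xi x) * wave g' (neg_sqr f') s xi)
  (fun xi => G f g xi + G f' g' xi) t 1 ltr01).
- by move=> s _; apply: osc_integrable; exact: fast_wave.
- move=> s xi _; apply: has_deriv_eq.
    apply: has_derivD; apply: has_derivM; [exact: has_deriv_cst|exact: wave_derive
      |exact: has_deriv_cst|exact: wave_derive].
  by rewrite /= !mulr0 !addr0.
- by apply: fast_integrable; apply: fastD; exact: fG.
- move=> s xi st; apply: (le_trans (norm_osc_le (wave g (neg_sqr f) s) (wave g' (neg_sqr f') s) x xi)).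
  have s1 : `|s| <= `|t| + 1.
    by have := ler_normD (s - t) t; rewrite subrK => /le_trans; apply; lra.
  by apply: lerD; apply: le_trans (norm_wave_le _ _ _ _) _; rewrite lerD2l ler_wpM2r.
Qed.

Lemma wave_neg_sqr f g t xi : wave (neg_sqr f) (neg_sqr g) t xi = - (w xi ^+ 2) * wave f g t xi.
Proof. by rewrite /wave /neg_sqr; ring. Qed.

End Wave.

(** * The explicit solution and the complex formula *)

Section Existence.
Variable R : realType.
Implicit Types (x y xi : R * R).
Variables (kappa rho delta alpha : R) (v0 v1 : R * R -> R * R).
Hypotheses (kappa_gt0 : 0 < kappa) (rho_gt0 : 0 < rho) (delta_gt0 : 0 < delta).
Hypothesis alpha01 : 0 < alpha < 1.
Hypotheses (schwartz_v0 : schwartz v0) (schwartz_v1 : schwartz v1).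

Let w xi : R := omega kappa rho delta alpha (modulus xi).

Let wE xi : w xi = Num.sqrt (2 * kappa / rho * symbol alpha delta xi).
Proof. exact: omega_symbol. Qed.

Let w_ge0 xi : 0 <= w xi. Proof. exact: sqrtr_ge0. Qed.

Let c0 : 0 < 2 * kappa / rho. Proof. by rewrite divr_gt0// mulr_gt0. Qed.

Let w_sqr xi : w xi ^+ 2 = 2 * kappa / rho * symbol alpha delta xi.
Proof. by rewrite wE sqr_sqrtr// mulr_ge0 ?(ltW c0)// symbol_ge0. Qed.

Let continuous_w : continuous w.
Proof.
rewrite (_ : w = (fun xi => Num.sqrt (2 * kappa / rho * symbol alpha delta xi))); last first.
  by apply/funext => xi; exact: wE.
apply: (continuous_plane_comp (@sqrt_continuous R)).
by apply: continuous_planeM; [exact: continuous_plane_cst|exact: continuous_symbol].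
Qed.

Let Kw : R := 2 * kappa / rho * (pint (ball_sing alpha delta) / 2).

Let w_le xi : w xi ^+ 2 <= Kw * wt xi.
Proof.
rewrite w_sqr /Kw -!mulrA ler_wpM2l// ler_wpM2l ?(ltW kappa_gt0)// ler_wpM2l ?invr_ge0 ?(ltW rho_gt0)//.
have b0 : 0 <= pint (ball_sing alpha delta) by apply: pint_ge0 => y; exact: ball_sing_ge0.
apply: le_trans (symbol_le alpha01 _ delta_gt0) _.
rewrite sqr_modulus [leLHS]mulrC; apply: ler_wpM2l => //.
by have := dot_le_wt xi; lra.
Qed.

Let w_eq0 xi : (w xi == 0) = (xi == 0).
Proof.
apply/idP/idP => [|/eqP ->].
  by apply: contraLR => x0; rewrite gt_eqF// wE sqrtr_gt0 mulr_gt0// symbol_gt0.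
rewrite -sqrf_eq0 w_sqr; suff -> : symbol alpha delta 0 = 0 by rewrite mulr0.
rewrite -pint0; apply: eq_pint => y; rewrite /singular.
by rewrite /dot /= !mul0r addr0 cos0 subrr !mulr0.
Qed.

Definition fourier_cos (v : R * R -> R * R) c xi : R :=
  (2 * pi) ^- 2 * cos_transform (fun s x => component c (pderiv s v x)) [::] xi.
Definition fourier_sin (v : R * R -> R * R) c xi : R :=
  (2 * pi) ^- 2 * sin_transform (fun s x => component c (pderiv s v x)) [::] xi.

Lemma fast_fourier_cos v c : schwartz v -> fast (fourier_cos v c).
Proof.
move=> sv; have r := schwartz_rapid c sv.
apply: (@fast_mul _ _ (fun=> (2 * pi) ^- 2) `|(2 * pi) ^- 2| 0).
- split; first by apply: pmeas_continuous; exact: continuous_cos_transform.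
  by move=> n; exact: cos_transform_decay.
- exact: pmeas_cst.
- by move=> xi; rewrite mulr1.
Qed.

Lemma fast_fourier_sin v c : schwartz v -> fast (fourier_sin v c).
Proof.
move=> sv; have r := schwartz_rapid c sv.
apply: (@fast_mul _ _ (fun=> (2 * pi) ^- 2) `|(2 * pi) ^- 2| 0).
- split; first by apply: pmeas_continuous; exact: continuous_sin_transform.
  by move=> n; exact: sin_transform_decay.
- exact: pmeas_cst.
- by move=> xi; rewrite mulr1.
Qed.

Lemma osc_fourier v c x : schwartz v -> osc (fourier_cos v c) (fourier_sin v c) x = component c (v x).
Proof.
move=> sv; have r := schwartz_rapid c sv.
have p0 : (2 * pi : R) ^+ 2 != 0 by rewrite expf_neq0// mulf_neq0// gt_eqF// pi_gt0.
have := transform_inversion r x; rewrite /= => E.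
apply: (mulfI p0); rewrite -E -pintZ; last by apply: osc_integrable; [exact: fast_fourier_cos|exact: fast_fourier_sin].
apply: eq_pint => xi; rewrite /fourier_cos /fourier_sin.
move: (cos_transform _ _ _) (sin_transform _ _ _) (cos _) (sin _) ((2 * pi) ^+ 2) p0 => a b d e q q0.
by field.
Qed.

Definition wave_comp c (t : R) x : R :=
  osc (wave w (fourier_cos v0 c) (fourier_cos v1 c) t) (wave w (fourier_sin v0 c) (fourier_sin v1 c) t) x.

Definition wave_comp_t c (t : R) x : R :=
  osc (wave w (fourier_cos v1 c) (neg_sqr w (fourier_cos v0 c)) t)
      (wave w (fourier_sin v1 c) (neg_sqr w (fourier_sin v0 c)) t) x.

Definition wave_comp_tt c (t : R) x : R :=
  osc (wave w (neg_sqr w (fourier_cos v0 c)) (neg_sqr w (fourier_cos v1 c)) t)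
      (wave w (neg_sqr w (fourier_sin v0 c)) (neg_sqr w (fourier_sin v1 c)) t) x.

Definition wave_solution (t : R) x : R * R := (wave_comp false t x, wave_comp true t x).

Let fc0 c := fast_fourier_cos c schwartz_v0.
Let fs0 c := fast_fourier_sin c schwartz_v0.
Let fc1 c := fast_fourier_cos c schwartz_v1.
Let fs1 c := fast_fourier_sin c schwartz_v1.
Let fn f := fast_neg_sqr continuous_w w_le (f := f).
Let fw f g t := fast_wave w_ge0 continuous_w t (f := f) (g := g).

Lemma wave_comp_derive c (t : R) x : is_derive t 1 (fun s => wave_comp c s x) (wave_comp_t c t x).
Proof. by apply: (osc_wave_derive w_ge0 continuous_w w_le). Qed.

Lemma wave_comp_t_derive c (t : R) x : is_derive t 1 (fun s => wave_comp_t c s x) (wave_comp_tt c t x).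
Proof.
by apply: (osc_wave_derive w_ge0 continuous_w w_le) => //; exact: fn.
Qed.

Lemma time_deriv_wave t x : 0 <= t -> time_derivable (wave_solution ^~ x) t /\
  time_deriv (wave_solution ^~ x) t = (wave_comp_t false t x, wave_comp_t true t x).
Proof.
move=> t0; apply: (@time_derivable_pair _ _ (wave_comp false ^~ x) (wave_comp true ^~ x)) => //;
  exact: wave_comp_derive.
Qed.

Lemma time_deriv2_wave t x : 0 < t -> time_derivable (time_deriv (wave_solution ^~ x)) t /\
  time_deriv (time_deriv (wave_solution ^~ x)) t = (wave_comp_tt false t x, wave_comp_tt true t x).
Proof.
move=> t0; apply: (@time_derivable_pair _ _ (wave_comp_t false ^~ x) (wave_comp_t true ^~ x)).
- exact: ltW.
- by move=> s s0; have [_] := time_deriv_wave x s0.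
- exact: wave_comp_t_derive.
- exact: wave_comp_t_derive.
Qed.

(** Since - 2 kappa times the symbol is - rho omega ^ 2, the limit is rho times the second time
    derivative. *)
Lemma K_truncated_wave c t x :
  - 2 * kappa * pint (singular alpha (in_annulus eps delta)
     (fun y => wave_comp c t x - wave_comp c t (x - y))) @[eps --> 0^'+] --> rho * wave_comp_tt c t x.
Proof.
have f1 := fw t (fc0 c) (fc1 c); have f2 := fw t (fs0 c) (fs1 c).
have H := @osc_kernel_cvg _ _ _ alpha01 delta_gt0 _ _ x f1 f2.
have -> : rho * wave_comp_tt c t x = - 2 * kappa *
    osc (fun xi => symbol alpha delta xi * wave w (fourier_cos v0 c) (fourier_cos v1 c) t xi)
        (fun xi => symbol alpha delta xi * wave w (fourier_sin v0 c) (fourier_sin v1 c) t xi) x.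
  have fsy f : fast f -> fast (fun xi => symbol alpha delta xi * f xi).
    move=> ff; apply: (@fast_mul _ _ _ (pint (ball_sing alpha delta) / 2) 1) => //.
      by apply: pmeas_continuous; exact: continuous_symbol.
    move=> xi; rewrite ger0_norm ?symbol_ge0// expr1.
    apply: le_trans (symbol_le alpha01 _ delta_gt0) _.
    have b0 : 0 <= pint (ball_sing alpha delta) by apply: pint_ge0 => y; exact: ball_sing_ge0.
    rewrite sqr_modulus [leLHS]mulrC -[leRHS]mulrA; apply: ler_wpM2l => //.
    by have := dot_le_wt xi; lra.
  rewrite /wave_comp_tt /osc -!pintZ; [|by apply: osc_integrable; exact: fsy
    |by apply: osc_integrable; apply: fw; exact: fn].
  apply: eq_pint => xi; rewrite !wave_neg_sqr w_sqr.
  by field; rewrite gt_eqF.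
by apply: cvgM; [exact: cvg_cst|exact: H].
Qed.

Lemma K_truncatedE (f : R * R -> R * R) x eps : K_truncated kappa delta alpha f x eps =
  (- 2 * kappa * pint (singular alpha (in_annulus eps delta) (fun y => (f x).1 - (f (x - y)).1)),
   - 2 * kappa * pint (singular alpha (in_annulus eps delta) (fun y => (f x).2 - (f (x - y)).2))).
Proof.
have E (g : R * R -> R) : \int[(@lebesgue_measure R \x @lebesgue_measure R)%E]_(y in [set y | eps <= modulus y < delta])
    ((modulus y `^ (2 + 2 * alpha))^-1 * g y) = pint (singular alpha (in_annulus eps delta) g).
  rewrite Rintegral_mkcond; apply: eq_Rintegral => y _; rewrite patchE /singular /in_annulus.
  have [] := boolP (y \in [set y | eps <= modulus y < delta]%classic).
    by rewrite inE /= => ->; rewrite iverson_true mul1r.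
  by rewrite notin_setE /= => /negP/negbTE ->; rewrite mul0r.
by rewrite /K_truncated /vintegral -!E.
Qed.

Lemma K_wave t x : 
  K_truncated kappa delta alpha (wave_solution t) x eps @[eps --> 0^'+] -->
  (rho * wave_comp_tt false t x, rho * wave_comp_tt true t x).
Proof.
rewrite (_ : (fun eps => _) = (fun eps =>
  (- 2 * kappa * pint (singular alpha (in_annulus eps delta) (fun y => wave_comp false t x - wave_comp false t (x - y))),
   - 2 * kappa * pint (singular alpha (in_annulus eps delta) (fun y => wave_comp true t x - wave_comp true t (x - y)))))); last first.
  by apply/funext => eps; rewrite K_truncatedE.
exact: (cvg_pair (@K_truncated_wave false t x) (@K_truncated_wave true t x)).
Qed.

Lemma wave_growth : slowly_increasing wave_solution.
Proof.
move=> T.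
pose g c xi := (`|fourier_cos v0 c xi| + `|T| * `|fourier_cos v1 c xi|) +
  (`|fourier_sin v0 c xi| + `|T| * `|fourier_sin v1 c xi|).
pose M c := pint (fun xi => wt xi ^+ 2 * g c xi).
have fg c : fast (fun xi => wt xi ^+ 2 * g c xi).
  have fT f : fast f -> fast (fun xi => `|T| * `|f xi|).
    move=> ff; apply: (@fast_mul _ _ (fun=> `|T|) `|T| 0).
    - exact: fast_norm.
    - exact: pmeas_cst.
    - by move=> xi; rewrite mulr1 normr_id.
  apply: (@fast_mul _ _ (fun xi => wt xi ^+ 2) 1 2).
  - by apply: fastD; apply: fastD; do ?[exact: fT|exact: fast_norm].
  - by apply: pmeas_continuous; apply: continuous_planeX; exact: continuous_wt.
  - by move=> xi; rewrite mul1r ger0_norm// wtX_ge0.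
(* Exponent 0: on [0, T] the derivatives up to order two are bounded. The factor wt ^ 2 in [M] pays
   for two differentiations. *)
exists (M false + M true), 0%N => t x s /andP[t0 tT] s2.
rewrite expr0 mulr1.
have q1 c := fw t (fc0 c) (fc1 c); have q2 c := fw t (fs0 c) (fs1 c).
rewrite [pderiv s _](@pderiv_osc _
  (wave w (fourier_cos v0 false) (fourier_cos v1 false) t, wave w (fourier_sin v0 false) (fourier_sin v1 false) t)
  (wave w (fourier_cos v0 true) (fourier_cos v1 true) t, wave w (fourier_sin v0 true) (fourier_sin v1 true) t) s
  (q1 false) (q2 false) (q1 true) (q2 true)).
have B c : `|osc (word_coef (wave w (fourier_cos v0 c) (fourier_cos v1 c) t, wave w (fourier_sin v0 c) (fourier_sin v1 c) t) s).1
    (word_coef (wave w (fourier_cos v0 c) (fourier_cos v1 c) t, wave w (fourier_sin v0 c) (fourier_sin v1 c) t) s).2 x| <= M c.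
  set p := (wave _ _ _ _, _); have [p1 p2] := @fast_word_coef _ p s (q1 c) (q2 c).
  apply: norm_pint_le; [exact: osc_integrable|exact: fast_integrable|].
  move=> xi; apply: le_trans (norm_osc_le _ _ _ _) _; apply: le_trans (word_coef_le _ _ _) _.
  apply: ler_pM; rewrite ?wtX_ge0 ?addr_ge0//.
    by rewrite ler_weXn2l ?wt_ge1.
  have tT' : `|t| <= `|T| by rewrite !ger0_norm// (le_trans t0).
  by apply: lerD; apply: le_trans (norm_wave_le _ _ _ _ _) _ => //; rewrite lerD2l ler_wpM2r.
apply: le_trans (modulus_le_norms _) _.
exact: (lerD (B false) (B true)).
Qed.

Lemma wave_peridynamic : peridynamic_solution kappa rho delta alpha v0 v1 wave_solution.
Proof.
have K_lim t x : K kappa delta alpha (wave_solution t) x = (rho * wave_comp_tt false t x, rho * wave_comp_tt true t x).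
  rewrite /K; apply: (@cvg_lim ((R * R)%type : normedModType R)); [exact: norm_hausdorff|exact: K_wave].
split.
- move=> t t0; apply: (@Cn_osc _
    (wave w (fourier_cos v0 false) (fourier_cos v1 false) t, wave w (fourier_sin v0 false) (fourier_sin v1 false) t)
    (wave w (fourier_cos v0 true) (fourier_cos v1 true) t, wave w (fourier_sin v0 true) (fourier_sin v1 true) t)); exact: fw.
- exact: wave_growth.
- by move=> t x t0; have [] := time_deriv_wave x t0.
- by move=> t x t0; have [] := time_deriv2_wave x t0.
- by move=> t x t0; apply/cvg_ex; eexists; exact: K_wave.
- by move=> t x t0; rewrite K_lim; have [_ ->] := time_deriv2_wave x t0.
- move=> x; have E c : wave_comp c 0 x = component c (v0 x).
    rewrite -(osc_fourier c x schwartz_v0); apply: eq_pint => xi.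
    by rewrite /wave /sinc mulr0 cos0 sin0 !mul0r addr0 !mul0r !addr0 !mul1r.
  by rewrite /wave_solution !E; case: (v0 x).
- move=> x; have [_ ->] := time_deriv_wave x (lexx 0).
  have E c : wave_comp_t c 0 x = component c (v1 x).
    rewrite -(osc_fourier c x schwartz_v1); apply: eq_pint => xi.
    by rewrite /wave /sinc mulr0 cos0 sin0 !mul0r addr0 !mul0r !addr0 !mul1r.
  by rewrite !E; case: (v1 x).
Qed.

Lemma fourier_component (v : R * R -> R * R) c xi : 
  (if c then (fourier v xi).2 else (fourier v xi).1) = (fourier_cos v c xi +i* fourier_sin v c xi)%C.
Proof.
suff h : cintegral (fun x => expi (dot x xi) * (component c (v x))%:C%C) =
    (cos_transform (fun s x => component c (pderiv s v x)) [::] xi +i*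
     sin_transform (fun s x => component c (pderiv s v x)) [::] xi)%C.
  have -> : (if c then (fourier v xi).2 else (fourier v xi).1) =
      ((2 * pi) ^- 2)%:C%C * cintegral (fun x => expi (dot x xi) * (component c (v x))%:C%C).
    by case: c {h}.
  by rewrite h /fourier_cos /fourier_sin; apply/eqP; rewrite eq_complex /=; apply/andP; split; apply/eqP; ring.
congr Complex; apply: eq_Rintegral => x _ /=.
  by rewrite mulr0 subr0 mulrC dotC.
by rewrite mulr0 add0r mulrC dotC.
Qed.

(** The real parts have integrands that agree off frequency 0. The imaginary part has an odd
    integrand: the data are real, so their cosine transforms are even and their sine transforms
    odd. *)
Lemma wave_formula t x : 0 <= t ->
  cvec (wave_solution t x) = solution_formula kappa rho delta alpha v0 v1 t x.
Proof.
move=> t0.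
have Hc c : ((wave_comp c t x)%:C)%C = cintegral (fun xi => expi (- dot xi x) *
    ((cos (w xi * t))%:C%C * (fourier_cos v0 c xi +i* fourier_sin v0 c xi)%C +
     (sin (w xi * t) / w xi)%:C%C * (fourier_cos v1 c xi +i* fourier_sin v1 c xi)%C)).
  pose sq xi := sin (w xi * t) / w xi.
  pose al xi := cos (w xi * t) * fourier_cos v0 c xi + sq xi * fourier_cos v1 c xi.
  pose be xi := cos (w xi * t) * fourier_sin v0 c xi + sq xi * fourier_sin v1 c xi.
  have sqE xi : sq xi = sinc w t xi - t * iverson (w xi <= 0) by rewrite /sinc addrK.
  have msq : pmeas sq.
    rewrite (_ : sq = (fun xi => sinc w t xi - t * iverson (w xi <= 0))); last exact/funext.
    apply: pmeasB; first exact: pmeas_sinc.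
    apply: pmeasM; first exact: pmeas_cst.
    exact: (pmeas_comp (measurable_cst_le 0) (pmeas_continuous continuous_w)).
  have sqle xi : `|sq xi| <= `|t|.
    rewrite /sq; have [w0|wn0] := eqVneq (w xi) 0; first by rewrite w0 mul0r sin0 mul0r normr0.
    by have := @norm_sinc_le _ w w_ge0 t xi; rewrite sincE.
  have fam f g : fast f -> fast g -> fast (fun xi => cos (w xi * t) * f xi + sq xi * g xi).
    move=> ff fg; apply: fastD.
      apply: (@fast_mul _ _ (fun xi => cos (w xi * t)) 1 0) => //.
        by apply: pmeas_continuous; exact: continuous_cos_w.
      by move=> xi; rewrite mulr1 norm_cos_le1.
    by apply: (@fast_mul _ _ sq `|t| 0) => // xi; rewrite mulr1.
  have fal := fam _ _ (fc0 c) (fc1 c); have fbe := fam _ _ (fs0 c) (fs1 c).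
  congr Complex.
    transitivity (pint (fun xi => cos (dot xi x) * al xi + sin (dot xi x) * be xi)); last first.
      by apply: eq_Rintegral => xi _ /=; rewrite cosN sinN /al /be /sq; ring.
    apply: eq_pint_off0.
    - by apply: osc_integrable; exact: fw.
    - exact: osc_integrable.
    - move=> xi xi0; rewrite /wave sincE ?w_eq0//.
  apply/esym; transitivity (pint (fun xi => cos (dot xi x) * be xi + sin (dot xi x) * - al xi)).
    by apply: eq_Rintegral => xi _ /=; rewrite cosN sinN /al /be /sq; ring.
  apply: pint_odd; first by apply: osc_integrable => //; exact: fastN.
  have wN xi : w (- xi) = w xi by rewrite /w modulusN.
  move=> xi; rewrite /al /be /sq /fourier_cos /fourier_sin wN dotNl cosN sinN.
  by rewrite !cos_transform_even !sin_transform_odd; [ring|exact: schwartz_rapid..].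
rewrite /cvec /wave_solution /= (Hc false) (Hc true).
rewrite /solution_formula /cvintegral; congr (_, _); congr cintegral; apply/funext => xi /=.
  by rewrite -(fourier_component v0 false) -(fourier_component v1 false).
by rewrite -(fourier_component v0 true) -(fourier_component v1 true).
Qed.

End Existence.

(** * Uniqueness *)

Section Hermite.
Variable R : realType.
Implicit Types (x y z v : R * R).

(* The k-th derivative of exp (- r ^ 2) is hermite k r * exp (- r ^ 2). *)
Fixpoint hermite (k : nat) (r : R) : R :=
  if k is k1.+1 then
    - (2 * r) * hermite k1 r - (if k1 is k2.+1 then 2 * k1%:R * hermite k2 r else 0)
  else 1.

Lemma hermiteS k (r : R) : hermite k.+1 r = - (2 * r) * hermite k r - 2 * k%:R * hermite k.-1 r.
Proof. by case: k => [|k] //=; rewrite !mulr0 mul0r. Qed.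

Lemma hermite_derive k (r : R) : is_derive r 1 (hermite k) (- (2 * k%:R) * hermite k.-1 r).
Proof.
suff : is_derive r 1 (hermite k) (- (2 * k%:R) * hermite k.-1 r) /\
       is_derive r 1 (hermite k.+1) (- (2 * k.+1%:R) * hermite k r) by case.
elim: k => [|k [IH1 IH2]].
  split; first by rewrite mulr0 oppr0 mul0r; exact: has_deriv_cst.
  rewrite (_ : hermite 1 = (fun r => - (2 * r))); last first.
    by apply/funext => t; rewrite /= mulr1 subr0.
  by apply: has_deriv_eq; [derive_rules|rewrite /= !mulr1 mulr0 addr0].
split=> //; rewrite (_ : hermite k.+2 = (fun r => - (2 * r) * hermite k.+1 r - 2 * k.+1%:R * hermite k r)); last first.
  by apply/funext => t; rewrite hermiteS.
apply: has_deriv_eq.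
  apply: has_derivB.
    apply: has_derivM; last exact: IH2.
    by apply: has_derivN; apply: has_derivM; [exact: has_deriv_cst|exact: has_deriv_id].
  by apply: has_derivM; [exact: has_deriv_cst|exact: IH1].
rewrite !hermiteS /= -[k.+2%:R]natr1; move: (k.+1%:R) (hermite k r) (hermite k.-1 r) (k%:R : R) => a b c e.
ring.
Qed.

Lemma hermite_gauss_derive k (r : R) :
  is_derive r 1 (fun t => hermite k t * expR (- t ^+ 2)) (hermite k.+1 r * expR (- r ^+ 2)).
Proof.
apply: has_deriv_eq.
  apply: has_derivM; first exact: hermite_derive.
  by apply: has_deriv_exp; apply: has_derivN; apply: has_derivX; exact: has_deriv_id.
by rewrite hermiteS /= expr1; ring.
Qed.

(** With A = 2 |r| + b, the recursion gives 2 |r| A ^ k + 2 k A ^ (k - 1), and 2 k <= b ^ 2 <= b A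
    turns this into at most A ^ (k + 1). *)
Lemma hermite_le (b : R) n k (r : R) : 0 <= b -> 2 * n%:R <= b ^+ 2 -> (k <= n)%N ->
  `|hermite k r| <= (2 * `|r| + b) ^+ k.
Proof.
move=> b0 nb; set A := 2 * `|r| + b.
have A0 : 0 <= A by rewrite addr_ge0// mulr_ge0.
suff H : (k <= n)%N -> `|hermite k r| <= A ^+ k /\ `|hermite k.-1 r| * b <= A ^+ k.-1 * b by case/H.
elim: k => [_|k IH kn] /=; first by rewrite normr1 expr0.
have [IH1 IH2] := IH (ltnW kn); split; last by rewrite ler_wpM2r.
rewrite -[X in `|X|]/(hermite k.+1 r) hermiteS.
apply: le_trans (ler_normB _ _) _; rewrite !normrM normrN normrM (ger0_norm (ler0n _ 2)) (ger0_norm (ler0n _ k)).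
case: k IH1 IH2 kn {IH} => [|k] /= IH1 IH2 kn.
  by rewrite mulr0 mul0r addr0 expr1 normr1 mulr1 /A lerDl.
apply: (@le_trans _ _ (2 * `|r| * A ^+ k.+1 + b * (b * A ^+ k))).
  apply: lerD; first by rewrite ler_wpM2l// mulr_ge0.
  apply: (@le_trans _ _ (b ^+ 2 * `|hermite k r|)).
    by rewrite ler_wpM2r//; apply: le_trans nb; rewrite ler_wpM2l// ler_nat ltnW.
  by rewrite expr2 -mulrA ler_wpM2l// mulrC [leRHS]mulrC.
have bA : b <= A by rewrite /A lerDr mulr_ge0.
have -> : A ^+ k.+2 = 2 * `|r| * A ^+ k.+1 + b * A ^+ k.+1 by rewrite -mulrDl -exprS.
rewrite lerD2l ler_wpM2l//.
by rewrite exprS ler_wpM2r// exprn_ge0.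
Qed.

(** The partial derivative of order (i, j) of [gauss]. *)
Definition hgauss i j z : R := hermite i z.1 * hermite j z.2 * gauss z.

Lemma hgaussE i j z : hgauss i j z =
  (hermite i z.1 * expR (- z.1 ^+ 2)) * (hermite j z.2 * expR (- z.2 ^+ 2)).
Proof. by rewrite /hgauss /gauss /dot -!expr2 opprD expRD; ring. Qed.

Lemma continuous_hermite k : continuous (hermite k).
Proof. move=> r; exact: (is_derive_continuous (hermite_derive k r)). Qed.

Lemma continuous_hgauss i j : continuous (hgauss i j).
Proof.
apply: continuous_planeM; last exact: continuous_gauss.
apply: continuous_planeM; apply: (continuous_plane_comp (@continuous_hermite _)).
  exact: continuous_plane_fst.
exact: continuous_plane_snd.
Qed.

(** In [hgauss_le], 32 ^ n n! comes from (32 u)^n <= 32 ^ n n! exp u, and exp 1 * (exp 1) ^ n from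
    exp ((4 n + 1) / 16) <= exp (1 + n). *)
Definition hgauss_const n : R := expR 1 * (32 * expR 1) ^+ n * n`!%:R.

Lemma hgauss_const_ge0 n : 0 <= hgauss_const n.
Proof. by rewrite !mulr_ge0 ?expR_ge0// exprn_ge0// mulr_ge0// expR_ge0. Qed.

Lemma hgauss_le n i j z : (i + j <= 2 * n)%N ->
  `|hgauss i j z| <= hgauss_const n * expR (- (2^-1 * dot z z)).
Proof.
(* Each order is at most 2 n, and b ^ 2 >= 2 * (2 n) is what [hermite_le] asks; the 1 under the root
   secures b >= 1. *)
move=> ijn; pose b : R := Num.sqrt (4 * n%:R + 1).
have n0 : 0 <= n%:R :> R by [].
have b2 : b ^+ 2 = 4 * n%:R + 1 by rewrite sqr_sqrtr//; lra.
have b1 : 1 <= b.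
  by rewrite -[leLHS](@sqrtr1 R) ler_wsqrtr//; lra.
have b0 := le_trans ler01 b1.
have bn : 2 * (2 * n)%:R <= b ^+ 2 by rewrite b2 natrM; lra.
pose B := 2 * (`|z.1| + `|z.2|) + b.
have B1 : 1 <= B by rewrite /B (le_trans b1)// lerDr mulr_ge0// addr_ge0.
have h : `|hermite i z.1 * hermite j z.2| <= B ^+ (2 * n).
  rewrite normrM; apply: (@le_trans _ _ (B ^+ i * B ^+ j)); last first.
    by rewrite -exprD ler_weXn2l.
  have B0 : 0 <= B by rewrite (le_trans ler01).
  apply: ler_pM => //.
    apply: le_trans (hermite_le _ b0 bn (leq_trans (leq_addr j i) ijn)) _.
    by rewrite lerXn2r ?nnegrE ?addr_ge0 ?mulr_ge0// /B; have := normr_ge0 z.2; lra.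
  apply: le_trans (hermite_le _ b0 bn (leq_trans (leq_addl i j) ijn)) _.
  by rewrite lerXn2r ?nnegrE ?addr_ge0 ?mulr_ge0// /B; have := normr_ge0 z.1; lra.
have dz : dot z z = `|z.1| ^+ 2 + `|z.2| ^+ 2 by rewrite /dot -!expr2 !real_normK ?num_real.
(* One half of |z|^2 is spent here and the other kept as decay; with the share b ^ 2 / 16 one gets B
   ^ 2 <= 32 u. *)
pose u := 2^-1 * dot z z + b ^+ 2 / 16.
have u0 : 0 <= u by rewrite addr_ge0// ?mulr_ge0 ?dot_ge0// sqr_ge0.
have Bu : B ^+ 2 <= 32 * u.
  rewrite /u dz /B; have := sqr_ge0 (`|z.1| - `|z.2|); have := sqr_ge0 (2 * (`|z.1| + `|z.2|) - b).
  nra.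
rewrite /hgauss normrM (ger0_norm (ltW (gauss_gt0 z))).
apply: (@le_trans _ _ (32 ^+ n * (n`!%:R * expR u) * gauss z)).
  rewrite ler_wpM2r ?(ltW (gauss_gt0 z))//; apply: (le_trans h); rewrite exprM.
  apply: (@le_trans _ _ ((32 * u) ^+ n)).
    by rewrite lerXn2r ?nnegrE ?sqr_ge0 ?mulr_ge0.
  by rewrite exprMn ler_wpM2l ?exprn_ge0// exprn_le_expR.
have -> : hgauss_const n * expR (- (2^-1 * dot z z)) =
    32 ^+ n * (n`!%:R * (expR (1 + n%:R) * expR (- (2^-1 * dot z z)))).
  rewrite /hgauss_const exprMn expRD -expRM_natl mulr1.
  ring.
rewrite -mulrA ler_wpM2l ?exprn_ge0// -mulrA ler_wpM2l//.
rewrite /gauss -!expRD ler_expR /u b2; lra.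
Qed.

End Hermite.

(** * Symmetric first and second differences on the line *)

Section SecondDifference.
Variable R : realType.

Lemma derivative_bound0 (f df : R -> R) (M b : R) :
  (forall t : R, is_derive t 1 f (df t)) -> (forall t, `|t| <= `|b| -> `|df t| <= M) ->
  `|f b - f 0| <= M * `|b|.
Proof.
move=> fd dM; have cf (x y : R) : {within `[x, y], continuous f}.
  by apply: continuous_subspaceT => t; exact: (is_derive_continuous (fd t)).
have [b0|b0] := leP 0 b.
  rewrite (ger0_norm b0) -[X in _ * X]subr0.
  have := @derivative_bound_within _ f df M 0 b b0 (fun t _ => fd t) (cf _ _).
  apply => t /andP[t0 tb]; apply: dM.
  by rewrite !ger0_norm// ?ltW.
rewrite distrC (ltr0_norm b0) -[- b]add0r.
apply: (@derivative_bound_within _ f df M b 0 (ltW b0) (fun t _ => fd t) (cf _ _)) => t /andP[bt t0].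
by apply: dM; rewrite !ltr0_norm// lerN2 ltW.
Qed.

Lemma has_deriv_opp (f : R -> R) (t d : R) : is_derive (- t) 1 f d ->
  is_derive t 1 (fun s => f (- s)) (- d).
Proof.
move=> fd; have := has_deriv_comp (f := f) (g := fun s : R => - s) (x := t) fd (has_derivN (has_deriv_id t)).
by move=> H; apply: (has_deriv_eq H); rewrite mulrN1.
Qed.

Lemma symmetric_difference_le (f df : R -> R) (M b : R) :
  (forall t : R, is_derive t 1 f (df t)) -> (forall t, `|t| <= `|b| -> `|df t| <= M) ->
  `|f b - f (- b)| <= 2 * M * `|b|.
Proof.
move=> fd dM; have := @derivative_bound0 (fun t => f t - f (- t)) (fun t => df t - - df (- t)) (2 * M) b.
rewrite oppr0 subrr subr0; apply.
  by move=> t; apply: has_derivB; [exact: fd|exact: has_deriv_opp].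
move=> t tb; rewrite opprK; apply: le_trans (ler_normD _ _) _.
by have := dM _ tb; have := dM (- t); rewrite normrN => /(_ tb); lra.
Qed.

(** The derivative of f t + f (- t) is a symmetric difference of df. Bounding it by its supremum
    gives 2 M instead of the sharp M. *)
Lemma second_difference_le (f df ddf : R -> R) (M b : R) :
  (forall t : R, is_derive t 1 f (df t)) -> (forall t : R, is_derive t 1 df (ddf t)) ->
  (forall t, `|t| <= `|b| -> `|ddf t| <= M) ->
  `|f b + f (- b) - 2 * f 0| <= 2 * M * b ^+ 2.
Proof.
move=> fd dfd dM.
have := @derivative_bound0 (fun t => f t + f (- t)) (fun t => df t + - df (- t)) (2 * M * `|b|) b.
have -> : 2 * M * b ^+ 2 = 2 * M * `|b| * `|b|.
  by rewrite -[b ^+ 2]real_normK ?num_real// expr2 mulrA.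
have -> : 2 * f 0 = f 0 + f 0 by ring.
rewrite oppr0; apply.
  by move=> t; apply: has_derivD; [exact: fd|exact: has_deriv_opp].
move=> t tb; apply: le_trans (symmetric_difference_le dfd (M := M) _) _.
  by move=> r rt; apply: dM; exact: le_trans tb.
have M0 : 0 <= M by apply: le_trans (dM t tb).
by rewrite ler_wpM2l// mulr_ge0.
Qed.

End SecondDifference.

(** * Shifts of the weight and weighted Gaussian integrals *)

Section Weights.
Variable R : realType.
Local Notation P := (measurableTypeR R * measurableTypeR R)%type.
Implicit Types (x y z v b : R * R).

Lemma wtN x : wt (- x) = wt x.
Proof. by rewrite /wt /oneDsqr /= !sqrrN. Qed.

Lemma wt_add x b : wt (x + b) <= 4 * wt b * wt x.
Proof. by have := wt_shift (x + b) (- b); rewrite addrK wtN. Qed.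

Lemma wtX_add m x b : wt (x + b) ^+ m <= (4 * wt b) ^+ m * wt x ^+ m.
Proof.
by rewrite -exprMn lerXn2r ?nnegrE ?(ltW (wt_gt0 _)) ?wt_add// !mulr_ge0// ltW// wt_gt0.
Qed.

Lemma wt_le_mod x : wt x <= (1 + modulus x ^+ 2) ^+ 2.
Proof.
rewrite sqr_modulus /wt /oneDsqr expr2 /dot -!expr2.
by apply: ler_pM; rewrite ?addr_ge0 ?sqr_ge0// lerD2l ?lerDl ?lerDr sqr_ge0.
Qed.

Lemma one_add_modulus_le_wt x : 1 + modulus x <= 2 * wt x.
Proof.
have := dot_le_wt x; rewrite -sqr_modulus; have := modulus_ge0 x.
have := sqr_ge0 (modulus x); have := sqr_ge0 (modulus x - 1).
have -> : (modulus x - 1) ^+ 2 = modulus x ^+ 2 - 2 * modulus x + 1 by ring.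
lra.
Qed.

Lemma wtX_ge1 m x : 1 <= wt x ^+ m.
Proof. by rewrite exprn_ege1// wt_ge1. Qed.

Lemma pmeas2_affine (f : R * R -> R) (s1 s2 : R) b : pmeas f ->
  pmeas2 (fun x y => f (s1 *: x + s2 *: y + b)).
Proof.
move=> mf.
have m : measurable_fun [set: P * P]
    (fun z : P * P => ((s1 * z.1.1 + s2 * z.2.1 + b.1, s1 * z.1.2 + s2 * z.2.2 + b.2) : P)).
  apply/measurable_fun_pairP; split; apply: measurable_funD => //;
    apply: measurable_funD; apply: measurable_funM => //.
  - exact: (measurableT_comp measurable_fst measurable_fst).
  - exact: (measurableT_comp measurable_fst measurable_snd).
  - exact: (measurableT_comp measurable_snd measurable_fst).
  - exact: (measurableT_comp measurable_snd measurable_snd).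
exact: (measurableT_comp mf m).
Qed.

Definition gauss_weight m : R := pint (fun u : R * R => wt u ^+ m * expR (- (2^-1 * dot u u))).

Lemma gauss_weight_integrable m : pintegrable (fun u : R * R => wt u ^+ m * expR (- (2^-1 * dot u u))).
Proof.
have h0 : (0 : R) < 2^-1 by [].
have [C C0 HC] := wt_gaussc_env m h0; apply: (pintegrable_env (C := C)).
  apply: pmeas_continuous; apply: continuous_planeM; last exact: continuous_gaussc.
  by apply: continuous_planeX; exact: continuous_wt.
by move=> u; rewrite ger0_norm// mulr_ge0 ?expR_ge0// wtX_ge0.
Qed.

Lemma gauss_weight_ge0 m : 0 <= gauss_weight m.
Proof. by apply: pint_ge0 => u; rewrite mulr_ge0 ?expR_ge0// wtX_ge0. Qed.

End Weights.

(** * Convolution with derivatives of a Gaussian *)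

Section Mollification.
Variable R : realType.
Implicit Types (x y z v : R * R) (q : R * R -> R).

(** Constant and exponent are explicit because bounds uniform in time are tracked. Continuity is not
    demanded: the time derivatives of a solution enter as pointwise limits. *)
Definition moderate m (C : R) q : Prop := pmeas q /\ forall z, `|q z| <= C * wt z ^+ m.

Lemma moderate_ge0 m C q : moderate m C q -> 0 <= C.
Proof.
move=> [_ /(_ 0)] /(le_trans (normr_ge0 _)); rewrite pmulr_lge0// exprn_gt0// wt_gt0.
exact.
Qed.

Variable s : R.
Hypothesis s01 : 0 < s <= 1.

Let s0 : 0 < s. Proof. by case/andP: s01. Qed.

(** Left unnormalised: the power of s that the true derivative would carry appears in
    [mollify_derive] instead. *)
Definition mollify i j q x : R := pint (fun z => q z * hgauss i j (s^-1 *: (x - z))).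

Lemma moderate_shift_le m C q x u : moderate m C q ->
  `|q (x - s *: u)| <= C * (4 * wt x) ^+ m * wt u ^+ m.
Proof.
move=> mq; have C0 := moderate_ge0 mq; case: mq => _ qC; apply: (le_trans (qC _)).
rewrite -mulrA ler_wpM2l//; rewrite addrC; apply: le_trans (wtX_add _ _ _) _.
rewrite ler_wpM2l ?exprn_ge0 ?mulr_ge0 ?(ltW (wt_gt0 _))//.
rewrite lerXn2r ?nnegrE ?(ltW (wt_gt0 _))// wtN wt_scale_le//.
by rewrite gtr0_norm//; case/andP: s01.
Qed.

Lemma mollify_term_le m C q n i j x u : moderate m C q -> (i + j <= 2 * n)%N ->
  `|q (x - s *: u) * hgauss i j u| <=
   C * (4 * wt x) ^+ m * hgauss_const R n * (wt u ^+ m * expR (- (2^-1 * dot u u))).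
Proof.
move=> mq ij; have C0 := moderate_ge0 mq.
rewrite normrM; apply: le_trans (ler_pM _ _ (moderate_shift_le x u mq) (hgauss_le u ij)) _ => //.
rewrite le_eqVlt; apply/orP; left; apply/eqP; ring.
Qed.

Lemma pmeas_mollify_term q i j x : pmeas q -> pmeas (fun u => q (x - s *: u) * hgauss i j u).
Proof.
move=> mq; apply: pmeasM; last by apply: pmeas_continuous; exact: continuous_hgauss.
have := pmeas_affine (- s) x mq; congr pmeas; apply/funext => u.
by rewrite scaleNr addrC.
Qed.

Lemma mollify_term_integrable m C q i j x : moderate m C q ->
  pintegrable (fun u => q (x - s *: u) * hgauss i j u).
Proof.
move=> mq; have ij : (i + j <= 2 * (i + j))%N by rewrite leq_pmull.
apply: pintegrable_dominated (fun u => mollify_term_le x u mq ij).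
  by apply: pmeas_mollify_term; case: mq.
by apply: pintegrableZ; exact: gauss_weight_integrable.
Qed.

Lemma mollify_flip q i j x z :
  (fun u => q (x - s *: u) * hgauss i j u) (s^-1 *: (x - z)) = q z * hgauss i j (s^-1 *: (x - z)).
Proof. by rewrite /= scalerA mulfV ?gt_eqF// scale1r subKr. Qed.

Let flipE x z : - (s^-1 *: z - s^-1 *: x) = s^-1 *: (x - z).
Proof. by rewrite opprB scalerBr. Qed.

Lemma mollify_integrable m C q i j x : moderate m C q ->
  pintegrable (fun z => q z * hgauss i j (s^-1 *: (x - z))).
Proof.
move=> mq; have si0 : 0 < s^-1 by rewrite invr_gt0.
have := pintegrable_affine (- (s^-1 *: x)) si0 (pintegrable_opp (mollify_term_integrable i j x mq)).
by apply: eq_pintegrable => z; rewrite flipE; exact: mollify_flip.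
Qed.

(** Moves x from the kernel to q. This form serves the bounds, the defining one the
    differentiation. *)
Lemma mollifyE m C q i j x : moderate m C q ->
  mollify i j q x = s ^+ 2 * pint (fun u => q (x - s *: u) * hgauss i j u).
Proof.
move=> mq; have si0 : 0 < s^-1 by rewrite invr_gt0.
have i1 := mollify_term_integrable i j x mq.
rewrite -(pint_opp i1) (pint_affine (- (s^-1 *: x)) si0 (pintegrable_opp i1)).
rewrite mulrA -exprMn mulfV ?gt_eqF// expr1n mul1r; apply: eq_pint => z.
by rewrite flipE; exact/esym/mollify_flip.
Qed.

(** The constant is the same for all s in ]0, 1], because shrinking a shift does not increase its
    weight. *)
Lemma mollify_le m C q n i j x : moderate m C q -> (i + j <= 2 * n)%N ->
  `|mollify i j q x| <= C * (4 ^+ m * gauss_weight R m) * hgauss_const R n * wt x ^+ m.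
Proof.
move=> mq ij; have C0 := moderate_ge0 mq; rewrite (mollifyE _ _ _ mq) normrM.
have H : `|pint (fun u => q (x - s *: u) * hgauss i j u)| <=
    C * (4 * wt x) ^+ m * hgauss_const R n * gauss_weight R m.
  rewrite /gauss_weight -pintZ; last exact: gauss_weight_integrable.
  apply: norm_pint_le; first exact: (mollify_term_integrable i j x mq).
    by apply: pintegrableZ; exact: gauss_weight_integrable.
  by move=> u; exact: mollify_term_le.
apply: (@le_trans _ _ (C * (4 * wt x) ^+ m * hgauss_const R n * gauss_weight R m)).
  rewrite -[leRHS]mul1r; apply: ler_pM => //.
  by rewrite ger0_norm ?sqr_ge0// expr_le1 ?(ltW s0)//; case/andP: s01.
by rewrite exprMn le_eqVlt; apply/orP; left; apply/eqP; ring.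
Qed.

(** Gives dominating functions in z that are locally uniform in x, for continuity and
    differentiation of [mollify]. *)
Lemma mollify_dominated m C q : moderate m C q -> exists2 G : R, 0 <= G & forall x z,
  `|q z| * expR (- (2^-1 * dot (s^-1 *: (x - z)) (s^-1 *: (x - z)))) <=
  C * ((4 * wt x) ^+ m.+1 * G) * env z.
Proof.
move=> mq; have C0 := moderate_ge0 mq; have h0 : (0 : R) < 2^-1 by [].
have [G G0 HG] := wt_gaussc m.+1 h0; exists G => // x z; set u := s^-1 *: (x - z).
have wU : wt z <= 4 * wt x * wt u.
  have zE : z = x - s *: u by rewrite /u scalerA mulfV ?gt_eqF// scale1r subKr.
  rewrite {1}zE addrC; apply: le_trans (wt_add _ _) _.
  rewrite ler_wpM2l ?mulr_ge0 ?(ltW (wt_gt0 _))// wtN wt_scale_le//.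
  by rewrite gtr0_norm//; case/andP: s01.
case: mq => _ qC; rewrite envE ler_pdivlMr ?wt_gt0//.
apply: (@le_trans _ _ (C * wt z ^+ m * expR (- (2^-1 * dot u u)) * wt z)).
  by rewrite ler_wpM2r ?(ltW (wt_gt0 _))// ler_wpM2r ?expR_ge0.
rewrite [leLHS](_ : _ = C * (wt z ^+ m.+1 * expR (- (2^-1 * dot u u)))); last first.
  by rewrite exprS; ring.
rewrite ler_wpM2l//.
apply: (@le_trans _ _ ((4 * wt x * wt u) ^+ m.+1 * expR (- (2^-1 * dot u u)))).
  by rewrite ler_wpM2r ?expR_ge0// lerXn2r ?nnegrE ?mulr_ge0 ?(ltW (wt_gt0 _))// wU.
by rewrite exprMn -mulrA ler_wpM2l ?exprn_ge0 ?mulr_ge0 ?(ltW (wt_gt0 _)).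
Qed.

Lemma continuous_mollify m C q i j : moderate m C q -> continuous (mollify i j q).
Proof.
move=> mq x; have C0 := moderate_ge0 mq; have [G G0 HG] := mollify_dominated mq.
pose D : set (R * R) := [set x' | wt x' < wt x + 1].
pose n := (i + j)%N.
have ij : (i + j <= 2 * n)%N by rewrite leq_pmull.
apply: (@pint_continuous _ _ (fun x' z => q z * hgauss i j (s^-1 *: (x' - z))) x D
  (fun z => hgauss_const R n * (C * ((4 * (wt x + 1)) ^+ m.+1 * G)) * env z)).
- have /cvgrPdist_lt/(_ 1 ltr01) := @continuous_wt R x.
  by apply: filterS => z; rewrite ltr_distlC => /andP[_].
- by move=> z _; exact: pintegrable_meas (mollify_integrable i j z mq).
- move=> z; apply: cvgM; first exact: cvg_cst.
  apply: (@continuous_comp _ _ _ (fun x' : R * R => s^-1 *: (x' - z)) (hgauss i j)); last exact: continuous_hgauss.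
  by apply: cvgZr; apply: cvgB; [exact: cvg_id|exact: cvg_cst].
- by apply: pintegrableZ; exact: integrable_env.
- move=> x' z Dx; rewrite normrM.
  apply: (@le_trans _ _ (`|q z| * (hgauss_const R n * expR (- (2^-1 * dot (s^-1 *: (x' - z)) (s^-1 *: (x' - z))))))).
    by apply: ler_wpM2l => //; exact: hgauss_le.
  rewrite mulrCA -[leRHS]mulrA; apply: ler_wpM2l; first exact: hgauss_const_ge0.
  apply: (le_trans (HG _ _)); rewrite ler_wpM2r ?env_ge0// ler_wpM2l// ler_wpM2r//.
  have h : 4 * wt x' <= 4 * (wt x + 1) by rewrite ler_wpM2l// ltW.
  have h0 : 0 <= 4 * wt x' by rewrite mulr_ge0// ltW// wt_gt0.
  by rewrite lerXn2r// nnegrE// (le_trans h0).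
Qed.

Lemma has_deriv_affine (a b t : R) : has_deriv (fun r => a + r * b) t b.
Proof. by apply: has_deriv_eq; [derive_rules|rewrite /= mulr0 !add0r mulr1]. Qed.

Lemma hgauss_line_derive i j x v (t : R) :
  is_derive t 1 (fun r => hgauss i j (x + r *: v))
    (v.1 * hgauss i.+1 j (x + t *: v) + v.2 * hgauss i j.+1 (x + t *: v)).
Proof.
rewrite (_ : (fun r => _) = (fun r => (hermite i (x.1 + r * v.1) * expR (- (x.1 + r * v.1) ^+ 2)) *
   (hermite j (x.2 + r * v.2) * expR (- (x.2 + r * v.2) ^+ 2)))); last first.
  by apply/funext => r; rewrite hgaussE.
have e1 : (x + t *: v).1 = x.1 + t * v.1 by [].
have e2 : (x + t *: v).2 = x.2 + t * v.2 by [].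
rewrite !hgaussE !e1 !e2; apply: has_deriv_eq.
  apply: has_derivM.
    exact: (has_deriv_comp (g := fun r => x.1 + r * v.1) (hermite_gauss_derive i _) (has_deriv_affine _ _ _)).
  exact: (has_deriv_comp (g := fun r => x.2 + r * v.2) (hermite_gauss_derive j _) (has_deriv_affine _ _ _)).
lazy beta; ring.
Qed.

Lemma mollify_derive m C q i j x v : moderate m C q ->
  is_derive x v (mollify i j q) (s^-1 * (v.1 * mollify i.+1 j q x + v.2 * mollify i j.+1 q x)).
Proof.
move=> mq; have C0 := moderate_ge0 mq; apply/is_derive_line0.
pose n := (i + j).+1.
have ij1 : (i.+1 + j <= 2 * n)%N by rewrite addSn leq_pmull.
have ij2 : (i + j.+1 <= 2 * n)%N by rewrite addnS leq_pmull.
pose U (r : R) z := s^-1 *: (x + r *: v - z).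
pose dF (r : R) z := q z * (s^-1 * (v.1 * hgauss i.+1 j (U r z) + v.2 * hgauss i j.+1 (U r z))).
have -> : s^-1 * (v.1 * mollify i.+1 j q x + v.2 * mollify i j.+1 q x) = pint (dF 0).
  have i1 := mollify_integrable i.+1 j x mq; have i2 := mollify_integrable i j.+1 x mq.
  rewrite /mollify -(pintZ v.1 i1) -(pintZ v.2 i2) -pintD; [|exact: pintegrableZ|exact: pintegrableZ].
  rewrite -pintZ; last by apply: pintegrableD; exact: pintegrableZ.
  by apply: eq_pint => z; rewrite /dF /U scale0r addr0; ring.
have [G G0 HG] := mollify_dominated mq.
pose D := 4 * (4 * wt v * wt x).
have dom r z : `|r| <= 1 -> `|q z| * expR (- (2^-1 * dot (U r z) (U r z))) <= C * (D ^+ m.+1 * G) * env z.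
  move=> r1; apply: (le_trans (HG _ _)); rewrite ler_wpM2r ?env_ge0// ler_wpM2l// ler_wpM2r//.
  rewrite lerXn2r ?nnegrE ?mulr_ge0 ?(ltW (wt_gt0 _))// /D ler_wpM2l//.
  apply: le_trans (wt_add _ _) _; rewrite ler_wpM2r ?(ltW (wt_gt0 _))// ler_wpM2l//.
  exact: wt_scale_le.
apply: (@is_derive_pint _ (fun r z => q z * hgauss i j (U r z)) dF
  (fun z => (s^-1 * ((`|v.1| + `|v.2|) * hgauss_const R n) * (C * (D ^+ m.+1 * G))) * env z) 0 1 ltr01).
- by move=> r _; exact: (mollify_integrable i j (x + r *: v) mq).
- move=> r z _; apply: has_deriv_eq.
    apply: has_derivM; first exact: has_deriv_cst.
    rewrite (_ : (fun r => _) = (fun r => hgauss i j (s^-1 *: (x - z) + r *: (s^-1 *: v)))).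
      exact: hgauss_line_derive.
    by apply/funext => r'; rewrite /U addrAC scalerDr !scalerA (mulrC r').
  have -> : s^-1 *: (x - z) + r *: (s^-1 *: v) = U r z.
    by apply/esym; rewrite /U addrAC scalerDr !scalerA (mulrC r).
  have e1 : (s^-1 *: v).1 = s^-1 * v.1 by [].
  have e2 : (s^-1 *: v).2 = s^-1 * v.2 by [].
  by rewrite e1 e2 /dF; ring.
- by apply: pintegrableZ; exact: integrable_env.
- move=> r z; rewrite subr0 => /ltW r1.
  have e0 := expR_ge0 (- (2^-1 * dot (U r z) (U r z))).
  apply: (@le_trans _ _ (`|q z| * (s^-1 * ((`|v.1| + `|v.2|) * (hgauss_const R n * expR (- (2^-1 * dot (U r z) (U r z)))))))).
    rewrite /dF normrM ler_wpM2l// normrM gtr0_norm ?invr_gt0// ler_wpM2l ?invr_ge0 ?(ltW s0)//.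
    apply: le_trans (ler_normD _ _) _; rewrite mulrDl (normrM v.1) (normrM v.2).
    by apply: lerD; apply: ler_wpM2l => //; exact: hgauss_le.
  have -> : `|q z| * (s^-1 * ((`|v.1| + `|v.2|) * (hgauss_const R n * expR (- (2^-1 * dot (U r z) (U r z)))))) =
    (s^-1 * ((`|v.1| + `|v.2|) * hgauss_const R n)) * (`|q z| * expR (- (2^-1 * dot (U r z) (U r z)))) by ring.
  rewrite -[leRHS]mulrA ler_wpM2l ?dom//.
  by rewrite !mulr_ge0 ?invr_ge0 ?(ltW s0) ?addr_ge0 ?hgauss_const_ge0.
Qed.

(** Two derivatives are lost here, with a factor s ^ (- 2). In the constant 4, one 2 comes from
    [second_difference_le], the other from (|y1| + |y2|)^2 <= 2 |y|^2. *)
Lemma mollify_second_difference m C q i j x y (Z : R) : moderate m C q ->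
  (forall t i' j', `|t| <= 1 -> (i' + j' = (i + j).+2)%N -> `|mollify i' j' q (x + t *: y)| <= Z) ->
  `|mollify i j q (x + y) + mollify i j q (x - y) - 2 * mollify i j q x| <= 4 * s ^- 2 * Z * modulus y ^+ 2.
Proof.
move=> mq HZ.
have L i' j' (t : R) : is_derive t 1 (fun r => mollify i' j' q (x + r *: y))
    (s^-1 * (y.1 * mollify i'.+1 j' q (x + t *: y) + y.2 * mollify i' j'.+1 q (x + t *: y))).
  by apply/is_derive_line; exact: (mollify_derive i' j' (x + t *: y) y mq).
have Z0 : 0 <= Z.
  apply: le_trans (normr_ge0 _) (HZ 0 (i + j).+2 0%N _ _); rewrite ?normr0 ?addn0//.
have := @second_difference_le _ (fun r => mollify i j q (x + r *: y)) _
  (fun t => s^-1 * (y.1 * (s^-1 * (y.1 * mollify i.+2 j q (x + t *: y) + y.2 * mollify i.+1 j.+1 q (x + t *: y)))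
    + y.2 * (s^-1 * (y.1 * mollify i.+1 j.+1 q (x + t *: y) + y.2 * mollify i j.+2 q (x + t *: y)))))
  (s ^- 2 * (2 * Z * modulus y ^+ 2)) 1 (L i j).
rewrite !scale1r scaleN1r scale0r addr0 expr1n mulr1 => H.
have -> : 4 * s ^- 2 * Z * modulus y ^+ 2 = 2 * (s ^- 2 * (2 * Z * modulus y ^+ 2)) by ring.
apply: H.
move=> t; rewrite normr1 => t1.
have h1 : `|mollify i.+2 j q (x + t *: y)| <= Z by apply: HZ; rewrite ?addSn ?addnS.
have h2 : `|mollify i.+1 j.+1 q (x + t *: y)| <= Z by apply: HZ; rewrite ?addSn ?addnS.
have h3 : `|mollify i j.+2 q (x + t *: y)| <= Z by apply: HZ; rewrite ?addSn ?addnS.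
set a := mollify _ _ _ _ in h1 *; set b := mollify _ _ _ _ in h2 *; set c := mollify _ _ _ _ in h3 *.
have -> : s^-1 * (y.1 * (s^-1 * (y.1 * a + y.2 * b)) + y.2 * (s^-1 * (y.1 * b + y.2 * c))) =
   s ^- 2 * (y.1 ^+ 2 * a + 2 * (y.1 * y.2) * b + y.2 ^+ 2 * c) by rewrite -exprVn; ring.
rewrite normrM gtr0_norm ?invr_gt0 ?exprn_gt0// ler_wpM2l ?invr_ge0 ?exprn_ge0 ?(ltW s0)//.
rewrite sqr_modulus /dot -!expr2.
apply: (@le_trans _ _ (y.1 ^+ 2 * Z + `|2 * (y.1 * y.2)| * Z + y.2 ^+ 2 * Z)).
  apply: le_trans (ler_normD _ _) _; apply: lerD.
    apply: le_trans (ler_normD _ _) _; apply: lerD; rewrite normrM.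
      by rewrite (ger0_norm (sqr_ge0 _)) ler_wpM2l ?sqr_ge0.
    by rewrite ler_wpM2l.
  by rewrite normrM (ger0_norm (sqr_ge0 _)) ler_wpM2l ?sqr_ge0.
have yy : `|2 * (y.1 * y.2)| <= y.1 ^+ 2 + y.2 ^+ 2.
  rewrite ler_norml; have := sqr_ge0 (y.1 - y.2); have := sqr_ge0 (y.1 + y.2).
  by move=> k1 k2; apply/andP; split; nra.
rewrite -!mulrDl mulrAC ler_wpM2r//; lra.
Qed.

End Mollification.

(** * The truncated operator on functions of polynomial growth *)

Section TruncatedOperator.
Variable R : realType.
Implicit Types (x y z v : R * R) (q : R * R -> R).
Variables (al delta : R).
Hypotheses (al01 : 0 < al < 1) (delta_gt0 : 0 < delta).

Definition truncated (eps : R) q x : R :=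
  pint (singular al (in_annulus eps delta) (fun y => q x - q (x - y))).

Let k (eps : R) y : R := singular al (in_annulus eps delta) (fun=> 1) y.

Let k_ge0 eps y : 0 <= k eps y. Proof. exact: kernel_ge0. Qed.
Let k_int eps : 0 < eps -> pintegrable (k eps). Proof. exact: kernel_integrable. Qed.

Lemma singularE eps q y : singular al (in_annulus eps delta) q y = k eps y * q y.
Proof. by rewrite /k /singular; ring. Qed.

Let wd : R := (1 + delta ^+ 2) ^+ 2.

Lemma wt_le_delta y : modulus y < delta -> wt y <= wd.
Proof.
move=> yd; apply: (le_trans (wt_le_mod y)).
by rewrite lerXn2r ?nnegrE ?addr_ge0 ?sqr_ge0// lerD2l lerXn2r ?nnegrE ?modulus_ge0 ?ltW.
Qed.

(** The kernel is supported within the horizon, where the weight is bounded; so a polynomial weight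
    passes through the operator at the cost of a constant. *)
Lemma kernel_wt eps m y : k eps y * wt y ^+ m <= k eps y * wd ^+ m.
Proof.
have [yd|yd] := ltP (modulus y) delta.
  rewrite ler_wpM2l ?k_ge0// lerXn2r ?nnegrE ?(ltW (wt_gt0 _)) ?wt_le_delta//.
  exact: sqr_ge0.
by rewrite /k /singular /in_annulus (ltNge (modulus y)) yd andbF iverson_false !mul0r.
Qed.

Lemma truncated_term_le eps m C q x y : moderate m C q ->
  `|k eps y * (q x - q (x - y))| <= k eps y * (C * (1 + (4 * wd) ^+ m) * wt x ^+ m).
Proof.
move=> mq; have C0 := moderate_ge0 mq; case: mq => _ qC.
rewrite normrM (ger0_norm (k_ge0 _ _)).
have h : `|q x - q (x - y)| <= C * wt x ^+ m + C * (4 * wt x) ^+ m * wt y ^+ m.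
  apply: le_trans (ler_normB _ _) _; apply: lerD => //.
  apply: (le_trans (qC _)); rewrite -mulrA ler_wpM2l// addrC.
  by apply: le_trans (wtX_add _ _ _) _; rewrite wtN.
apply: le_trans (ler_wpM2l (k_ge0 _ _) h) _.
have -> : k eps y * (C * wt x ^+ m + C * (4 * wt x) ^+ m * wt y ^+ m) =
   k eps y * (C * wt x ^+ m) + C * (4 * wt x) ^+ m * (k eps y * wt y ^+ m) by ring.
have -> : k eps y * (C * (1 + (4 * wd) ^+ m) * wt x ^+ m) =
   k eps y * (C * wt x ^+ m) + C * (4 * wt x) ^+ m * (k eps y * wd ^+ m).
  by rewrite !exprMn; ring.
rewrite lerD2l ler_wpM2l ?kernel_wt//.
by rewrite mulr_ge0// exprn_ge0// mulr_ge0 ?(ltW (wt_gt0 _)).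
Qed.

Lemma truncated_integrable eps m C q x : 0 < eps -> moderate m C q ->
  pintegrable (singular al (in_annulus eps delta) (fun y => q x - q (x - y))).
Proof.
move=> e0 mq; apply: (pintegrable_dominated
  (g := fun y => (C * (1 + (4 * wd) ^+ m) * wt x ^+ m) * k eps y)).
- apply: pmeas_singular; first exact: pmeas_annulus.
  apply: pmeasB; first exact: pmeas_cst.
  case: mq => mq _; have := pmeas_affine (-1) x mq; congr pmeas; apply/funext => y.
  by rewrite scaleN1r addrC.
- by apply: pintegrableZ; exact: k_int.
- by move=> y; rewrite singularE [leRHS]mulrC; exact: truncated_term_le.
Qed.

Lemma continuous_truncated eps m C q : 0 < eps -> continuous q -> moderate m C q ->
  continuous (truncated eps q).
Proof.
move=> e0 cq mq x; have C0 := moderate_ge0 mq.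
pose D : set (R * R) := [set x' | wt x' < wt x + 1].
apply: (@pint_continuous _ _ (fun x' y => singular al (in_annulus eps delta) (fun y => q x' - q (x' - y)) y) x D
  (fun y => (C * (1 + (4 * wd) ^+ m) * (wt x + 1) ^+ m) * k eps y)).
- have /cvgrPdist_lt/(_ 1 ltr01) := @continuous_wt R x.
  by apply: filterS => z; rewrite ltr_distlC => /andP[_].
- by move=> z _; exact: pintegrable_meas (truncated_integrable z e0 mq).
- move=> y; apply: cvgM; first exact: cvg_cst.
  apply: cvgM; first exact: cvg_cst.
  apply: cvgB; first exact: cq.
  apply: (@continuous_comp _ _ _ (fun z : R * R => z - y) q); last exact: cq.
  by apply: cvgB; [exact: cvg_id|exact: cvg_cst].
- by apply: pintegrableZ; exact: k_int.
- move=> z y Dz; rewrite singularE [leRHS]mulrC; apply: (le_trans (truncated_term_le _ _ _ mq)).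
  rewrite ler_wpM2l ?k_ge0// ler_wpM2l//; last first.
    by rewrite lerXn2r ?nnegrE ?addr_ge0 ?(ltW (wt_gt0 _)) ?(ltW Dz).
  by apply: mulr_ge0 => //; apply: addr_ge0 => //; apply: exprn_ge0; apply: mulr_ge0 => //; exact: sqr_ge0.
Qed.

(** Averaging over y and - y trades a first difference for a second one, of size |y|^2, which the
    kernel integrates uniformly in eps. *)
Lemma truncated_symmetric eps m C q x : 0 < eps -> moderate m C q ->
  truncated eps q x = 2^-1 * pint (singular al (in_annulus eps delta) (fun y => 2 * q x - q (x + y) - q (x - y))).
Proof.
move=> e0 mq; have i1 := truncated_integrable x e0 mq.
have i2 := pintegrable_opp i1.
have -> : pint (singular al (in_annulus eps delta) (fun y => 2 * q x - q (x + y) - q (x - y))) =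
   truncated eps q x + truncated eps q x.
  rewrite /truncated -{2}(pint_opp i1) -pintD//; apply: eq_pint => y.
  by rewrite /singular modulusN opprK; ring.
by field.
Qed.

Lemma truncated_bound eps m C q x (S : R) : 0 < eps -> moderate m C q -> 0 <= S ->
  (forall y, modulus y < delta -> `|q (x + y) + q (x - y) - 2 * q x| <= S * modulus y ^+ 2) ->
  `|truncated eps q x| <= 2^-1 * (S * pint (ball_sing al delta)).
Proof.
move=> e0 mq S0 HS; rewrite (truncated_symmetric x e0 mq) normrM ger0_norm// ler_wpM2l//.
have i1 := truncated_integrable x e0 mq.
have ib := ball_sing_integrable al01 delta_gt0.
rewrite -pintZ//; apply: norm_pint_le; last 2 first.
- exact: pintegrableZ.
- apply: singular_le => //; first by move=> r; exact: in_annulus_lt.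
  move=> y yd; have := HS y yd; rewrite -normrN; congr (`|_| <= _); ring.
have := pintegrableD i1 (pintegrable_opp i1); apply: eq_pintegrable => y.
by rewrite /singular modulusN opprK; ring.
Qed.

Variable s : R.
Hypothesis s01 : 0 < s <= 1.

(** Fubini applies because the truncated kernel is integrable; hence commutation is stated for fixed
    eps, not for the principal value. *)
Lemma truncated_mollify eps m C C' q i j x : 0 < eps -> moderate m C q ->
  moderate m C' (truncated eps q) ->
  truncated eps (mollify s i j q) x = mollify s i j (truncated eps q) x.
Proof.
move=> e0 mq mTq; have C0 := moderate_ge0 mq.
rewrite (mollifyE s01 i j x mTq).
pose F y u := s ^+ 2 * (k eps y * ((q (x - s *: u) - q (x - y - s *: u)) * hgauss i j u)).
have it y := mollify_term_integrable s01 i j (x - y) mq.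
have ix := mollify_term_integrable s01 i j x mq.
have iF y : pintegrable (fun u => (q (x - s *: u) - q (x - y - s *: u)) * hgauss i j u).
  by have := pintegrableB ix (it y); apply: eq_pintegrable => u; rewrite mulrBl.
transitivity (pint (fun y => pint (F y))).
  apply: eq_pint => y; rewrite singularE (mollifyE s01 i j x mq) (mollifyE s01 i j (x - y) mq).
  rewrite -mulrBr -pintB// /F pintZ; last exact: pintegrableZ.
  rewrite pintZ// mulrCA; congr (_ * (_ * _)).
  by apply: eq_pint => u; rewrite mulrBl.
(* The constant 16 = 4 * 4 pays for the shifts by y and by s u; the power of [wt y] that remains is
   at most wd ^ m where the kernel is nonzero. *)
rewrite (@pint_swap _ F (fun y => wd ^+ m * k eps y)
  (fun u => (2 * C * (16 * wt x) ^+ m) * (hgauss_const R (i + j) * (wt u ^+ m * expR (- (2^-1 * dot u u)))))).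
- rewrite -pintZ; last exact: (mollify_term_integrable s01 i j x mTq).
  apply: eq_pint => u; rewrite /F /truncated.
  have i1 := truncated_integrable (x - s *: u) e0 mq.
  rewrite [X in _ = _ * X]mulrC -[X in _ = _ * X](pintZ _ i1) -[RHS]pintZ; last exact: pintegrableZ.
  by apply: eq_pint => y; rewrite singularE addrAC; ring.
- have [mmq _] := mq.
  apply: (pmeas2M (f := fun _ _ => s ^+ 2)); first by apply: pmeas2_fst; exact: pmeas_cst.
  apply: pmeas2M; first by apply: pmeas2_fst; exact: (pintegrable_meas (k_int e0)).
  apply: pmeas2M; last by apply: pmeas2_snd; apply: pmeas_continuous; exact: continuous_hgauss.
  apply: pmeas2B.
    apply: pmeas2_snd; have := pmeas_affine (- s) x mmq; congr pmeas; apply/funext => u.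
    by rewrite scaleNr addrC.
  have := pmeas2_affine (-1) (- s) x mmq; congr pmeas2; apply/funext => y; apply/funext => u.
  by rewrite scaleN1r scaleNr addrC addrA.
- by apply: pintegrableZ; exact: k_int.
- by apply: pintegrableZ; apply: pintegrableZ; exact: gauss_weight_integrable.
- move=> y u; rewrite /F.
  have s2 : `|s ^+ 2| <= 1.
    by have /andP[s0 s1] := s01; rewrite ger0_norm ?sqr_ge0// expr_le1// ltW.
  rewrite normrM; apply: (@le_trans _ _ (`|k eps y * ((q (x - s *: u) - q (x - y - s *: u)) * hgauss i j u)|)).
    by rewrite ler_piMl.
  rewrite normrM (ger0_norm (k_ge0 _ _)) (normrM _ (hgauss i j u)).
  have h : `|q (x - s *: u) - q (x - y - s *: u)| <= 2 * C * (16 * wt x) ^+ m * wt u ^+ m * wt y ^+ m.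
    apply: le_trans (ler_normB _ _) _.
    have b1 : `|q (x - s *: u)| <= C * (16 * wt x) ^+ m * wt u ^+ m * wt y ^+ m.
      apply: (le_trans (moderate_shift_le s01 x u mq)).
      rewrite -[leLHS]mulr1; apply: ler_pM; rewrite ?wtX_ge1 ?mulr_ge0 ?exprn_ge0 ?mulr_ge0 ?(ltW (wt_gt0 _))//.
      rewrite ler_wpM2r ?wtX_ge0// ler_wpM2l// lerXn2r ?nnegrE ?mulr_ge0 ?(ltW (wt_gt0 _))//.
      by rewrite ler_wpM2r ?(ltW (wt_gt0 _))// ler_nat.
    have b2 : `|q (x - y - s *: u)| <= C * (16 * wt x) ^+ m * wt u ^+ m * wt y ^+ m.
      apply: (le_trans (moderate_shift_le s01 (x - y) u mq)).
      rewrite [leRHS]mulrAC ler_wpM2r ?wtX_ge0// -[leRHS]mulrA ler_wpM2l// -exprMn.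
      rewrite lerXn2r ?nnegrE ?mulr_ge0 ?(ltW (wt_gt0 _))//.
      have := wt_add (- y) x; rewrite addrC wtN => wb.
      by apply: (le_trans (ler_wpM2l _ wb)) => //; rewrite le_eqVlt; apply/orP; left; apply/eqP; ring.
    by apply: le_trans (lerD b1 b2) _; rewrite le_eqVlt; apply/orP; left; apply/eqP; ring.
  apply: (@le_trans _ _ (k eps y * ((2 * C * (16 * wt x) ^+ m * wt u ^+ m * wt y ^+ m) *
     (hgauss_const R (i + j) * expR (- (2^-1 * dot u u)))))).
    rewrite ler_wpM2l ?k_ge0//; apply: ler_pM => //.
    by apply: hgauss_le; rewrite leq_pmull.
  have -> : k eps y * ((2 * C * (16 * wt x) ^+ m * wt u ^+ m * wt y ^+ m) *
     (hgauss_const R (i + j) * expR (- (2^-1 * dot u u)))) =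
     (k eps y * wt y ^+ m) * (2 * C * (16 * wt x) ^+ m * (hgauss_const R (i + j) * (wt u ^+ m * expR (- (2^-1 * dot u u))))) by ring.
  rewrite ler_wpM2r//.
    rewrite !mulr_ge0 ?exprn_ge0 ?mulr_ge0 ?(ltW (wt_gt0 _)) ?hgauss_const_ge0 ?expR_ge0//.
  by rewrite [leRHS]mulrC; exact: kernel_wt.
Qed.

End TruncatedOperator.

(** * Integration of bounds in time *)

Section Taylor.
Variable R : realType.

Lemma le_of_derive_ge0 (h dh : R -> R) (a b : R) : a <= b ->
  (forall t : R, a <= t <= b -> is_derive t 1 h (dh t)) ->
  (forall t, a <= t <= b -> 0 <= dh t) -> h a <= h b.
Proof.
rewrite le_eqVlt => /predU1P[->//|ab] hd dh0.
have hd' t : t \in `]a, b[ -> is_derive t 1 h (dh t).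
  by rewrite in_itv/= => /andP[at' tb]; apply: hd; rewrite !ltW.
have ch : {within `[a, b], continuous h}.
  apply: continuous_in_subspaceT => t /set_mem /=; rewrite in_itv/= => tab.
  exact: (is_derive_continuous (hd t tab)).
have [c cab E] := MVT ab hd' ch.
rewrite -subr_ge0 E mulr_ge0 ?subr_ge0 ?(ltW ab)//; apply: dh0.
by move: cab; rewrite in_itv/= => /andP[ac cb]; rewrite !ltW.
Qed.

(* The hypothesis |g t| <= L t replaces the initial condition at t = 0, where
   nothing is assumed about g. *)
Lemma taylor_bound (g e : R -> R) (B L T : R) (k : nat) :
  (forall t : R, 0 < t < T -> is_derive t 1 g (e t)) ->
  (forall t, 0 < t < T -> `|g t| <= L * t) ->
  (forall t, 0 < t < T -> `|e t| <= B * (t ^+ k / k`!%:R)) ->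
  forall t, 0 < t < T -> `|g t| <= B * (t ^+ k.+1 / (k.+1)`!%:R).
Proof.
move=> gd gL eB t /andP[t0 tT].
have fk : (k`!%:R : R) != 0 by rewrite pnatr_eq0 -lt0n fact_gt0.
have L0 : 0 <= L.
  by have := le_trans (normr_ge0 _) (gL t _); rewrite t0 tT => /(_ isT); rewrite pmulr_lge0.
have B0 : 0 <= B.
  have := le_trans (normr_ge0 _) (eB t _); rewrite t0 tT => /(_ isT).
  by rewrite pmulr_lge0// divr_gt0 ?exprn_gt0// ltr0n fact_gt0.
pose p r : R := B * (r ^+ k.+1 / (k.+1)`!%:R).
have pd (r : R) : is_derive r 1 p (B * (r ^+ k / k`!%:R)).
  apply: has_deriv_eq.
    apply: has_derivM; first exact: has_deriv_cst.
    by apply: has_derivM; [apply: has_derivX; exact: has_deriv_id|exact: has_deriv_cst].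
  rewrite /= factS natrM; have h1 : (k.+1%:R : R) != 0 by [].
  by move: (k.+1%:R) (k`!%:R) (r ^+ k) (r ^+ k.+1) fk h1 => a b c d hb ha; field; rewrite ha hb.
(* For sg = 1 and sg = -1 these are the two sides of the absolute value: p + sg g has a nonnegative
   derivative and is at least - eta at some small time r. *)
have main (sg : R) : `|sg| = 1 -> 0 <= p t + sg * g t.
  move=> sg1; rewrite -oppr_le0; apply/ler_addgt0Pr => eta eta0.
  (* There |g r| <= L r <= eta; the denominator L + 1 is positive also when L = 0. *)
  pose r := Num.min t (eta / (L + 1)).
  have r0 : 0 < r by rewrite lt_min t0 divr_gt0// ltr_wpDl.
  have rt : r <= t by rewrite ge_min lexx.
  have rin v : r <= v <= t -> 0 < v < T.
    by move=> /andP[rv vt]; rewrite (lt_le_trans r0 rv) (le_lt_trans vt tT).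
  have H : p r + sg * g r <= p t + sg * g t.
    apply: (@le_of_derive_ge0 (fun v => p v + sg * g v) (fun v => B * (v ^+ k / k`!%:R) + sg * e v)) => //.
      move=> v rvt; apply: has_deriv_eq.
        apply: has_derivD; first exact: pd.
        by apply: has_derivM; [exact: has_deriv_cst|exact: (gd v (rin v rvt))].
      by rewrite /= mulr0 addr0.
    move=> v rvt; have := eB v (rin v rvt); rewrite -[`|e v|]mul1r -sg1 -normrM ler_norml => /andP[+ _].
    lra.
  have pr : 0 <= p r by apply: mulr_ge0 => //; rewrite divr_ge0// exprn_ge0// ltW.
  have gr : `|sg * g r| <= eta.
    rewrite normrM sg1 mul1r; apply: le_trans (gL r (rin r _)) _; first by rewrite lexx.
    apply: (@le_trans _ _ (L * (eta / (L + 1)))); first by rewrite ler_wpM2l// ge_min lexx orbT.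
    rewrite mulrCA ler_piMr ?(ltW eta0)// ler_pdivrMr ?mul1r ?lerDl// ltr_wpDl//.
  by move: gr; rewrite ler_norml => /andP[g1 g2]; rewrite add0r; lra.
rewrite ler_norml -/(p t).
have h1 := main 1; have h2 := main (-1); rewrite normr1 in h1; rewrite normrN1 in h2.
by have {}h1 := h1 erefl; have {}h2 := h2 erefl; apply/andP; split; lra.
Qed.

End Taylor.

(** * Vanishing of a moderate solution with zero data *)

Section Vanishing.
Variable R : realType.
Implicit Types (x y z v : R * R).
(** In the application d is a component of the difference of two solutions, e and f are its time
    derivatives, and c0 is - 2 kappa / rho. *)
Variables (al delta T c0 C E F S L : R) (m : nat).
Variables d e f : R -> R * R -> R.
Hypotheses (al01 : 0 < al < 1) (delta_gt0 : 0 < delta).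
Hypothesis d_moderate : forall t : R, 0 < t < T -> moderate m C (d t).
Hypothesis e_moderate : forall t : R, 0 < t < T -> moderate m E (e t).
Hypothesis f_moderate : forall t : R, 0 < t < T -> moderate m F (f t).
Hypothesis d_continuous : forall t : R, 0 < t < T -> continuous (d t).
Hypothesis d_derive : forall (t : R) x, 0 < t < T -> is_derive t 1 (d ^~ x) (e t x).
Hypothesis e_derive : forall (t : R) x, 0 < t < T -> is_derive t 1 (e ^~ x) (f t x).
Hypothesis d_small : forall (t : R) x, 0 < t < T -> `|d t x| <= L * t * wt x ^+ m.
Hypothesis e_small : forall (t : R) x, 0 < t < T -> `|e t x| <= L * t * wt x ^+ m.
Hypothesis f_limit : forall (t : R) x, 0 < t < T ->
  c0 * truncated al delta n.+1%:R^-1 (d t) x @[n --> \oo] --> f t x.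
Hypothesis d_second : forall (t : R) x y, 0 < t < T -> modulus y < delta ->
  `|d t (x + y) + d t (x - y) - 2 * d t x| <= S * wt x ^+ m * modulus y ^+ 2.

Let I : R := pint (ball_sing al delta).
Let wd : R := (1 + delta ^+ 2) ^+ 2.

Let I_ge0 : 0 <= I. Proof. by apply: pint_ge0 => y; exact: ball_sing_ge0. Qed.
Let wd_ge0 : 0 <= wd. Proof. exact: sqr_ge0. Qed.

Section FixedScale.
Variable s : R.
Hypothesis s01 : 0 < s <= 1.

Let s0 : 0 < s. Proof. by case/andP: s01. Qed.

Let W i j t x := mollify s i j (d t) x.

Let mollify_time_derive (p q : R -> R * R -> R) (P Q : R) i j (t : R) x :
  (forall r : R, 0 < r < T -> moderate m P (p r)) -> (forall r : R, 0 < r < T -> moderate m Q (q r)) ->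
  (forall (r : R) z, 0 < r < T -> is_derive r 1 (p ^~ z) (q r z)) -> 0 < t < T ->
  is_derive t 1 (fun r => mollify s i j (p r) x) (mollify s i j (q t) x).
Proof.
move=> mp mq pd /andP[t0 tT].
pose r := Num.min t (T - t).
have r0 : 0 < r by rewrite lt_min t0 subr_gt0.
have rin (v : R) : `|v - t| < r -> 0 < v < T.
  rewrite lt_min ltr_norml => /andP[/andP[h1 _]]; rewrite ltr_norml => /andP[_ h2].
  by apply/andP; split; lra.
have mw : moderate m Q (fun z => Q * wt z ^+ m).
  split; last by move=> z; rewrite ger0_norm// mulr_ge0 ?wtX_ge0// (moderate_ge0 (mq t _))// t0.
  by apply: pmeasM; [exact: pmeas_cst|apply: pmeas_continuous; apply: continuous_planeX; exact: continuous_wt].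
apply: (@is_derive_pint R (fun (v : R) z => p v z * hgauss i j (s^-1 *: (x - z)))
  (fun (v : R) z => q v z * hgauss i j (s^-1 *: (x - z)))
  (fun z => `|Q * wt z ^+ m * hgauss i j (s^-1 *: (x - z))|) t r r0).
- by move=> v' /rin vT; exact: (mollify_integrable s01 i j x (mp v' vT)).
- move=> v' z /rin vT; apply: has_deriv_eq.
    by apply: has_derivM; [exact: (pd v' z vT)|exact: has_deriv_cst].
  by rewrite /= mulr0 add0r mulrC.
- by have := integrable_abse (mollify_integrable s01 i j x mw); exact.
- move=> v' z /rin vT; rewrite (normrM _ (hgauss _ _ _)) (normrM _ (hgauss _ _ _)) ler_wpM2r//.
  have [_ qQ] := mq v' vT; apply: (le_trans (qQ z)).
  exact: ler_norm.
Qed.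

Let truncated_d_le n (t : R) x : 0 < t < T ->
  `|truncated al delta n.+1%:R^-1 (d t) x| <= 2^-1 * (S * I) * wt x ^+ m.
Proof.
move=> tT; have n0 : 0 < n.+1%:R^-1 :> R by rewrite invr_gt0.
(* The sign is extracted from [d_second] at one nonzero y within the horizon. *)
have S0 : 0 <= S * wt x ^+ m.
  have [y /andP[y0 yd]] : exists y : R * R, 0 < modulus y < delta.
    exists (delta / 2, 0); rewrite /modulus /dot /= mulr0 addr0 -expr2 sqrtr_sqr.
    have h2 : 0 < delta / 2 by rewrite divr_gt0.
    by rewrite (gtr0_norm h2) h2 /=; lra.
  have := le_trans (normr_ge0 _) (d_second x tT yd).
  by rewrite pmulr_lge0// exprn_gt0.
apply: le_trans (truncated_bound al01 delta_gt0 n0 (d_moderate tT) S0 (fun y => d_second x tT (y := y))) _.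
by rewrite -/I le_eqVlt; apply/orP; left; apply/eqP; ring.
Qed.

Let truncated_d_moderate n (t : R) : 0 < t < T ->
  moderate m (2^-1 * (S * I)) (truncated al delta n.+1%:R^-1 (d t)).
Proof.
move=> tT; split; last by move=> x; exact: truncated_d_le.
apply: pmeas_continuous; have n0 : 0 < n.+1%:R^-1 :> R by rewrite invr_gt0.
exact: (continuous_truncated al01 delta_gt0 n0 (d_continuous tT) (d_moderate tT)).
Qed.

(** At fixed truncation the operator commutes with the convolution, and the bound uniform in n lets
    the limit pass under the integral. *)
Let mollify_f_limit i j (t : R) x : 0 < t < T ->
  c0 * truncated al delta n.+1%:R^-1 (W i j t) x @[n --> \oo] --> mollify s i j (f t) x.
Proof.
move=> tT.
have H : pint (fun z => c0 * truncated al delta n.+1%:R^-1 (d t) z * hgauss i j (s^-1 *: (x - z))) @[n --> \oo]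
    --> mollify s i j (f t) x.
  pose K := `|c0| * (2^-1 * (S * I)).
  have K0 : 0 <= K.
    by rewrite mulr_ge0// (moderate_ge0 (truncated_d_moderate 0 tT)).
  have mw : moderate m K (fun z => K * wt z ^+ m).
    split; last by move=> z; rewrite ger0_norm// mulr_ge0 ?wtX_ge0.
    by apply: pmeasM; [exact: pmeas_cst|apply: pmeas_continuous; apply: continuous_planeX; exact: continuous_wt].
  apply: (@pint_cvg _ _ _ (fun z => `|K * wt z ^+ m * hgauss i j (s^-1 *: (x - z))|)).
  - move=> n; have := pintegrable_meas (pintegrableZ c0 (mollify_integrable s01 i j x (truncated_d_moderate n tT))).
    by congr pmeas; apply/funext => z; rewrite mulrA.
  - by move=> z; apply: cvgM; [exact: f_limit|exact: cvg_cst].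
  - by have := integrable_abse (mollify_integrable s01 i j x mw); exact.
  - move=> n z; rewrite (normrM _ (hgauss _ _ _)) (normrM _ (hgauss _ _ _)) ler_wpM2r//.
    rewrite (ger0_norm (mulr_ge0 K0 (wtX_ge0 _ _))) /K normrM -mulrA ler_wpM2l//.
    exact: truncated_d_le.
apply: cvg_trans H; apply: near_eq_cvg; apply: nearW => n.
have n0 : 0 < n.+1%:R^-1 :> R by rewrite invr_gt0.
rewrite /W (truncated_mollify al01 delta_gt0 s01 i j x n0 (d_moderate tT) (truncated_d_moderate n tT)).
rewrite /mollify -pintZ; last exact: (mollify_integrable s01 i j x (truncated_d_moderate n tT)).
by apply: eq_pint => z; rewrite mulrA.
Qed.

(** The cost of one step: c0 from the equation, 2 s ^ (- 2) I from half of the constant 4 s ^ (- 2)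
    of the second difference, and (4 wd)^m for moving the weight from x + v y back to x. *)
Let growth : R := `|c0| * (2 * s ^- 2 * I * (4 * wd) ^+ m).

Let growth_ge0 : 0 <= growth.
Proof.
apply: mulr_ge0 => //; apply: mulr_ge0; last by apply: exprn_ge0; exact: mulr_ge0.
by apply: mulr_ge0 => //; rewrite divr_ge0// exprn_ge0// ltW.
Qed.

Let W_bound (N : nat) : R := C * (4 ^+ m * gauss_weight R m) * hgauss_const R N.

Let W_bound_ge0 N : 0 < T -> 0 <= W_bound N.
Proof.
move=> T0; have tT : 0 < T / 2 < T by apply/andP; split; lra.
have C0 := moderate_ge0 (d_moderate tT).
by rewrite mulr_ge0 ?hgauss_const_ge0// mulr_ge0// mulr_ge0 ?gauss_weight_ge0// exprn_ge0.
Qed.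

(** Induction on the number n of completed steps: each one lowers the order by two and raises the
    power of t by two, so n = N concerns the undifferentiated convolution. *)
Lemma mollify_decay N n i j (t : R) x : (n <= N)%N -> (i + j = 2 * (N - n))%N -> 0 < t < T ->
  `|W i j t x| <= W_bound N * growth ^+ n * wt x ^+ m * (t ^+ (2 * n) / (2 * n)`!%:R).
Proof.
elim: n i j t x => [|n IH] i j t x nN ij tT.
  rewrite !expr0 mulr1 fact0 divr1 !mulr1.
  by apply: (mollify_le s01 x (d_moderate tT)); rewrite ij subn0.
have T0 : 0 < T by case/andP: tT => a b; exact: lt_trans b.
have Wb0 := W_bound_ge0 N T0.
pose B := W_bound N * growth ^+ n.+1 * wt x ^+ m.
have tt (r : R) : 0 < r < T -> 0 <= r ^+ (2 * n) / (2 * n)`!%:R.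
  by move=> /andP[r0 _]; rewrite divr_ge0// exprn_ge0// ltW.
(* Through the equation, the second time derivative is controlled by second differences of [W], that
   is by values of order 2 (N - n), where the induction hypothesis applies. *)
have fB (r : R) : 0 < r < T -> `|mollify s i j (f r) x| <= B * (r ^+ (2 * n) / (2 * n)`!%:R).
  move=> rT; have r00 := tt r rT.
  have H := @mollify_f_limit i j r x rT.
  have Hn : `|c0 * truncated al delta k.+1%:R^-1 (W i j r) x| @[k --> \oo] --> `|mollify s i j (f r) x|.
    exact: cvg_norm.
  rewrite -(cvg_lim _ Hn)//; apply: limr_le; first by apply/cvg_ex; eexists; exact: Hn.
  apply: nearW => k; have k0 : 0 < k.+1%:R^-1 :> R by rewrite invr_gt0.
  have mW : moderate m (W_bound (i + j)) (W i j r).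
    split; first by apply: pmeas_continuous; exact: (@continuous_mollify _ _ s01 m C _ i j (d_moderate rT)).
    by move=> z; apply: (mollify_le s01 z (d_moderate rT)); rewrite leq_pmull.
  pose Z := W_bound N * growth ^+ n * ((4 * wd) ^+ m * wt x ^+ m) * (r ^+ (2 * n) / (2 * n)`!%:R).
  have Z0 : 0 <= Z.
    apply: mulr_ge0 => //; apply: mulr_ge0; first by apply: mulr_ge0 => //; exact: exprn_ge0.
    by apply: mulr_ge0; [apply: exprn_ge0; exact: mulr_ge0|exact: wtX_ge0].
  have S'0 : 0 <= 4 * s ^- 2 * Z by apply: mulr_ge0 => //; rewrite divr_ge0// exprn_ge0// ltW.
  have sd y : modulus y < delta ->
      `|W i j r (x + y) + W i j r (x - y) - 2 * W i j r x| <= 4 * s ^- 2 * Z * modulus y ^+ 2.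
    move=> yd; apply: (mollify_second_difference s01 (d_moderate rT)) => v i' j' v1 ij'.
    have ij2 : (i' + j' = 2 * (N - n))%N.
      by rewrite ij' ij -(addn2 (2 * _)) -[2%N in RHS]/2%N; rewrite -[X in (_ + X)%N]muln1 -mulnDr addn1 subnSK.
    apply: le_trans (IH i' j' r (x + v *: y) (ltnW nN) ij2 rT) _.
    rewrite ler_wpM2r// ler_wpM2l//; first by apply: mulr_ge0 => //; exact: exprn_ge0.
    apply: le_trans (wtX_add _ _ _) _; rewrite ler_wpM2r ?wtX_ge0//.
    have wv : wt (v *: y) <= wd.
      by apply: le_trans (wt_scale_le y v1) _; exact: wt_le_delta.
    have h : 4 * wt (v *: y) <= 4 * wd by rewrite ler_wpM2l.
    have h0 : 0 <= 4 * wt (v *: y) by rewrite mulr_ge0// ltW// wt_gt0.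
    by rewrite lerXn2r// nnegrE// (le_trans h0).
  have tb := truncated_bound al01 delta_gt0 k0 mW S'0 sd.
  rewrite normrM; apply: le_trans (ler_wpM2l (normr_ge0 _) tb) _.
  rewrite -/I /B /Z (exprS growth n) le_eqVlt; apply/orP; left; apply/eqP.
  move: (growth ^+ n) (r ^+ (2 * n) / _) => gn a; rewrite /growth.
  by move: ((s ^+ 2)^-1) (W_bound N) ((4 * wd) ^+ m) (wt x ^+ m) => b c k1 k2; field.
(* The linear smallness that [taylor_bound] asks for at t = 0; its constant may depend on i and j,
   since the conclusion does not contain it. *)
have c (q : R -> R * R -> R) (P : R) : (forall (r : R) z, 0 < r < T -> `|q r z| <= L * r * wt z ^+ m) ->
    (forall r : R, 0 < r < T -> moderate m P (q r)) ->
    forall r : R, 0 < r < T -> `|mollify s i j (q r) x| <= (L * (4 ^+ m * gauss_weight R m) * hgauss_const R (i + j) * wt x ^+ m) * r.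
  move=> qs mq r rT; have mq' : moderate m (L * r) (q r).
    by split; [case: (mq r rT)|move=> z; exact: qs].
  have := mollify_le s01 x mq' (n := i + j) (i := i) (j := j); rewrite leq_pmull// => /(_ isT).
  by congr (_ <= _); ring.
have d1 (r : R) (rT : 0 < r < T) := mollify_time_derive i j x d_moderate e_moderate d_derive rT.
have d2 (r : R) (rT : 0 < r < T) := mollify_time_derive i j x e_moderate f_moderate e_derive rT.
(* Two integrations in time, from f to e and from e to d. *)
have eB := taylor_bound d2 (c e E e_small e_moderate) fB.
have dB := taylor_bound d1 (c d C d_small d_moderate) eB.
have := dB t tT; rewrite /B mulnS add2n; exact.
Qed.

Lemma mollify_vanish (t : R) x : 0 < t < T -> mollify s 0 0 (d t) x = 0.
Proof.
move=> tT; have [t0 tT'] := andP tT; have T0 := lt_trans t0 tT'.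
have C0 := moderate_ge0 (d_moderate tT).
(* Collects what is raised to the power N: 32 e from [hgauss_const], [growth] from the steps, t ^ 2
   from the integrations. [K] holds the rest. *)
pose A := 32 * expR 1 * growth * t ^+ 2.
pose K := C * (4 ^+ m * gauss_weight R m) * expR 1 * wt x ^+ m.
have K0 : 0 <= K.
  apply: mulr_ge0; last exact: wtX_ge0.
  apply: mulr_ge0; last exact: expR_ge0.
  apply: mulr_ge0 => //; apply: mulr_ge0; last exact: gauss_weight_ge0.
  exact: exprn_ge0.
have A0 : 0 <= A.
  apply: mulr_ge0; last exact: sqr_ge0.
  by apply: mulr_ge0 => //; apply: mulr_ge0 => //; exact: expR_ge0.
have H N : `|mollify s 0 0 (d t) x| <= K * exp_coeff A N.
  apply: le_trans (mollify_decay x (leqnn N) (_ : 0 + 0 = 2 * (N - N))%N tT) _; first by rewrite subnn.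
  rewrite /W_bound /hgauss_const /K /exp_coeff/= /A.
  have f1 : 0 < (N`!%:R : R) by rewrite ltr0n fact_gt0.
  have f2 : 0 < ((2 * N)`!%:R : R) by rewrite ltr0n fact_gt0.
  (* The quotient of (2 N)! by N!^2 is a binomial coefficient, hence at least 1; the bound becomes a
     term of the exponential series at A. *)
  have fN : N`!%:R * (2 * N)`!%:R^-1 <= N`!%:R^-1 :> R.
    rewrite ler_pdivrMr// mulrC ler_pdivlMr// -natrM ler_nat.
    have := bin_fact (leq_addr N N); rewrite addnK addnn -mul2n => <-.
    by rewrite leq_pmull// bin_gt0 mul2n -addnn leq_addr.
  have AN : (32 * expR 1 * growth * t ^+ 2) ^+ N = (32 * expR 1) ^+ N * growth ^+ N * t ^+ (2 * N).
    by rewrite exprM -exprMn -exprMn.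
  rewrite AN; have g0 : 0 <= growth ^+ N by exact: exprn_ge0.
  have e0 : 0 <= (32 * expR 1 : R) ^+ N by apply: exprn_ge0; apply: mulr_ge0 => //; exact: expR_ge0.
  have t2 : 0 <= t ^+ (2 * N) by apply: exprn_ge0; exact: ltW.
  rewrite [leLHS](_ : _ = C * (4 ^+ m * gauss_weight R m) * expR 1 * wt x ^+ m *
     ((32 * expR 1) ^+ N * growth ^+ N * t ^+ (2 * N)) * (N`!%:R * (2 * N)`!%:R^-1)); last by ring.
  rewrite -mulrA; apply: ler_wpM2l => //; apply: ler_wpM2l => //.
  by apply: mulr_ge0 => //; apply: mulr_ge0.
have L0 : K * exp_coeff A N @[N --> \oo] --> (0 : R).
  by rewrite -(mulr0 K); apply: cvgM; [exact: cvg_cst|exact: cvg_exp_coeff].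
apply/eqP; rewrite -normr_le0 -(cvg_lim _ L0)//; apply: limr_ge.
  by apply/cvg_ex; eexists; exact: L0.
exact: nearW.
Qed.

End FixedScale.

(** Along the widths 1 / (k + 1) the vanishing convolutions converge to pi times d. *)
Lemma vanish (t : R) x : 0 < t < T -> d t x = 0.
Proof.
move=> tT; have md := d_moderate tT.
have C0 := moderate_ge0 md.
have sk01 k : 0 < (k.+1%:R^-1 : R) <= 1 by rewrite invr_gt0 ltr0n invf_le1// ler1n.
have [_ dC] := md.
have H : pint (fun z => d t (x + k.+1%:R^-1 *: z) * gauss z) @[k --> \oo] --> d t x * pi.
  apply: (@gauss_approx_identity _ _ C m) => //; first exact: d_continuous.
    by move=> k; case/andP: (sk01 k) => /ltW -> ->.
  exact: cvg_harmonic.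
have Z k : pint (fun z => d t (x + k.+1%:R^-1 *: z) * gauss z) = 0.
  have i1 := mollify_term_integrable (sk01 k) 0 0 x md.
  have := mollify_vanish (sk01 k) x tT; rewrite (mollifyE (sk01 k) 0 0 x md) => /eqP.
  rewrite mulf_eq0 expf_eq0 /= invr_eq0 pnatr_eq0 /= => /eqP <-.
  rewrite -(pint_opp i1); apply: eq_pint => z.
  rewrite scalerN opprK /hgauss /= !mul1r /gauss dotNl dotNr opprK //.
move: H; rewrite (_ : (fun k => _) = fun=> 0); last exact/funext.
move=> H; have E0 : d t x * pi = 0 by apply: (cvg_seq_eq _ H (cvg_cst (0 : R))).
by move/eqP: E0; rewrite mulf_eq0 (gt_eqF (pi_gt0 R)) orbF => /eqP.
Qed.

End Vanishing.

(** * Second differences of functions of class C^2 *)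

Section C2.
Variable R : realType.
Implicit Types (x y z b : R * R).
Variables (f : R * R -> R * R) (c : bool) (delta C : R) (m : nat).
Hypotheses (delta_gt0 : 0 < delta) (C2f : Cn 2 f).
Hypothesis growth_f : forall x s, (size s <= 2)%N -> modulus (pderiv s f x) <= C * (1 + modulus x) ^+ m.

Let g s x : R := component c (pderiv s f x).

Let C_ge0 : 0 <= C.
Proof.
have := le_trans (modulus_ge0 _) (growth_f 0 (isT : (size [::] <= 2)%N)).
by rewrite modulus0 addr0 expr1n mulr1.
Qed.

Lemma growth_component s x : (size s <= 2)%N -> `|g s x| <= C * 2 ^+ m * wt x ^+ m.
Proof.
move=> s2; apply: le_trans (norm_component _ _) _; apply: le_trans (growth_f x s2) _.
rewrite -mulrA ler_wpM2l// -exprMn lerXn2r ?nnegrE ?one_add_modulus_le_wt//.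
  by rewrite addr_ge0// modulus_ge0.
by rewrite mulr_ge0// ltW// wt_gt0.
Qed.

Let derive_g s i x : (size s < 2)%N -> is_derive x (basis_vector R i) (g s) (g (i :: s) x).
Proof.
move=> s2; apply: is_derive_component; have [/(_ s2 i x) fd _] := C2f s.
by apply: DeriveDef => //; rewrite /=.
Qed.

Let derive_line s i x (t : R) : (size s < 2)%N ->
  is_derive t 1 (fun r => g s (x + r *: basis_vector R i)) (g (i :: s) (x + t *: basis_vector R i)).
Proof. by move=> s2; apply/is_derive_line; exact: derive_g. Qed.

(** [Cn] speaks of iterated partial derivatives along the axes, so the difference is decomposed into
    axis-parallel steps; mixed derivatives enter in a single order. *)
Lemma C2_second_difference x y : modulus y < delta ->
  `|g [::] (x + y) + g [::] (x - y) - 2 * g [::] x| <=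
   3 * (C * 2 ^+ m * (4 * (1 + delta ^+ 2) ^+ 2) ^+ m) * wt x ^+ m * modulus y ^+ 2.
Proof.
move=> yd; set wd := (1 + delta ^+ 2) ^+ 2.
pose M := C * 2 ^+ m * (4 * wd) ^+ m * wt x ^+ m.
have M0 : 0 <= M.
  apply: mulr_ge0; last exact: wtX_ge0.
  apply: mulr_ge0; first by apply: mulr_ge0 => //; exact: exprn_ge0.
  by apply: exprn_ge0; apply: mulr_ge0 => //; exact: sqr_ge0.
(* This box contains every point of the axis-parallel paths, and its points stay within the horizon
   of x. *)
have bM s (a b : R) : (size s <= 2)%N -> `|a| <= `|y.1| -> `|b| <= `|y.2| ->
    `|g s (x + a *: basis_vector R false + b *: basis_vector R true)| <= M.
  move=> s2 ay by2; apply: (le_trans (growth_component _ s2)).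
  rewrite /M -!mulrA ler_wpM2l// ler_wpM2l ?exprn_ge0// -addrA.
  apply: le_trans (wtX_add _ _ _) _; rewrite ler_wpM2r ?wtX_ge0//.
  set p := (_ + _ : R * R).
  have pE : p = (a, b).
    by rewrite /p /basis_vector /=; congr pair; rewrite /=; [change (a * 1 + b * 0 = a)|change (a * 0 + b * 1 = b)]; ring.
  have pd : modulus p < delta.
    apply: le_lt_trans yd; rewrite pE /modulus ler_wsqrtr// /dot /= -!expr2.
    rewrite -[a ^+ 2]real_normK ?num_real// -[b ^+ 2]real_normK ?num_real//.
    rewrite -[y.1 ^+ 2]real_normK ?num_real// -[y.2 ^+ 2]real_normK ?num_real//.
    by apply: lerD; rewrite lerXn2r ?nnegrE.
  have h : 4 * wt p <= 4 * wd by rewrite ler_wpM2l// wt_le_delta.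
  have h0 : 0 <= 4 * wt p by rewrite mulr_ge0// ltW// wt_gt0.
  by rewrite lerXn2r// nnegrE// (le_trans h0).
set e1 := basis_vector R false in bM *; set e2 := basis_vector R true in bM *.
have yE : y = y.1 *: e1 + y.2 *: e2.
  case: (y) => y1 y2 /=; rewrite /e1 /e2 /basis_vector.
  by congr pair; rewrite /=; [change (y1 = y1 * 1 + y2 * 0)|change (y2 = y1 * 0 + y2 * 1)]; ring.
(* At t = y1 this is g (x + y) + g (x - y); at t = 0 it leaves a second difference in the second
   coordinate alone. *)
pose h (t : R) := g [::] (x + y.2 *: e2 + t *: e1) + g [::] (x - y.2 *: e2 + (- t) *: e1).
pose dh (t : R) := g [:: false] (x + y.2 *: e2 + t *: e1) - g [:: false] (x - y.2 *: e2 + (- t) *: e1).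
have hd (t : R) : is_derive t 1 h (dh t).
  have := has_derivD (@derive_line [::] false (x + y.2 *: e2) t isT)
    (has_deriv_opp (@derive_line [::] false (x - y.2 *: e2) (- t) isT)).
  exact.
have hb t : `|t| <= `|y.1| -> `|dh t| <= 2 * M * (`|y.1| + `|y.2|).
  move=> ty.
  have A1 : `|g [:: false] (x + y.2 *: e2 + t *: e1) - g [:: false] (x + y.2 *: e2 + (- t) *: e1)| <= 2 * M * `|t|.
    apply: (symmetric_difference_le (fun r => @derive_line [:: false] false (x + y.2 *: e2) r isT)).
    move=> r rt; rewrite addrAC; apply: bM => //; exact: le_trans ty.
  have A2 : `|g [:: false] (x + (- t) *: e1 + y.2 *: e2) - g [:: false] (x + (- t) *: e1 + (- y.2) *: e2)| <= 2 * M * `|y.2|.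
    apply: (symmetric_difference_le (fun r => @derive_line [:: false] true (x + (- t) *: e1) r isT)).
    by move=> r rt; apply: bM => //; rewrite normrN.
  have -> : dh t = (g [:: false] (x + y.2 *: e2 + t *: e1) - g [:: false] (x + y.2 *: e2 + (- t) *: e1)) +
     (g [:: false] (x + (- t) *: e1 + y.2 *: e2) - g [:: false] (x + (- t) *: e1 + (- y.2) *: e2)).
    have E1 : x - y.2 *: e2 + (- t) *: e1 = x + (- t) *: e1 + (- y.2) *: e2 by rewrite addrAC -scaleNr.
    have E2 : x + y.2 *: e2 + (- t) *: e1 = x + (- t) *: e1 + y.2 *: e2 by rewrite addrAC.
    rewrite /dh E1 E2.
    move: (g [:: false] (x + y.2 *: e2 + t *: e1)) (g [:: false] (x + (- t) *: e1 + y.2 *: e2)) (g _ _) => a1 a2 a3.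
    by ring.
  apply: le_trans (ler_normD _ _) _; apply: le_trans (lerD A1 A2) _.
  by rewrite mulrDr lerD2r ler_wpM2l// mulr_ge0.
have H1 := derivative_bound0 hd hb.
have H2 := @second_difference_le _ _ _ _ M y.2 (fun r => @derive_line [::] true x r isT)
  (fun r => @derive_line [:: true] true x r isT).
have {}H2 : `|g [::] (x + y.2 *: e2) + g [::] (x + (- y.2) *: e2) - 2 * g [::] (x + 0 *: e2)| <= 2 * M * y.2 ^+ 2.
  apply: H2 => r ry; have := @bM [:: true; true] 0 r isT; rewrite normr0 scale0r addr0; exact.
have -> : g [::] (x + y) + g [::] (x - y) - 2 * g [::] x =
   (h y.1 - h 0) + (g [::] (x + y.2 *: e2) + g [::] (x + (- y.2) *: e2) - 2 * g [::] (x + 0 *: e2)).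
  rewrite /h oppr0 !scale0r !addr0 !scaleNr.
  have -> : x + y.2 *: e2 + y.1 *: e1 = x + y by rewrite {3}yE addrAC addrA.
  have -> : x - y.2 *: e2 - y.1 *: e1 = x - y by rewrite {3}yE opprD addrAC addrA.
  by ring.
apply: le_trans (ler_normD _ _) _; apply: le_trans (lerD H1 H2) _.
rewrite sqr_modulus /dot -!expr2 -[y.1 ^+ 2]real_normK ?num_real// -[y.2 ^+ 2]real_normK ?num_real//.
have -> : 3 * (C * 2 ^+ m * (4 * wd) ^+ m) * wt x ^+ m = 3 * M by rewrite /M; ring.
have := sqr_ge0 (`|y.1| - `|y.2|); move: (`|y.1|) (`|y.2|) => a b ab.
(* The constant 3 comes from 2 a ^ 2 + 2 a b + 2 b ^ 2 <= 3 (a ^ 2 + b ^ 2). *)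
have -> : 2 * M * (a + b) * a + 2 * M * b ^+ 2 = M * (2 * a ^+ 2 + 2 * a * b + 2 * b ^+ 2) by ring.
have -> : 3 * M * (a ^+ 2 + b ^+ 2) = M * (3 * (a ^+ 2 + b ^+ 2)) by ring.
rewrite ler_wpM2l//; nra.
Qed.

End C2.

(** * One-sided time derivatives and behaviour at time 0 *)

Section OneSidedDerivative.
Variable R : realType.

Lemma is_derive_seq (g : R -> R) (t l : R) (a : nat -> R) : is_derive t 1 g l ->
  (forall n, a n != 0) -> a n @[n --> \oo] --> (0 : R) ->
  (a n)^-1 * (g (t + a n) - g t) @[n --> \oo] --> l.
Proof.
move=> /is_derive_cvgP H an0 a0 A /H; rewrite /dnbhs /within /= => nA.
have : \forall n \near \oo, a n != 0 -> A ((a n)^-1 * (g (t + a n) - g t)) := a0 _ nA.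
by apply: filterS => n; apply.
Qed.

Lemma time_quotient_component (g : R -> R * R) (t : R) c : 0 <= t -> time_derivable g t ->
  (s - t)^-1 * (component c (g s) - component c (g t)) @[s --> within [set s : R | 0 <= s] t^'] -->
  component c (time_deriv g t).
Proof.
move=> t0 dg; have F := time_filter_proper t0.
have H : time_quotient g t s @[s --> within [set s : R | 0 <= s] t^'] --> time_deriv g t := dg.
by case: c; [exact: (cvg_comp _ _ H (@cvg_snd _ _ _ _ _))|exact: (cvg_comp _ _ H (@cvg_fst _ _ _ _ _))].
Qed.

Lemma time_derivable_is_derive (g : R -> R * R) (t : R) c : 0 < t -> time_derivable g t ->
  is_derive t 1 (fun s => component c (g s)) (component c (time_deriv g t)).
Proof.
move=> t0 dg; have /cvgrPdist_lt H := @time_quotient_component g t c (ltW t0) dg.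
apply/is_derive_cvgP/cvgrPdist_lt => e e0.
have /nbhs_ballP[r /= r0 Hr] := H e e0.
apply/nbhs_ballP; exists (Num.min r t); first by rewrite /= lt_min r0.
move=> h; rewrite /ball /= sub0r normrN lt_min => /andP[hr ht] h0.
have := Hr (t + h); rewrite /ball /= opprD addrA subrr add0r normrN => /(_ hr).
rewrite addrC addrK; apply.
  by rewrite -subr_eq0 addrK.
by move: ht; rewrite ltr_norml => /andP[h1 _]; lra.
Qed.

Lemma initial_bound (g e f : R -> R) (T M : R) :
  (forall t : R, 0 < t < T -> is_derive t 1 g (e t)) ->
  (forall t : R, 0 < t < T -> is_derive t 1 e (f t)) ->
  (forall t, 0 < t < T -> `|f t| <= M) ->
  (forall eta, 0 < eta -> exists2 r, 0 < r & forall s, 0 < s < r -> `|g s| <= eta * s) ->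
  forall t, 0 < t < T -> `|e t| <= M * t /\ `|g t| <= M * T * t.
Proof.
move=> gd ed fM small.
have M0 t : 0 < t < T -> 0 <= M by move=> tT; apply: le_trans (fM t tT).
have MVTb (p q : R -> R) (B a b : R) : 0 < a -> a <= b -> b < T ->
    (forall t : R, 0 < t < T -> is_derive t 1 p (q t)) -> (forall t, a < t < b -> `|q t| <= B) ->
    `|p b - p a| <= B * (b - a).
  move=> a0 ab bT pd qB; apply: (@derivative_bound_within _ p q) => //.
    by move=> t /andP[at' tb]; apply: pd; rewrite (lt_trans a0 at') (lt_trans tb bT).
  apply: continuous_in_subspaceT => t /set_mem /=; rewrite in_itv/= => /andP[at' tb].
  by apply: is_derive_continuous (pd t _); rewrite (lt_le_trans a0 at') (le_lt_trans tb bT).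
have eb t : 0 < t < T -> `|e t| <= M * t.
  move=> tT; have [t0 tT'] := andP tT; have M0' := M0 t tT.
  apply/ler_addgt0Pr => eta eta0.
  (* On [b / 2, b], |g b| + |g (b / 2)| <= (eta / 3) (3 b / 2), which is eta times the length b /
     2. *)
  have eta3 : 0 < eta / 3 by rewrite divr_gt0.
  have [r r0 Hr] := small _ eta3.
  pose b := Num.min (r / 2) t.
  have b0 : 0 < b by rewrite lt_min t0 divr_gt0.
  have bt : b <= t by rewrite ge_min lexx orbT.
  have br : b < r by rewrite (@le_lt_trans _ _ (r / 2)) ?ge_min ?lexx//; lra.
  have b20 : 0 < b / 2 by rewrite divr_gt0.
  have bb : b / 2 < b by lra.
  have gdb v : v \in `]b / 2, b[ -> is_derive v 1 g (e v).
    rewrite in_itv/= => /andP[v1 v2]; apply: gd.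
    by rewrite (lt_trans b20 v1) (lt_trans v2 (le_lt_trans bt tT')).
  have gcb : {within `[b / 2, b], continuous g}.
    apply: continuous_in_subspaceT => v /set_mem /=; rewrite in_itv/= => /andP[v1 v2].
    by apply: is_derive_continuous (gd v _); rewrite (lt_le_trans b20 v1) (le_lt_trans v2 (le_lt_trans bt tT')).
  have [z zb zE] := MVT bb gdb gcb.
  move: zb; rewrite in_itv/= => /andP[z1 z2].
  have z0 : 0 < z := lt_trans b20 z1.
  have ez : `|e z| <= eta.
    have E : `|e z| * (b / 2) <= eta * (b / 2).
      have -> : `|e z| * (b / 2) = `|g b - g (b / 2)|.
        by rewrite zE normrM [`|b - _|]gtr0_norm; [congr (_ * _); field|lra].
      apply: le_trans (ler_normB _ _) _.
      have g1 := Hr b; have g2 := Hr (b / 2).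
      rewrite b0 br in g1; rewrite b20 (lt_trans bb br) in g2.
      by have := g1 isT; have := g2 isT; lra.
    by rewrite -(ler_pM2r b20).
  have zt : z <= t by exact: ltW (lt_le_trans z2 bt).
  have et : `|e t - e z| <= M * (t - z).
    apply: (MVTb e f) => // v /andP[v1 v2]; apply: fM.
    by rewrite (lt_trans z0 v1) (lt_trans v2 tT').
  have -> : e t = (e t - e z) + e z by rewrite subrK.
  apply: le_trans (ler_normD _ _) _.
  have : M * (t - z) <= M * t by rewrite ler_wpM2l//; lra.
  lra.
move=> t tT; split; first exact: eb.
have [t0 tT'] := andP tT; have M0' := M0 t tT; have T0 := lt_trans t0 tT'.
apply/ler_addgt0Pr => eta eta0.
have eta1 : 0 < eta / T by rewrite divr_gt0.
have [r r0 Hr] := small _ eta1.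
pose b := Num.min (r / 2) t.
have b0 : 0 < b by rewrite lt_min t0 divr_gt0.
have bt : b <= t by rewrite ge_min lexx orbT.
have br : b < r by rewrite (@le_lt_trans _ _ (r / 2)) ?ge_min ?lexx//; lra.
have gb : `|g b| <= eta.
  apply: le_trans (Hr b _) _; first by rewrite b0 br.
  rewrite mulrAC ler_pdivrMr// ler_wpM2l ?(ltW eta0)//.
  by apply: ltW; exact: le_lt_trans bt tT'.
have gt : `|g t - g b| <= M * T * (t - b).
  apply: (MVTb g e) => // v /andP[v1 v2].
  have vT : 0 < v < T by rewrite (lt_trans b0 v1) (lt_trans v2 tT').
  by apply: (le_trans (eb v vT)); rewrite ler_wpM2l// ltW//; case/andP: vT.
have -> : g t = (g t - g b) + g b by rewrite subrK.
apply: le_trans (ler_normD _ _) _.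
have : M * T * (t - b) <= M * T * t by rewrite ler_wpM2l ?mulr_ge0 ?(ltW T0)//; lra.
lra.
Qed.

End OneSidedDerivative.

(** * Uniqueness among slowly increasing solutions *)

Section Uniqueness.
Variable R : realType.
Implicit Types (x y z : R * R).
Variables (kappa rho delta alpha : R) (v0 v1 : R * R -> R * R).
Hypotheses (rho_gt0 : 0 < rho) (delta_gt0 : 0 < delta) (alpha01 : 0 < alpha < 1).

(** The growth condition enters through these two bounds; the one on second differences keeps the
    truncated operator bounded uniformly in eps. *)
Lemma solution_bounds w (T : R) c : peridynamic_solution kappa rho delta alpha v0 v1 w ->
  exists C S m, forall t, 0 <= t <= T -> (forall x, `|component c (w t x)| <= C * wt x ^+ m) /\
    forall x y, modulus y < delta ->
    `|component c (w t (x + y)) + component c (w t (x - y)) - 2 * component c (w t x)| <=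
     S * wt x ^+ m * modulus y ^+ 2.
Proof.
move=> sw; have [C [m H]] := sol_growth sw T.
exists (C * 2 ^+ m), (3 * (C * 2 ^+ m * (4 * (1 + delta ^+ 2) ^+ 2) ^+ m)), m => t tT.
have G x s : (size s <= 2)%N -> modulus (pderiv s (w t) x) <= C * (1 + modulus x) ^+ m.
  by move=> s2; exact: H.
have C2w := sol_C2_space sw (proj1 (andP tT)).
split=> [x|x y yd].
  exact: (@growth_component _ (w t) c C m G [::] x isT).
exact: (@C2_second_difference _ (w t) c delta C m delta_gt0 C2w G x y yd).
Qed.

Lemma wtX_weaken (A : R) (m k : nat) x : 0 <= A -> (m <= k)%N -> A * wt x ^+ m <= A * wt x ^+ k.
Proof. by move=> A0 mk; rewrite ler_wpM2l// ler_weXn2l// wt_ge1. Qed.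

(** The principal value is read along eps = 1 / (n + 1), since the convergence theorems are applied
    to sequences. *)
Lemma solution_truncated w c (t : R) x : peridynamic_solution kappa rho delta alpha v0 v1 w -> 0 < t ->
  - 2 * kappa / rho * truncated alpha delta n.+1%:R^-1 (fun z => component c (w t z)) x @[n --> \oo] -->
  component c (time_deriv (time_deriv (w ^~ x)) t).
Proof.
move=> sw t0.
have H : K_truncated kappa delta alpha (w t) x eps @[eps --> 0^'+] --> K kappa delta alpha (w t) x.
  by have := sol_K sw (x := x) t0; rewrite /K_defined /K.
have acvg : n.+1%:R^-1 @[n --> \oo] --> (0 : R)^'+.
  move=> A; rewrite /at_right /within /= => nA.
  have a0 : n.+1%:R^-1 @[n --> \oo] --> (0 : R) by exact: cvg_harmonic.
  have : \forall n \near \oo, 0 < (n.+1%:R^-1 : R) -> A n.+1%:R^-1 := a0 _ nA.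
  by apply: filterS => n; apply; rewrite invr_gt0.
have H1 := cvg_comp _ _ acvg H.
have H2 : component c (K_truncated kappa delta alpha (w t) x n.+1%:R^-1) @[n --> \oo] -->
    component c (K kappa delta alpha (w t) x).
  by case: c; [exact: (cvg_comp _ _ H1 (@cvg_snd _ _ _ _ _))|exact: (cvg_comp _ _ H1 (@cvg_fst _ _ _ _ _))].
have -> : component c (time_deriv (time_deriv (w ^~ x)) t) = rho^-1 * component c (K kappa delta alpha (w t) x).
  have compZ (r : R) z : component c (r *: z) = r * component c z by case: (c).
  by rewrite -(sol_eq sw x t0) compZ mulKf// gt_eqF.
rewrite (_ : (fun n => _) = (fun n => rho^-1 * component c (K_truncated kappa delta alpha (w t) x n.+1%:R^-1))).
  by apply: cvgM; [exact: cvg_cst|exact: H2].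
apply/funext => n; rewrite K_truncatedE.
have -> : - 2 * kappa / rho = rho^-1 * (- 2 * kappa) by rewrite mulrC.
by rewrite -[LHS]mulrA; congr (_ * _); case: (c).
Qed.

Lemma uniqueness w u : peridynamic_solution kappa rho delta alpha v0 v1 w ->
  peridynamic_solution kappa rho delta alpha v0 v1 u ->
  forall t x, 0 <= t -> w t x = u t x.
Proof.
move=> sw su t x t0.
have [->|tn0] := eqVneq t 0; first by rewrite (sol_init sw) (sol_init su).
have {tn0}t0 : 0 < t by rewrite lt_neqAle eq_sym tn0.
suff main c : component c (w t x) - component c (u t x) = 0.
  have := main false; have := main true; rewrite /component.
  by move=> /subr0_eq e2 /subr0_eq e1; rewrite [LHS]surjective_pairing e1 e2 -surjective_pairing.
(* The estimates live on the open interval ]0, T[, which has to contain t. *)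
pose T := t + 1; have T0 : 0 < T by rewrite addr_gt0.
have [C1 [S1 [m1 H1]]] := solution_bounds T c sw.
have [C2 [S2 [m2 H2]]] := solution_bounds T c su.
pose m := (m1 + m2)%N.
pose d (r : R) z := component c (w r z) - component c (u r z).
pose e (r : R) z := component c (time_deriv (w ^~ z) r) - component c (time_deriv (u ^~ z) r).
pose f (r : R) z := component c (time_deriv (time_deriv (w ^~ z)) r) - component c (time_deriv (time_deriv (u ^~ z)) r).
pose c0 := - 2 * kappa / rho.
have inT (r : R) : 0 < r < T -> 0 <= r <= T by move=> /andP[a b]; rewrite !ltW.
have tT0 : 0 <= t <= T by rewrite (ltW t0) lerDl ler01.
have C10 : 0 <= C1.
  by have := le_trans (normr_ge0 _) ((H1 t tT0).1 0); rewrite pmulr_lge0// exprn_gt0// wt_gt0.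
have C20 : 0 <= C2.
  by have := le_trans (normr_ge0 _) ((H2 t tT0).1 0); rewrite pmulr_lge0// exprn_gt0// wt_gt0.
have contc v (r : R) : peridynamic_solution kappa rho delta alpha v0 v1 v -> 0 < r < T ->
    continuous (fun z => component c (v r z)).
  move=> sv rT; apply: continuous_component.
  by have [_] := sol_C2_space sv (proj1 (andP (inT r rT))) [::]; apply.
have modw (r : R) : 0 < r < T -> moderate m C1 (fun z => component c (w r z)).
  move=> rT; split; first by apply: pmeas_continuous; exact: contc.
  move=> z; apply: le_trans ((H1 r (inT r rT)).1 z) _.
  by apply: wtX_weaken => //; rewrite leq_addr.
have modu (r : R) : 0 < r < T -> moderate m C2 (fun z => component c (u r z)).
  move=> rT; split; first by apply: pmeas_continuous; exact: contc.
  move=> z; apply: le_trans ((H2 r (inT r rT)).1 z) _.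
  by apply: wtX_weaken => //; rewrite leq_addl.
have d_cont (r : R) : 0 < r < T -> continuous (d r).
  by move=> rT; apply: continuous_planeB; exact: contc.
have d_mod (r : R) : 0 < r < T -> moderate m (C1 + C2) (d r).
  move=> rT; split; first by apply: pmeas_continuous; exact: d_cont.
  move=> z; apply: le_trans (ler_normB _ _) _; rewrite mulrDl.
  by apply: lerD; [exact: (modw r rT).2|exact: (modu r rT).2].
pose S := `|S1| + `|S2|.
have d_second (r : R) z y : 0 < r < T -> modulus y < delta ->
    `|d r (z + y) + d r (z - y) - 2 * d r z| <= S * wt z ^+ m * modulus y ^+ 2.
  move=> rT yd; have A1 := (H1 r (inT r rT)).2 z y yd; have A2 := (H2 r (inT r rT)).2 z y yd.
  have -> : d r (z + y) + d r (z - y) - 2 * d r z =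
    (component c (w r (z + y)) + component c (w r (z - y)) - 2 * component c (w r z)) -
    (component c (u r (z + y)) + component c (u r (z - y)) - 2 * component c (u r z)).
    by rewrite /d; ring.
  apply: le_trans (ler_normB _ _) _; rewrite /S.
  have -> : (`|S1| + `|S2|) * wt z ^+ m * modulus y ^+ 2 =
    `|S1| * wt z ^+ m * modulus y ^+ 2 + `|S2| * wt z ^+ m * modulus y ^+ 2 by ring.
  apply: lerD; [apply: (le_trans A1)|apply: (le_trans A2)]; rewrite ler_wpM2r ?sqr_ge0//.
    apply: (@le_trans _ _ (`|S1| * wt z ^+ m1)); first by rewrite ler_wpM2r ?wtX_ge0// ler_norm.
    by apply: wtX_weaken => //; rewrite leq_addr.
  apply: (@le_trans _ _ (`|S2| * wt z ^+ m2)); first by rewrite ler_wpM2r ?wtX_ge0// ler_norm.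
  by apply: wtX_weaken => //; rewrite leq_addl.
have d_derive (r : R) z : 0 < r < T -> is_derive r 1 (d ^~ z) (e r z).
  move=> /andP[r0 _]; apply: has_derivB.
    exact: (@time_derivable_is_derive _ (w ^~ z) r c r0 (sol_dt sw (x := z) (ltW r0))).
  exact: (@time_derivable_is_derive _ (u ^~ z) r c r0 (sol_dt su (x := z) (ltW r0))).
have e_derive (r : R) z : 0 < r < T -> is_derive r 1 (e ^~ z) (f r z).
  move=> /andP[r0 _]; apply: has_derivB.
    exact: (@time_derivable_is_derive _ (time_deriv (w ^~ z)) r c r0 (sol_dtt sw (x := z) r0)).
  exact: (@time_derivable_is_derive _ (time_deriv (u ^~ z)) r c r0 (sol_dtt su (x := z) r0)).
have f_lim (r : R) z : 0 < r < T ->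
    c0 * truncated alpha delta n.+1%:R^-1 (d r) z @[n --> \oo] --> f r z.
  move=> rT; have r0 := proj1 (andP rT).
  rewrite (_ : (fun n => _) = (fun n =>
    c0 * truncated alpha delta n.+1%:R^-1 (fun z => component c (w r z)) z -
    c0 * truncated alpha delta n.+1%:R^-1 (fun z => component c (u r z)) z)).
    by apply: cvgB; exact: solution_truncated.
  apply/funext => n; have n0 : 0 < n.+1%:R^-1 :> R by rewrite invr_gt0.
  rewrite -mulrBr; congr (_ * _); rewrite /truncated -pintB.
  - by apply: eq_pint => y; rewrite /d /singular; ring.
  - exact: (truncated_integrable alpha01 delta_gt0 z n0 (modw r rT)).
  - exact: (truncated_integrable alpha01 delta_gt0 z n0 (modu r rT)).
pose M := `|c0| * (2^-1 * (S * pint (ball_sing alpha delta))).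
have S0 : 0 <= S by rewrite addr_ge0.
have M0 : 0 <= M.
  rewrite mulr_ge0// mulr_ge0// mulr_ge0//.
  by apply: pint_ge0 => y; exact: ball_sing_ge0.
have tr_le (r : R) n z : 0 < r < T ->
    `|c0 * truncated alpha delta n.+1%:R^-1 (d r) z| <= M * wt z ^+ m.
  move=> rT; have n0 : 0 < n.+1%:R^-1 :> R by rewrite invr_gt0.
  rewrite normrM /M -mulrA ler_wpM2l//.
  have S0' : 0 <= S * wt z ^+ m by rewrite mulr_ge0// wtX_ge0.
  apply: le_trans (truncated_bound alpha01 delta_gt0 n0 (d_mod r rT) S0' _) _.
    by move=> y yd; exact: d_second.
  by rewrite le_eqVlt; apply/orP; left; apply/eqP; ring.
(* Both the measurability and the bound of f are inherited from the truncated operators, whose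
   bounds do not depend on n. *)
have f_mod (r : R) : 0 < r < T -> moderate m M (f r).
  move=> rT; split.
    apply: (pmeas_cvg (f_ := fun n z => c0 * truncated alpha delta n.+1%:R^-1 (d r) z)).
      move=> n; apply: pmeasM; first exact: pmeas_cst.
      have n0 : 0 < n.+1%:R^-1 :> R by rewrite invr_gt0.
      by apply: pmeas_continuous; exact: (continuous_truncated alpha01 delta_gt0 n0 (d_cont r rT) (d_mod r rT)).
    by move=> z; exact: f_lim.
  move=> z; have /(_ _) L := cvg_norm (f_lim r z rT).
  rewrite -(cvg_lim _ L)//; apply: limr_le; first by apply/cvg_ex; eexists; exact: L.
  by apply: nearW => n; exact: tr_le.
(* Both solutions start at v0 with right derivative v1, so their difference is o(s) at time 0. *)
have small z (eta : R) : 0 < eta -> exists2 r, 0 < r & forall s, 0 < s < r -> `|d s z| <= eta * s.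
  move=> eta0.
  have Q1 := @time_quotient_component _ (w ^~ z) 0 c (lexx 0) (sol_dt sw (x := z) (lexx 0)).
  have Q2 := @time_quotient_component _ (u ^~ z) 0 c (lexx 0) (sol_dt su (x := z) (lexx 0)).
  have F := time_filter_proper (lexx (0 : R)).
  have /(_ _)/cvgrPdist_le/(_ eta eta0)/nbhs_ballP[r /= r0 Hr] := cvgB Q1 Q2.
  exists r => // s /andP[s0 sr].
  have := Hr s; rewrite /ball /= sub0r normrN gtr0_norm// => /(_ sr).
  rewrite gt_eqF// => /(_ isT (ltW s0)).
  rewrite (sol_init_dt sw) (sol_init_dt su) subrr sub0r normrN => qs.
  have {}qs : `|s^-1 * d s z| <= eta.
    apply: le_trans qs; rewrite le_eqVlt; apply/orP; left; apply/eqP; congr `|_|.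
    change (s^-1 * d s z = (s - 0)^-1 * (component c (w s z) - component c (w 0 z)) -
      (s - 0)^-1 * (component c (u s z) - component c (u 0 z))).
    by rewrite subr0 (sol_init sw) (sol_init su) /d; ring.
  by rewrite -ler_pdivrMr// mulrC -[s^-1]gtr0_norm ?invr_gt0// -normrM.
(* The factor 1 + T covers both the bound M r for e and the bound M T r for d. *)
pose L := M * (1 + T).
have bnd (r : R) z : 0 < r < T -> `|e r z| <= M * wt z ^+ m * r /\ `|d r z| <= M * wt z ^+ m * T * r.
  move=> rT; apply: (@initial_bound _ (d ^~ z) (e ^~ z) (f ^~ z) T (M * wt z ^+ m)) => //.
  - by move=> v vT; exact: (f_mod v vT).2.
  - exact: small.
have Mw z : 0 <= M * wt z ^+ m by rewrite mulr_ge0// wtX_ge0.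
have d_small (r : R) z : 0 < r < T -> `|d r z| <= L * r * wt z ^+ m.
  move=> rT; apply: (le_trans (bnd r z rT).2); have [r0 _] := andP rT.
  have -> : L * r * wt z ^+ m = M * wt z ^+ m * (1 + T) * r by rewrite /L; ring.
  by rewrite ler_wpM2r ?(ltW r0)// ler_wpM2l// lerDr.
have e_small (r : R) z : 0 < r < T -> `|e r z| <= L * r * wt z ^+ m.
  move=> rT; apply: (le_trans (bnd r z rT).1); have [r0 _] := andP rT.
  have -> : L * r * wt z ^+ m = M * wt z ^+ m * (1 + T) * r by rewrite /L; ring.
  by rewrite ler_wpM2r ?(ltW r0)// ler_peMr// lerDl ltW.
have L0 : 0 <= L by rewrite mulr_ge0// addr_ge0// ltW.
have e_mod (r : R) : 0 < r < T -> moderate m (L * T) (e r).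
  move=> rT; have [r0 rT'] := andP rT; split.
    (* Steps that keep r + a n below T; e is measurable as the limit of the corresponding difference
       quotients of d. *)
    pose a (n : nat) : R := (T - r) * n.+2%:R^-1.
    have Tr : 0 < T - r by rewrite subr_gt0.
    have a0 n : 0 < a n by rewrite mulr_gt0// invr_gt0.
    have aT n : 0 < r + a n < T.
      rewrite addr_gt0//= -ltrBrDl /a gtr_pMr// invf_lt1// ltr1n.
      by [].
    apply: (pmeas_cvg (f_ := fun n z => (a n)^-1 * (d (r + a n) z - d r z))).
      move=> n; apply: pmeasM; first exact: pmeas_cst.
      by apply: pmeasB; [exact: (d_mod _ (aT n)).1|exact: (d_mod r rT).1].
    move=> z; apply: (is_derive_seq (d_derive r z rT)); first by move=> n; rewrite gt_eqF.
    rewrite -(mulr0 (T - r)); apply: cvgM; first exact: cvg_cst.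
    by have := @cvg_harmonic R; rewrite -cvg_shiftS; apply.
  move=> z; apply: (le_trans (e_small r z rT)); rewrite ler_wpM2r ?wtX_ge0//.
  by rewrite ler_wpM2l// ltW.
have tT : 0 < t < T by rewrite t0 ltrDl ltr01.
apply: (@vanish R alpha delta T c0 (C1 + C2) (L * T) M S L m d e f alpha01 delta_gt0 d_mod e_mod f_mod d_cont
  d_derive e_derive d_small e_small _ _ t x tT) => //.
Qed.

End Uniqueness.

Theorem theorem2p1 (R : realType) (kappa rho delta alpha : R)
    (v0 v1 : R * R -> R * R) (kappa_gt0 : 0 < kappa) (rho_gt0 : 0 < rho)
    (delta_gt0 : 0 < delta) (alpha_gt0 : 0 < alpha) (alpha_lt1 : alpha < 1)
    (schwartz_v0 : schwartz v0) (schwartz_v1 : schwartz v1) :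
  exists u : R -> R * R -> R * R,
    [/\ peridynamic_solution kappa rho delta alpha v0 v1 u,
        forall (t : R) (x : R * R), 0 <= t ->
          cvec (u t x) = solution_formula kappa rho delta alpha v0 v1 t x &
        forall w : R -> R * R -> R * R,
          peridynamic_solution kappa rho delta alpha v0 v1 w ->
          forall (t : R) (x : R * R), 0 <= t -> w t x = u t x].
Proof.
have alpha01 : 0 < alpha < 1 by rewrite alpha_gt0 alpha_lt1.
have sol := wave_peridynamic kappa_gt0 rho_gt0 delta_gt0 alpha01 schwartz_v0 schwartz_v1.
exists (wave_solution kappa rho delta alpha v0 v1); split => //.
  by move=> t x t0; apply: wave_formula.
by move=> w sw; exact: (uniqueness rho_gt0 delta_gt0 alpha01 sw sol).
Qed.
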